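(* Let $H$ be a Hopf algebroid over $B$ and let $P$ be a right $H$-comodule algebra. The following are equivalent: (1) $P$ is anti-cleft. (2) $P$ is an anti-right $H$-Galois extension of $N=P^{\mathrm{co}H}$ that admits a normal basis. (3) $P\cong N\#_\sigma H$ (as right $H$-comodule algebras) is a crossed product, for some $B$-ring $N$ containing $B$ as a subalgebra and some invertible 2-cocycle $(\sigma,\triangleright)$ of $H$ over $N$.
   Context: Let $k$ be a field, $B$ a unital $k$-algebra, $\overline B$ its opposite algebra, $b\mapsto\bar b$ the canonical anti-isomorphism $B\to\overline B$, $B^e=B\otimes\overline B$. $\otimes_B,\otimes_{\overline B}$ are the usual balanced tensor products (right structure of the left factor against left structure of the right factor); $M\diamond_BN=M\otimes N/\langle\bar bm\otimes n-m\otimes bn\rangle$. The Takeuchi product $M\times_BN\subseteq M\diamond_BN$ consists of the $\sum m_i\otimes n_i$ with $\sum m_i\bar a\otimes n_i=\sum m_i\otimes n_ia$ for all $a\in B$. A left bialgebroid over $B$ is an algebra $H$ with algebra maps $s:B\to H$, $t:\overline B\to H$ with commuting images (one writes $b,\bar b$ for $s(b),t(\bar b)$ in products), a coassociative algebra map $\Delta:H\to H\times_BH$, $X\mapsto X_{(1)}\otimes X_{(2)}$, with $\Delta(b\bar cX)=bX_{(1)}\otimes\bar cX_{(2)}$, and $\varepsilon:H\to B$ with $\varepsilon(b\bar cX)=b\varepsilon(X)c$, $\varepsilon(X_{(1)})X_{(2)}=X=\overline{\varepsilon(X_{(2)})}X_{(1)}$, $\varepsilon(1)=1$, $\varepsilon(X\varepsilon(Y))=\varepsilon(XY)=\varepsilon(X\overline{\varepsilon(Y)})$.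 It is a Hopf algebroid if $\lambda:H\otimes_{\overline B}H\to H\diamond_BH$, $X\otimes Y\mapsto X_{(1)}\otimes X_{(2)}Y$ and $\mu:H\otimes_BH\to H\diamond_BH$, $X\otimes Y\mapsto X_{(1)}Y\otimes X_{(2)}$ are bijective; write $X_+\otimes X_-=\lambda^{-1}(X\otimes1)$, $X_{[+]}\otimes X_{[-]}=\mu^{-1}(1\otimes X)$. A right $H$-comodule is a left $\overline B$-module $P$ with coassociative counital left $\overline B$-linear coaction $\delta(p)=p_{(0)}\otimes p_{(1)}\in P\diamond_BH$ (with $\delta(\bar bp)=p_{(0)}\otimes\bar bp_{(1)}$); it is a $\overline B$-bimodule by $p\bar b=\overline{\varepsilon(p_{(1)}b)}p_{(0)}$, and $\delta(P)\subseteq P\times_BH$. A right $H$-comodule algebra is a $\overline B$-ring $P$ (algebra with algebra map $\overline B\to P$) which is a right $H$-comodule such that $\delta:P\to P\times_BH$ is a map of $\overline B$-rings. $P^{\mathrm{co}H}=\{p:\delta(p)=p\otimes1\}$. $P$ is reversible if $P\otimes_{\overline B}H\to P\diamond_BH$, $p\otimes X\mapsto p_{(0)}\otimes p_{(1)}X$ is bijective. Anti-cleft: $P$ is reversible, $B$ is a subalgebra of $P^{\mathrm{co}H}$, and there is a right $H$-colinear, left $B$-linear $\tilde\rho:H\to P$ that admits an anti-skewed inverse, i.e. there is a left $\overline B$-linear and right $B$-linear map $\rho:H\to P$ with $\tilde\rho(X_+)\rho(X_-)=\varepsilon(X)1_P$ and $\rho(X_{[+]})\tilde\rho(X_{[-]})=\overline{\varepsilon(X)}1_P$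 for all $X$. Anti-right $H$-Galois extension of $N=P^{\mathrm{co}H}$: $P\otimes_NP\to P\diamond_BH$, $p\otimes q\mapsto p_{(0)}q\otimes p_{(1)}$ is bijective. Normal basis: $B$ is a subalgebra of $N=P^{\mathrm{co}H}$ and $P\cong N\otimes_BH$ as right $H$-comodules and left $N$-modules. 2-cocycle $(\sigma,\triangleright)$ of $H$ over a $B$-ring $N$ (algebra with algebra map $B\to N$): linear maps $\triangleright:H\otimes N\to N$ and $\sigma:H\otimes_{\overline B}H\to N$ with $(b\bar b'X)\triangleright n=b(X\triangleright n)b'$; $X\triangleright1=\varepsilon(X)$; $X\triangleright(mn)=(X_{(1)}\triangleright m)(X_{(2)}\triangleright n)$; $\sigma(b\bar b'X,Y)=b\sigma(X,Y)b'$; $\sigma(X,1)=\sigma(1,X)=\varepsilon(X)$; $(X_{(1)}\triangleright b)\sigma(X_{(2)},Y)=\sigma(X,bY)$; $(X_{(1)}\triangleright\sigma(Y_{(1)},Z_{(1)}))\sigma(X_{(2)},Y_{(2)}Z_{(2)})=\sigma(X_{(1)},Y_{(1)})\sigma(X_{(2)}Y_{(2)},Z)$; $\sigma(X_{(1)},Y_{(1)})(X_{(2)}Y_{(2)}\triangleright n)=(X_{(1)}\triangleright(Y_{(1)}\triangleright n))\sigma(X_{(2)},Y_{(2)})$; $1\triangleright n=n$. It is invertible if there is $\sigma^{-1}:H\otimes_BH\to N$ with $\sigma^{-1}(b\bar b'X,Y)=b\sigma^{-1}(X,Y)b'$; $\sigma^{-1}(X_{(1)},Y)(X_{(2)}\triangleright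 b)=\sigma^{-1}(X,\bar bY)$; $\sigma(X_{(1)},Y_{(1)})\sigma^{-1}(X_{(2)},Y_{(2)})=X\triangleright(Y\triangleright1)$; $\sigma^{-1}(X_{(1)},Y_{(1)})\sigma(X_{(2)},Y_{(2)})=(XY)\triangleright1$. The crossed product $N\#_\sigma H$ is $N\otimes_BH$ with unit $1\otimes1$, product $(n\otimes X)(m\otimes Y)=n(X_{(1)}\triangleright m)\sigma(X_{(2)},Y_{(1)})\otimes X_{(3)}Y_{(2)}$ and right $H$-comodule algebra structure $n\otimes X\mapsto n\otimes X_{(1)}\otimes X_{(2)}$, $\bar b\mapsto1\otimes\bar b$. *)

(* Defs.v *)
From HB Require Import structures.
From mathcomp Require Import all_boot all_algebra.
From mathcomp Require Import boolp.

Set Implicit Arguments.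
Unset Strict Implicit.
Unset Printing Implicit Defensive.

Import GRing.Theory.
Local Open Scope ring_scope.
Local Open Scope quotient_scope.

Declare Scope tensor_scope.
Reserved Notation "x ⊗ y" (at level 40, left associativity).
Reserved Notation "'\tsum_' ( x ⊗ y <- t ) E"
  (at level 41, x name, y name, t at level 41, E at level 41,
   format "'[' \tsum_ ( x  ⊗  y  <-  t ) '/  '  E ']'").

(* [tensor r l] is the quotient of the k-tensor product of M and N by the     *)
(* span of the elements  r s m (x) n - m (x) l s n  (s : S).  All the balanced *)
(* tensor products below, including the diamond products, are instances.  A   *)
(* list of pairs stands for the sum of the corresponding pure tensors.        *)
Section Tensor.
Variables (k : fieldType) (M N : lmodType k) (S : Type).
Variables (r : S -> M -> M) (l : S -> N -> N).

Inductive tensor_rel : seq (M * N) -> seq (M * N) -> Prop :=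
| TRrefl u : tensor_rel u u
| TRsym u v : tensor_rel u v -> tensor_rel v u
| TRtrans v u w : tensor_rel u v -> tensor_rel v w -> tensor_rel u w
| TRcat u u' v v' :
    tensor_rel u u' -> tensor_rel v v' -> tensor_rel (u ++ v) (u' ++ v')
| TRcatC u v : tensor_rel (u ++ v) (v ++ u)
| TRadd0 n : tensor_rel [:: (0, n)] [::]
| TRaddl m m' n : tensor_rel [:: (m + m', n)] [:: (m, n); (m', n)]
| TRaddr m n n' : tensor_rel [:: (m, n + n')] [:: (m, n); (m, n')]
| TRscale a m n : tensor_rel [:: (a *: m, n)] [:: (m, a *: n)]
| TRbal a s m n : tensor_rel [:: (a *: r s m, n)] [:: (a *: m, l s n)].

Definition tensor_relb : rel (seq (M * N)) := fun u v => `[< tensor_rel u v >].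

Fact tensor_relb_refl : reflexive tensor_relb.
Proof. by move=> u; apply/asboolP; apply: TRrefl. Qed.
Fact tensor_relb_sym : symmetric tensor_relb.
Proof. by move=> u v; apply/asboolP/asboolP; apply: TRsym. Qed.
Fact tensor_relb_trans : transitive tensor_relb.
Proof.
move=> v u w /asboolP uv /asboolP vw; apply/asboolP; exact: TRtrans uv vw.
Qed.

Canonical tensor_equiv :=
  EquivRel tensor_relb tensor_relb_refl tensor_relb_sym tensor_relb_trans.

Definition tensor : Type := {eq_quot tensor_equiv}.

HB.instance Definition _ := Choice.on tensor.
HB.instance Definition _ := EqQuotient.on tensor.

Definition tens (m : M) (n : N) : tensor := \pi_tensor [:: (m, n)].
Definition tensor0 : tensor := \pi_tensor [::].
Definition tensor_add (t u : tensor) : tensor :=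
  \pi_tensor (repr t ++ repr u).
Definition tensor_scale (a : k) (t : tensor) : tensor :=
  \pi_tensor [seq (a *: p.1, p.2) | p <- repr t].
Lemma tensor_piP u v : \pi_tensor u = \pi_tensor v <-> tensor_rel u v.
Proof.
split=> [/eqP|uv].
  by rewrite (eqmodE (tensor_equiv)) => /asboolP.
by apply/eqP; rewrite (eqmodE tensor_equiv); apply/asboolP.
Qed.

Lemma tensor_repr u : tensor_rel (repr (\pi_tensor u)) u.
Proof. by apply/tensor_piP; rewrite reprK. Qed.

Lemma tensor_rel_scale a u v : tensor_rel u v ->
  tensor_rel [seq (a *: p.1, p.2) | p <- u] [seq (a *: p.1, p.2) | p <- v].
Proof.
elim=> {u v} /=.
- by move=> u; apply: TRrefl.
- by move=> u v _ /TRsym.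
- by move=> v u w _ uv _; apply: TRtrans uv.
- by move=> u u' v v' _ uu' _ vv'; rewrite !map_cat; apply: TRcat.
- by move=> u v; rewrite !map_cat; apply: TRcatC.
- by move=> n; rewrite scaler0; apply: TRadd0.
- by move=> m m' n; rewrite scalerDr; apply: TRaddl.
- by move=> m n n'; apply: TRaddr.
- by move=> b m n; rewrite scalerA mulrC -scalerA; apply: TRscale.
- by move=> b s m n; rewrite !scalerA; apply: TRbal.
Qed.

Lemma tensor_add_pi u v :
  tensor_add (\pi_tensor u) (\pi_tensor v) = \pi_tensor (u ++ v).
Proof. by apply/tensor_piP; apply: TRcat; apply: tensor_repr. Qed.

Lemma tensor_scale_pi a u :
  tensor_scale a (\pi_tensor u) = \pi_tensor [seq (a *: p.1, p.2) | p <- u].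
Proof. by apply/tensor_piP/tensor_rel_scale/tensor_repr. Qed.

Lemma tensor_piE t : exists u, t = \pi_tensor u.
Proof. by exists (repr t); rewrite reprK. Qed.

Lemma tensor_rel_catAC u v w : tensor_rel (u ++ (v ++ w)) (v ++ (u ++ w)).
Proof. by rewrite !catA; apply: TRcat (TRcatC _ _) (TRrefl _). Qed.

Fact tensor_addA : associative tensor_add.
Proof.
move=> t u v; have [[t' ->] [u' ->] [v' ->]] :=
  And3 (tensor_piE t) (tensor_piE u) (tensor_piE v).
by rewrite !tensor_add_pi catA.
Qed.

Fact tensor_addC : commutative tensor_add.
Proof. by move=> t u; apply/tensor_piP; apply: TRcatC. Qed.

Fact tensor_add0 : left_id tensor0 tensor_add.
Proof. by move=> t; have [u ->] := tensor_piE t; rewrite tensor_add_pi. Qed.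

Fact tensor_addN : left_inverse tensor0 (tensor_scale (-1)) tensor_add.
Proof.
move=> t; have [u ->] := tensor_piE t.
rewrite tensor_scale_pi tensor_add_pi; apply/tensor_piP.
elim: u => [|[m n] u IHu] /=; first exact: TRrefl.
rewrite -cat1s -[(m, n) :: u]cat1s.
apply: TRtrans (TRcat (TRrefl _) (tensor_rel_catAC _ _ _)) _.
rewrite catA -[[::]]/([::] ++ [::]); apply: TRcat IHu.
apply: TRtrans (TRsym (TRaddl _ _ _)) _.
by rewrite scaleN1r addNr; apply: TRadd0.
Qed.

HB.instance Definition _ := GRing.isZmodule.Build tensor
  tensor_addA tensor_addC tensor_add0 tensor_addN.

Fact tensor_scaleA a b t :
  tensor_scale a (tensor_scale b t) = tensor_scale (a * b) t.
Proof.
have [u ->] := tensor_piE t; rewrite !tensor_scale_pi -map_comp.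
by congr (\pi_tensor _); apply: eq_map => p /=; rewrite scalerA.
Qed.

Fact tensor_scale1 : left_id 1 tensor_scale.
Proof.
move=> t; have [u ->] := tensor_piE t; rewrite tensor_scale_pi.
by congr (\pi_tensor _); rewrite -[RHS]map_id; apply: eq_map => -[m n] /=; rewrite scale1r.
Qed.

Fact tensor_scaleDr : right_distributive tensor_scale +%R.
Proof.
move=> a t t'; have [u ->] := tensor_piE t; have [v ->] := tensor_piE t'.
by rewrite /GRing.add /= tensor_add_pi !tensor_scale_pi tensor_add_pi map_cat.
Qed.

Fact tensor_scaleDl t :
  {morph tensor_scale^~ t : a b / a + b}.
Proof.
move=> a b; have [u ->] := tensor_piE t.
rewrite /GRing.add /= !tensor_scale_pi tensor_add_pi; apply/tensor_piP.
elim: u => [|[m n] u IHu] /=; first exact: TRrefl.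
rewrite -cat1s -[X in tensor_rel _ X]cat1s -[(b *: m, n) :: _]cat1s.
apply: TRtrans (TRcat (TRrefl _) (tensor_rel_catAC _ _ _)).
rewrite catA; apply: TRcat IHu.
by rewrite scalerDl; apply: TRaddl.
Qed.

HB.instance Definition _ := GRing.Zmodule_isLmodule.Build k tensor
  tensor_scaleA tensor_scale1 tensor_scaleDr tensor_scaleDl.

(* The value on t of the map out of the tensor product induced by f,          *)
(* computed on the chosen representative [repr t]: for a balanced f it does   *)
(* not depend on that choice.  In the iterated Sweedler sums below, it is the *)
(* whole expression that does not depend on the choice, by the Takeuchi       *)
(* condition and the linearity axioms.                                        *)
Definition tsum (A : zmodType) (t : tensor) (f : M -> N -> A) : A :=
  \sum_(p <- repr t) f p.1 p.2.

Record balanced (A : lmodType k) (f : M -> N -> A) : Prop := Balanced {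
  balanced_Dl : forall m m' n, f (m + m') n = f m n + f m' n;
  balanced_Dr : forall m n n', f m (n + n') = f m n + f m n';
  balanced_Zl : forall a m n, f (a *: m) n = a *: f m n;
  balanced_Zr : forall a m n, f m (a *: n) = a *: f m n;
  balanced_mid : forall s m n, f (r s m) n = f m (l s n)
}.

Lemma balanced_rel (A : lmodType k) (f : M -> N -> A) u v :
  balanced f -> tensor_rel u v ->
  \sum_(p <- u) f p.1 p.2 = \sum_(p <- v) f p.1 p.2.
Proof.
case=> fDl fDr fZl fZr fb; elim=> {u v} //=.
- by move=> v u w _ -> _ ->.
- by move=> u u' v v' _ uu' _ vv'; rewrite !big_cat /= uu' vv'.
- by move=> u v; rewrite !big_cat /= addrC.
- by move=> n; have := fZl 0 0 n; rewrite !scale0r big_seq1 big_nil.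
- by move=> m m' n; rewrite big_seq1 big_cons big_seq1 fDl.
- by move=> m n n'; rewrite big_seq1 big_cons big_seq1 fDr.
- by move=> a m n; rewrite !big_seq1 fZl fZr.
- by move=> a s m n; rewrite !big_seq1 !fZl fb.
Qed.

Lemma tsum_tens (A : lmodType k) (f : M -> N -> A) m n :
  balanced f -> tsum (tens m n) f = f m n.
Proof.
by move=> fb; rewrite /tsum (balanced_rel fb (tensor_repr _)) big_seq1.
Qed.

Lemma tsumD (A : lmodType k) (f : M -> N -> A) t u :
  balanced f -> tsum (t + u) f = tsum t f + tsum u f.
Proof.
by move=> fb; rewrite {1}/tsum (balanced_rel fb (tensor_repr _)) big_cat.
Qed.

Lemma tsumZ (A : lmodType k) (f : M -> N -> A) a t :
  balanced f -> tsum (a *: t) f = a *: tsum t f.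
Proof.
move=> fb; rewrite {1}/tsum (balanced_rel fb (tensor_repr _)) big_map.
by rewrite scaler_sumr; apply: eq_bigr => p _; rewrite (balanced_Zl fb).
Qed.

Lemma balanced_tens : balanced tens.
Proof.
split=> [m m' n|m n n'|a m n|a m n|s m n].
- by rewrite /GRing.add /= tensor_add_pi; apply/tensor_piP; apply: TRaddl.
- by rewrite [RHS]tensor_add_pi; apply/tensor_piP; apply: TRaddr.
- by rewrite [RHS]tensor_scale_pi.
- rewrite [RHS]tensor_scale_pi; apply/tensor_piP/TRsym; exact: TRscale.
- by apply/tensor_piP; have := TRbal 1 s m n; rewrite !scale1r.
Qed.

End Tensor.

Arguments tens {k M N S r l} m n.
Arguments tsum {k M N S r l A} t f.
Notation "x ⊗ y" := (tens x y) : tensor_scope.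
Notation "'\tsum_' ( x ⊗ y <- t ) E" := (tsum t (fun x y => E)) : tensor_scope.
Local Open Scope tensor_scope.

(* f (x) id and id (x) f. *)
Definition tens_mapl (k : fieldType) (M N : lmodType k) (S : Type)
    (r : S -> M -> M) (l : S -> N -> N) (f : M -> M) (t : tensor r l) :
    tensor r l :=
  \tsum_(m ⊗ n <- t) (f m ⊗ n).
Definition tens_mapr (k : fieldType) (M N : lmodType k) (S : Type)
    (r : S -> M -> M) (l : S -> N -> N) (f : N -> N) (t : tensor r l) :
    tensor r l :=
  \tsum_(m ⊗ n <- t) (m ⊗ f n).

(* The opposite of B is not made into a separate type: an algebra map from    *)
(* the opposite of B is an anti-multiplicative linear map from B, and left    *)
(* modules over the opposite of B are given by their action B -> M -> M.      *)
Definition antimorphism (k : fieldType) (B A : algType k) (t : B -> A) : Prop :=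
  t 1 = 1 /\ forall b c, t (b * c) = t c * t b.

Record opp_module (k : fieldType) (B : algType k) (M : lmodType k)
    (a : B -> M -> M) : Prop := OppModule {
  opp_moduleD : forall b m m', a b (m + m') = a b m + a b m';
  opp_moduleZ : forall b c m, a b (c *: m) = c *: a b m;
  opp_moduleDl : forall b b' m, a (b + b') m = a b m + a b' m;
  opp_moduleZl : forall b c m, a (c *: b) m = c *: a b m;
  opp_module1 : forall m, a 1 m = m;
  opp_moduleM : forall b c m, a (b * c) m = a c (a b m)
}.

Section Diamond.
Variables (k : fieldType) (B H : algType k) (s t : B -> H).

(* M diamond_B H, where a is the left action of the opposite of B on M. *)
Definition diamond (M : lmodType k) (a : B -> M -> M) :=
  tensor a (fun b X => s b * X).

Definition tact (b : B) (X : H) : H := t b * X.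

Definition diamond_act (M : lmodType k) (a : B -> M -> M) (b : B) :
    diamond a -> diamond a :=
  tens_mapr (tact b).

Definition coassociative (Delta : H -> diamond tact) (M : lmodType k)
    (a : B -> M -> M) (d : M -> diamond a) : Prop :=
  forall m,
    \tsum_(m0 ⊗ m1 <- d m) (d m0 ⊗ m1) =
    \tsum_(m0 ⊗ m' <- d m) \tsum_(m1 ⊗ m2 <- Delta m') ((m0 ⊗ m1) ⊗ m2)
    :> diamond (diamond_act (a := a)).

(* The Takeuchi condition for u in P diamond_B H, where P is a ring over the  *)
(* opposite of B through eta.                                                 *)
Definition takeuchi (P : algType k) (eta : B -> P)
    (u : diamond (fun b (p : P) => eta b * p)) : Prop :=
  forall b,
    \tsum_(p ⊗ X <- u) ((p * eta b) ⊗ X) = \tsum_(p ⊗ X <- u) (p ⊗ (X * s b))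
    :> diamond (fun b (p : P) => eta b * p).

Definition diamond_mul (P : algType k) (eta : B -> P)
    (u v : diamond (fun b (p : P) => eta b * p)) :
    diamond (fun b (p : P) => eta b * p) :=
  \tsum_(p ⊗ X <- u) \tsum_(q ⊗ Y <- v) ((p * q) ⊗ (X * Y)).

End Diamond.

Record bialgebroid (k : fieldType) (B H : algType k) := Bialgebroid {
  src : {lrmorphism B -> H};
  tgt : {linear B -> H};
  comul : {linear H -> diamond src (tact tgt)};
  counit : {linear H -> B};
  tgt_anti : antimorphism tgt;
  src_tgtC : forall b c, src b * tgt c = tgt c * src b;
  comul_takeuchi : forall X, takeuchi (eta := tgt) (comul X);
  comul_coassoc : coassociative comul comul;
  comul1 : comul 1 = 1 ⊗ 1;
  comulM : forall X Y,
    comul (X * Y) = diamond_mul (eta := tgt) (comul X) (comul Y);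
  comul_lin : forall b c X,
    comul (src b * tgt c * X) =
    \tsum_(X1 ⊗ X2 <- comul X) ((src b * X1) ⊗ (tgt c * X2));
  counit_lin : forall b c X, counit (src b * tgt c * X) = b * counit X * c;
  counit_l : forall X, \tsum_(X1 ⊗ X2 <- comul X) (src (counit X1) * X2) = X;
  counit_r : forall X, \tsum_(X1 ⊗ X2 <- comul X) (tgt (counit X2) * X1) = X;
  counit1 : counit 1 = 1;
  counitM_src : forall X Y, counit (X * src (counit Y)) = counit (X * Y);
  counitM_tgt : forall X Y, counit (X * tgt (counit Y)) = counit (X * Y)
}.

Section Galois.
Variables (k : fieldType) (B H : algType k) (L : bialgebroid B H).
Local Notation s := (src L).
Local Notation t := (tgt L).

(* H diamond_B H *)
Definition HdH := diamond s (tact t).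
(* H tensored with itself over the opposite of B, and over B *)
Definition HoppH := tensor (fun b (X : H) => X * t b) (fun b (X : H) => t b * X).
Definition HtensH := tensor (fun b (X : H) => X * s b) (fun b (X : H) => s b * X).

Definition lam (u : HoppH) : HdH :=
  \tsum_(X ⊗ Y <- u) \tsum_(X1 ⊗ X2 <- comul L X) (X1 ⊗ (X2 * Y)).
Definition mu (u : HtensH) : HdH :=
  \tsum_(X ⊗ Y <- u) \tsum_(X1 ⊗ X2 <- comul L X) ((X1 * Y) ⊗ X2).

End Galois.

Record hopf_algebroid (k : fieldType) (B H : algType k) := HopfAlgebroid {
  hopf_bialgebroid :> bialgebroid B H;
  lamV : HdH hopf_bialgebroid -> HoppH hopf_bialgebroid;
  muV : HdH hopf_bialgebroid -> HtensH hopf_bialgebroid;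
  lamK : cancel (@lam k B H hopf_bialgebroid) lamV;
  lamVK : cancel lamV (@lam k B H hopf_bialgebroid);
  muK : cancel (@mu k B H hopf_bialgebroid) muV;
  muVK : cancel muV (@mu k B H hopf_bialgebroid)
}.

(* X_+ (x) X_- and X_[+] (x) X_[-] *)
Definition plus_minus (k : fieldType) (B H : algType k)
  (HH : hopf_algebroid B H) (X : H) : HoppH HH := lamV (X ⊗ 1).
Definition bplus_bminus (k : fieldType) (B H : algType k)
  (HH : hopf_algebroid B H) (X : H) : HtensH HH := muV (1 ⊗ X).

Section Comodule.
Variables (k : fieldType) (B H : algType k) (L : bialgebroid B H).

Record right_comodule (M : lmodType k) (a : B -> M -> M)
    (d : M -> diamond (src L) a) : Prop := RightComodule {
  comod_opp_module : opp_module a;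
  comod_coassoc : coassociative (comul L) d;
  comod_counit : forall m, \tsum_(m0 ⊗ m1 <- d m) a (counit L m1) m0 = m;
  comod_lin : forall b m,
    d (a b m) = \tsum_(m0 ⊗ m1 <- d m) (m0 ⊗ (tgt L b * m1))
}.

(* Being linear over the opposite of B is part of being colinear: it makes    *)
(* f (x) id well defined on the diamond product.                              *)
Definition colinear (M M' : lmodType k) (a : B -> M -> M) (a' : B -> M' -> M')
    (d : M -> diamond (src L) a) (d' : M' -> diamond (src L) a')
    (f : M -> M') : Prop :=
  (forall b m, f (a b m) = a' b (f m)) /\
  (forall m, d' (f m) = \tsum_(m0 ⊗ m1 <- d m) (f m0 ⊗ m1)).

End Comodule.

Record comodule_algebra (k : fieldType) (B H : algType k)
    (L : bialgebroid B H) (P : algType k) := ComoduleAlgebra {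
  eta : {linear B -> P};
  coact : {linear P -> diamond (src L) (fun b p => eta b * p)};
  eta_anti : antimorphism eta;
  coact_comodule : right_comodule coact;
  coact_takeuchi : forall p, takeuchi (coact p);
  coact1 : coact 1 = 1 ⊗ 1;
  coactM : forall p q, coact (p * q) = diamond_mul (coact p) (coact q);
  coact_eta : forall b, coact (eta b) = 1 ⊗ tgt L b
}.

Section Coinvariants.
Variables (k : fieldType) (B H : algType k) (L : bialgebroid B H).
Variables (P : algType k) (A : comodule_algebra L P).

Definition coinvariant : {pred P} := [pred p | `[< coact A p = p ⊗ 1 >]].

Lemma coinvariantP p : reflect (coact A p = p ⊗ 1) (p \in coinvariant).
Proof. exact: asboolP. Qed.

Lemma coinvariant_eta p b : p \in coinvariant -> p * eta A b = eta A b * p.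
Proof.
move=> /coinvariantP dp; have := coact_takeuchi A p b.
have [tDl tDr tZl tZr tb] := balanced_tens
  (fun b (p : P) => eta A b * p) (fun b X => src L b * X).
rewrite /takeuchi dp tsum_tens; last first.
  by split=> *; rewrite ?mulrDl ?tDl ?tDr -?scalerAl ?tZl ?tZr -?mulrA ?tb.
rewrite tsum_tens; last first.
  by split=> *; rewrite ?mulrDl ?tDl ?tDr -?scalerAl ?tZl ?tZr -?mulrA ?tb.
rewrite mul1r -[src L b]mulr1 -tb.
pose e (q : P) (X : H) := eta A (counit L X) * q.
have [_ etaM] := eta_anti A.
have eb : balanced (fun b (p : P) => eta A b * p) (fun b X => src L b * X) e.
  split=> [q q' X|q X X'|c q X|c q X|c q X]; rewrite /e.
  - by rewrite mulrDr.
  - by rewrite !linearD mulrDl.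
  - by rewrite scalerAr.
  - by rewrite !linearZ /= scalerAl.
  - have := counit_lin L c 1 X; have [-> _] := tgt_anti L.
    by rewrite !mulr1 => ->; rewrite etaM mulrA.
move=> /(congr1 (fun u => tsum u e)).
rewrite !tsum_tens // /e (counit1 L).
by have [-> _] := eta_anti A; rewrite !mul1r.
Qed.

Lemma coinvariant_subalg : subalg_closed coinvariant.
Proof.
have [tDl tDr tZl tZr tb] := balanced_tens
  (fun b (p : P) => eta A b * p) (fun b X => src L b * X).
split; first by apply/coinvariantP; apply: coact1.
  move=> c p q /coinvariantP dp /coinvariantP dq; apply/coinvariantP.
  by rewrite linearP /= dp dq tDl tZl.
move=> p q cp /coinvariantP dq; have /coinvariantP dp := cp.
apply/coinvariantP; rewrite coactM /diamond_mul dp tsum_tens; last first.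
  split=> [x x' X|x X X'|c x X|c x X|c x X]; rewrite /tsum.
  - rewrite -big_split /=; apply: eq_bigr => i _; by rewrite mulrDl tDl.
  - rewrite -big_split /=; apply: eq_bigr => i _; by rewrite mulrDl tDr.
  - rewrite scaler_sumr; apply: eq_bigr => i _; by rewrite -scalerAl tZl.
  - rewrite scaler_sumr; apply: eq_bigr => i _; by rewrite -scalerAl tZr.
  - by apply: eq_bigr => i _; rewrite -!mulrA tb.
rewrite dq tsum_tens ?mulr1 //.
split=> [x x' X|x X X'|c x X|c x X|c x X].
- by rewrite mulrDr tDl.
- by rewrite mulrDr tDr.
- by rewrite -scalerAr tZl.
- by rewrite -scalerAr tZr.
- by rewrite mulrA (coinvariant_eta _ cp) -mulrA tb !mul1r.
Qed.
HB.instance Definition _ := GRing.isSubalgClosed.Build k P coinvariant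
  (GRing.subalg_closed_semi coinvariant_subalg).

(* N = P^{co H} *)
Record coinv := Coinv { coinv_val :> P; coinv_valP : coinv_val \in coinvariant }.
HB.instance Definition _ := [isSub for coinv_val].
HB.instance Definition _ := [Choice of coinv by <:].
HB.instance Definition _ := [SubChoice_isSubAlgebra of coinv by <:].

End Coinvariants.

(* N (x)_B H for a B-ring N, as a left N-module and a right H-comodule. *)
Section NormalBasis.
Variables (k : fieldType) (B H : algType k) (L : bialgebroid B H).
Variables (N : algType k) (i : {lrmorphism B -> N}).

Definition NtensH := tensor (fun b n => n * i b) (fun b X => src L b * X).
Definition NtensH_lmul (n : N) : NtensH -> NtensH := tens_mapl ( *%R n).
Definition NtensH_act (b : B) : NtensH -> NtensH := tens_mapr (tact (tgt L) b).
Definition NtensH_coact (u : NtensH) : diamond (src L) NtensH_act :=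
  \tsum_(n ⊗ X <- u) \tsum_(X1 ⊗ X2 <- comul L X) ((n ⊗ X1) ⊗ X2).

End NormalBasis.

Section ComoduleAlgebraProperties.
Variables (k : fieldType) (B H : algType k) (P : algType k).

Definition reversible_map (L : bialgebroid B H) (A : comodule_algebra L P)
    (u : tensor (fun b p => p * eta A b) (fun b X => tgt L b * X)) :
    diamond (src L) (fun b p => eta A b * p) :=
  \tsum_(p ⊗ X <- u) \tsum_(p0 ⊗ p1 <- coact A p) (p0 ⊗ (p1 * X)).

Definition reversible (L : bialgebroid B H) (A : comodule_algebra L P) : Prop :=
  bijective (reversible_map (A := A)).

Definition anti_galois_map (L : bialgebroid B H) (A : comodule_algebra L P)
    (u : tensor (fun (n : coinv A) p => p * val n)
                (fun (n : coinv A) p => val n * p)) :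
    diamond (src L) (fun b p => eta A b * p) :=
  \tsum_(p ⊗ q <- u) \tsum_(p0 ⊗ p1 <- coact A p) ((p0 * q) ⊗ p1).

Definition anti_galois (L : bialgebroid B H) (A : comodule_algebra L P) : Prop :=
  bijective (anti_galois_map (A := A)).

Definition normal_basis (L : bialgebroid B H) (A : comodule_algebra L P) : Prop :=
  exists (i : {lrmorphism B -> coinv A}) (phi : {linear P -> NtensH L i}),
    [/\ injective i, bijective phi,
        forall (n : coinv A) p, phi (val n * p) = NtensH_lmul n (phi p) &
        colinear (coact A) (NtensH_coact (L := L) (i := i)) phi].

Definition anti_cleft (HH : hopf_algebroid B H) (A : comodule_algebra HH P) :
    Prop :=
  reversible A /\
  exists (i : {lrmorphism B -> coinv A}) (rhot rho : {linear H -> P}),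
    [/\ injective i,
        colinear (comul HH) (coact A) rhot /\
        (forall b X, rhot (src HH b * X) = val (i b) * rhot X),
        (forall b X, rho (tgt HH b * X) = eta A b * rho X) /\
        (forall b X, rho (X * src HH b) = rho X * val (i b)),
        forall X, \tsum_(X1 ⊗ X2 <- plus_minus HH X) (rhot X1 * rho X2) =
                  val (i (counit HH X)) &
        forall X, \tsum_(X1 ⊗ X2 <- bplus_bminus HH X) (rho X1 * rhot X2) =
                  eta A (counit HH X)].

End ComoduleAlgebraProperties.

Section Cocycle.
Variables (k : fieldType) (B H : algType k) (L : bialgebroid B H).
Variables (N : algType k) (i : {lrmorphism B -> N}).
Local Notation s := (src L).
Local Notation t := (tgt L).
Local Notation Delta := (comul L).
Local Notation eps := (counit L).

Record cocycle := Cocycle {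
  cact : {bilinear H -> N -> N};
  csig : {linear HoppH L -> N};
  cact_lin : forall b b' X n,
    cact (s b * t b' * X) n = i b * cact X n * i b';
  cact_1r : forall X, cact X 1 = i (eps X);
  cactM : forall X m n,
    cact X (m * n) = \tsum_(X1 ⊗ X2 <- Delta X) (cact X1 m * cact X2 n);
  csig_lin : forall b b' X Y,
    csig ((s b * t b' * X) ⊗ Y) = i b * csig (X ⊗ Y) * i b';
  csig_1r : forall X, csig (X ⊗ 1) = i (eps X);
  csig_1l : forall X, csig (1 ⊗ X) = i (eps X);
  csig_mid : forall b X Y,
    \tsum_(X1 ⊗ X2 <- Delta X) (cact X1 (i b) * csig (X2 ⊗ Y)) =
    csig (X ⊗ (s b * Y));
  csig_cocycle : forall X Y Z,
    \tsum_(X1 ⊗ X2 <- Delta X) \tsum_(Y1 ⊗ Y2 <- Delta Y)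
      \tsum_(Z1 ⊗ Z2 <- Delta Z)
        (cact X1 (csig (Y1 ⊗ Z1)) * csig (X2 ⊗ (Y2 * Z2))) =
    \tsum_(X1 ⊗ X2 <- Delta X) \tsum_(Y1 ⊗ Y2 <- Delta Y)
        (csig (X1 ⊗ Y1) * csig ((X2 * Y2) ⊗ Z));
  csig_twisted : forall X Y n,
    \tsum_(X1 ⊗ X2 <- Delta X) \tsum_(Y1 ⊗ Y2 <- Delta Y)
        (csig (X1 ⊗ Y1) * cact (X2 * Y2) n) =
    \tsum_(X1 ⊗ X2 <- Delta X) \tsum_(Y1 ⊗ Y2 <- Delta Y)
        (cact X1 (cact Y1 n) * csig (X2 ⊗ Y2));
  cact_1l : forall n, cact 1 n = n
}.

Record cocycle_inverse (c : cocycle) (sigV : HtensH L -> N) : Prop :=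
    CocycleInverse {
  sigV_lin : forall b b' X Y,
    sigV ((s b * t b' * X) ⊗ Y) = i b * sigV (X ⊗ Y) * i b';
  sigV_mid : forall b X Y,
    \tsum_(X1 ⊗ X2 <- Delta X) (sigV (X1 ⊗ Y) * cact c X2 (i b)) =
    sigV (X ⊗ (t b * Y));
  csigK : forall X Y,
    \tsum_(X1 ⊗ X2 <- Delta X) \tsum_(Y1 ⊗ Y2 <- Delta Y)
        (csig c (X1 ⊗ Y1) * sigV (X2 ⊗ Y2)) = cact c X (cact c Y 1);
  csigVK : forall X Y,
    \tsum_(X1 ⊗ X2 <- Delta X) \tsum_(Y1 ⊗ Y2 <- Delta Y)
        (sigV (X1 ⊗ Y1) * csig c (X2 ⊗ Y2)) = cact c (X * Y) 1
}.

Definition invertible_cocycle (c : cocycle) : Prop :=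
  exists sigV : {linear HtensH L -> N}, cocycle_inverse c sigV.

(* The product of the crossed product N #_sigma H, whose underlying comodule  *)
(* is N (x)_B H.                                                              *)
Definition crossed_mul (c : cocycle) (u v : NtensH L i) : NtensH L i :=
  \tsum_(n ⊗ X <- u) \tsum_(m ⊗ Y <- v)
    \tsum_(X1 ⊗ X' <- Delta X) \tsum_(X2 ⊗ X3 <- Delta X')
      \tsum_(Y1 ⊗ Y2 <- Delta Y)
        ((n * cact c X1 m * csig c (X2 ⊗ Y1)) ⊗ (X3 * Y2)).

(* P is isomorphic to N #_sigma H as a right H-comodule algebra. *)
Definition crossed_product_iso (P : algType k) (A : comodule_algebra L P)
    (c : cocycle) : Prop :=
  exists phi : {linear P -> NtensH L i},
    [/\ bijective phi,
        phi 1 = 1 ⊗ 1,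
        forall p q, phi (p * q) = crossed_mul c (phi p) (phi q),
        forall b, phi (eta A b) = 1 ⊗ t b &
        colinear (coact A) (NtensH_coact (L := L) (i := i)) phi].

End Cocycle.

Definition crossed_product (k : fieldType) (B H P : algType k)
    (L : bialgebroid B H) (A : comodule_algebra L P) : Prop :=
  exists (N : algType k) (i : {lrmorphism B -> N}) (c : cocycle L i),
    [/\ injective i, invertible_cocycle c & crossed_product_iso A c].

(* Main.v *)
(* The three conditions are proved in the cycle (1) => (3) => (2) => (1).       *)
(*                                                                            *)
(* (1) => (3).  Write p+ (x) p- for the preimage of p (x) 1 under the map     *)
(* P (x) H -> P <> H of reversibility.  By uniqueness of inverses, the        *)
(* anti-skewed inverse rho of rho~ is right H-colinear, so p |-> p+ rho(p-)   *)
(* is a left N-linear projection pi of P onto N = P^{co H}, it sends          *)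
(* rho~(X) to eps(X), and p = pi(p(0)) rho~(p(1)).  After replacing rho~ by   *)
(* rho~ rho(1), so that rho~(1) = 1, put X |> n = pi(rho~(X) n) and           *)
(* sigma(X, Y) = pi(rho~(X) rho~(Y)); the cocycle identities come from        *)
(* reassociating products in P, and the inverse of sigma is                   *)
(* sigma^-1(X, Y) = pi(rho~(X Y+) rho(Y-)).                                   *)
(*                                                                            *)
(* (3) => (2).  The elements n # 1 are the coinvariants.  With                *)
(* rho~(X) = 1 # X and T(X, Y) = sigma^-1(X(1), Y) rho~(X(2)), the map        *)
(* X (x) Y |-> T(X, Y(1)) (x)_N rho~(Y(2)), composed with mu^-1, inverts the  *)
(* anti-Galois map.                                                           *)
(*                                                                            *)
(* (2) => (1).  Let pi : P = N (x)_B H -> N be id (x) eps and let c(X) be the *)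
(* preimage of 1 (x) X under the anti-Galois map; then rho(X) is the image of *)
(* c(X) under p (x) q |-> p pi(q).                                            *)

Require Import Defs.
From HB Require Import structures.
From mathcomp Require Import all_boot all_algebra.

Set Implicit Arguments.
Unset Strict Implicit.
Unset Printing Implicit Defensive.

(* all_algebra shadows the projection eta of Defs. *)
Import Defs GRing.Theory.
Local Open Scope ring_scope.
Local Open Scope tensor_scope.

(** * Tensor products and linearity *)

(** All three conditions describe P as N ⊗_B H with a deformed product. The common core is a pair: a
    colinear, left B-linear section [rt] : H → P and a left N-linear [pi] : P → N = P^{co H} with
    π(η(b)p) = π(p)b, π(rt X) = ε(X) and π(p(0)) rt(p(1)) = p. Such a pair amounts to a normal
    basis, by p ↦ π(p(0)) ⊗ p(1) and n ⊗ X ↦ n rt(X) ([normal_basis_map], [normal_basis_inv]).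
    Applying π to the products rt(X)n and rt(X) rt(Y) gives the action and the cocycle, whose axioms
    express associativity in P ([section_cocycle]).

    What remains is invertibility, and an anti-skewed inverse of [rt], an inverse of σ and an
    inverse of the anti-Galois map β are three forms of one datum. The link is the element T(X, Y)
    of P with T(X, Y(1)) rt(Y(2)) = rt(XY). It is rt(XY+) ρ(Y-) when ρ is given, and its image under
    π is then σ^-1 ([section_cocycle_inverse]). It is σ^-1(X(1), Y) rt(X(2)) when σ^-1 is given, and
    then β sends x T(U, W(1)) ⊗ rt(W(2)) to x rt(U(1)W) ⊗ U(2), so bijectivity of μ yields that of β
    ([cocycle_anti_galois]). Conversely, if β(c(X)) = 1 ⊗ X, then multiplying out c(X) with π on its
    second factor gives ρ ([section_anti_inverse], [anti_inverse_section]), and reversibility is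
    bijectivity of λ carried through the normal basis ([normal_basis_reversible]). In the anti-cleft
    case, [pi] comes from [anti_inverse_coact], which makes p+ ρ(p-) coinvariant.

    Sweedler sums are sums over chosen representatives. Identities between them are therefore
    evaluated on multilinear functions, and each use of coassociativity comes with the balancing
    conditions that make it legitimate. *)

Section LinearFunctions.
Variable k : fieldType.
Implicit Types U V W : lmodType k.

Lemma linear_id_fun U : linear (fun x : U => x).
Proof. by []. Qed.

Lemma linear_comp_fun U V W (g : V -> W) (h : U -> V) :
  linear g -> linear h -> linear (fun x => g (h x)).
Proof. by move=> gl hl a x y; rewrite hl gl. Qed.

Lemma lin_mull (R : algType k) U (c : R) (h : U -> R) :
  linear h -> linear (fun x => c * h x).
Proof. by move=> hl a x y; rewrite hl mulrDr scalerAr. Qed.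

Lemma lin_mulr (R : algType k) U (c : R) (h : U -> R) :
  linear h -> linear (fun x => h x * c).
Proof. by move=> hl a x y; rewrite hl mulrDl scalerAl. Qed.

Lemma linearPf U V (f : {linear U -> V}) : linear f.
Proof. by move=> a x y; rewrite linearP. Qed.

Definition linear_pack U V (f : U -> V) (fl : linear f) : {linear U -> V} :=
  HB.pack f (GRing.isLinear.Build k U V *:%R f fl).

Section Tensor.
Variables (M N : lmodType k) (S : Type).
Variables (r : S -> M -> M) (l : S -> N -> N).

Lemma balancedI (A : lmodType k) (f : M -> N -> A) :
    (forall n, linear (fun m => f m n)) -> (forall m, linear (f m)) ->
    (forall s m n, f (r s m) n = f m (l s n)) ->
  balanced r l f.
Proof.
move=> fl fr fb; split=> //.
- by move=> m m' n; have := fl n 1 m m'; rewrite /= !scale1r.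
- by move=> m n n'; have := fr m 1 n n'; rewrite /= !scale1r.
- move=> a m n; have f0 : f 0 n = 0.
    by have := fl n (-1) 0 0; rewrite /= scaler0 addr0 scaleN1r addNr.
  by have := fl n a m 0; rewrite /= f0 !addr0.
- move=> a m n; have f0 : f m 0 = 0.
    by have := fr m (-1) 0 0; rewrite /= scaler0 addr0 scaleN1r addNr.
  by have := fr m a n 0; rewrite /= f0 !addr0.
Qed.

Lemma balanced_linl (A : lmodType k) (f : M -> N -> A) n :
  balanced r l f -> linear (fun m => f m n).
Proof. by move=> [fDl _ fZl _ _] a x y; rewrite fDl fZl. Qed.

Lemma balanced_linr (A : lmodType k) (f : M -> N -> A) m :
  balanced r l f -> linear (f m).
Proof. by move=> [_ fDr _ fZr _] a x y; rewrite fDr fZr. Qed.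

Lemma linear_tensl U (h : U -> M) n :
  linear h -> linear (fun x => h x ⊗ n : tensor r l).
Proof.
by move=> hl; apply: (linear_comp_fun (g := fun m => m ⊗ n : tensor r l)) => //;
  exact: balanced_linl (balanced_tens r l).
Qed.

Lemma linear_tensr U (h : U -> N) m :
  linear h -> linear (fun x => m ⊗ h x : tensor r l).
Proof.
by move=> hl; apply: (linear_comp_fun (g := fun n => m ⊗ n : tensor r l)) => //;
  exact: balanced_linr (balanced_tens r l).
Qed.

Lemma linear_tsum U (A : lmodType k) (f : M -> N -> A) (h : U -> tensor r l) :
  balanced r l f -> linear h -> linear (fun x => tsum (h x) f).
Proof. by move=> fb hl a x y; rewrite hl tsumD // tsumZ. Qed.

(** The representative of [t] does not move with [x], so this is a finite sum of linear maps. *)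
Lemma linear_tsumf U (A : lmodType k) (f : U -> M -> N -> A) (t : tensor r l) :
  (forall m n, linear (fun x => f x m n)) -> linear (fun x => tsum t (f x)).
Proof.
move=> fl a x y; rewrite /tsum scaler_sumr -big_split /=.
by apply: eq_bigr => i _; rewrite fl.
Qed.

Lemma tens_mid s m n : r s m ⊗ n = m ⊗ l s n :> tensor r l.
Proof. exact: balanced_mid (balanced_tens r l) s m n. Qed.

Lemma tsum_tensE (t : tensor r l) : \tsum_(m ⊗ n <- t) (m ⊗ n : tensor r l) = t.
Proof.
rewrite /tsum -{2}[t]reprK; elim: (repr t) => [|[m n] u IHu]; first by rewrite big_nil.
by rewrite big_cons IHu /= -[(m, n) :: u]cat1s -tensor_add_pi.
Qed.

Lemma eq_tsum (A : zmodType) (t : tensor r l) (f g : M -> N -> A) :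
  (forall m n, f m n = g m n) -> tsum t f = tsum t g.
Proof. by move=> fg; apply: eq_bigr => p _; apply: fg. Qed.

(** [tsum] is a finite sum over one representative, so linear maps pass inside it for every [f],
    balanced or not. This is the main tool for taking Sweedler expressions apart. *)
Lemma linear_out (V W : lmodType k) (g : V -> W) (t : tensor r l) f :
  linear g -> g (tsum t f) = tsum t (fun m n => g (f m n)).
Proof.
by move=> gl; exact: (raddf_sum (linear_pack gl)).
Qed.

Lemma tsum_linear (A : lmodType k) (g : tensor r l -> A) t :
  linear g -> \tsum_(m ⊗ n <- t) g (m ⊗ n) = g t.
Proof. by move=> gl; rewrite -linear_out // tsum_tensE. Qed.

Lemma eq_linear_tens (A : lmodType k) (g h : tensor r l -> A) :
  linear g -> linear h -> (forall m n, g (m ⊗ n) = h (m ⊗ n)) -> g =1 h.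
Proof.
by move=> gl hl gh t; rewrite -tsum_linear // -[RHS]tsum_linear //; apply: eq_tsum.
Qed.

Definition tlift_fun (A : lmodType k) (f : M -> N -> A) (fb : balanced r l f)
  (t : tensor r l) : A := tsum t f.

Fact tlift_linear A f fb : linear (@tlift_fun A f fb).
Proof. exact/linear_tsum/linear_id_fun. Qed.

HB.instance Definition _ (A : lmodType k) (f : M -> N -> A) (fb : balanced r l f) :=
  GRing.isLinear.Build k (tensor r l) A *:%R (@tlift_fun A f fb) (tlift_linear fb).

(** The universal property of the tensor product, bundled as a linear map; the inverses of the
    reversibility and anti-Galois maps are built with it. *)
Definition tlift (A : lmodType k) (f : M -> N -> A) (fb : balanced r l f) :
  {linear tensor r l -> A} := @tlift_fun A f fb.

Lemma tliftE (A : lmodType k) (f : M -> N -> A) (fb : balanced r l f) m n :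
  tlift fb (m ⊗ n) = f m n.
Proof. exact: tsum_tens. Qed.

End Tensor.

Lemma exchange_tsum (M N M' N' : lmodType k) (S S' : Type)
    (r : S -> M -> M) (l : S -> N -> N) (r' : S' -> M' -> M') (l' : S' -> N' -> N')
    (A : zmodType) (t : tensor r l) (t' : tensor r' l') (f : M -> N -> M' -> N' -> A) :
  \tsum_(m ⊗ n <- t) \tsum_(m' ⊗ n' <- t') f m n m' n' =
  \tsum_(m' ⊗ n' <- t') \tsum_(m ⊗ n <- t) f m n m' n'.
Proof. exact: exchange_big. Qed.

Lemma tsum_tsum (M N M' N' : lmodType k) (S S' : Type)
    (r : S -> M -> M) (l : S -> N -> N) (r' : S' -> M' -> M') (l' : S' -> N' -> N')
    (A : lmodType k) (u : tensor r' l') (g : M' -> N' -> tensor r l) f :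
  balanced r l f ->
  tsum (tsum u g) f = \tsum_(x ⊗ y <- u) tsum (g x y) f :> A.
Proof.
by move=> fb; rewrite (linear_out (g := fun t => tsum t f)) //; apply: linear_tsum.
Qed.

Lemma linear_inverse U V (f : U -> V) (g : V -> U) :
  linear f -> cancel f g -> cancel g f -> linear g.
Proof. by move=> fl fK gK a x y; apply: (can_inj fK); rewrite fl !gK. Qed.

End LinearFunctions.

Lemma tact_linear (k : fieldType) (B H : algType k) (t : B -> H) b : linear (tact t b).
Proof. exact/lin_mull/linear_id_fun. Qed.

Ltac linear_atom :=
  first [ assumption | exact: linearPf
        | solve [eapply balanced_linl; eassumption] | solve [eapply balanced_linr; eassumption] | exact: tact_linear
        | match goal with H : _ |- _ => solve [apply: H] end | idtac ].

(* [lin] proves linearity and [bal] balancedness; [bal] leaves the equation   *)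
(* f (r s m) n = f m (l s n) to the user.                                      *)
Ltac lin :=
  cbv beta;
  lazymatch goal with
  | |- GRing.linear_for _ (fun x => x) => exact: linear_id_fun
  | |- GRing.linear_for _ ( *%R _) => apply: lin_mull; lin
  | |- GRing.linear_for _ (tens _) => apply: linear_tensr; lin
  | |- GRing.linear_for _ (fun x => tsum _ _) =>
      first [ apply: linear_tsumf; [let m := fresh "m" in let n := fresh "n" in intros m n; lin]
            | apply: linear_tsum; [bal | lin] ]
  | |- GRing.linear_for _ (fun x => _ ⊗ _) =>
      first [apply: linear_tensl | apply: linear_tensr]; lin
  | |- GRing.linear_for _ (fun x => _ * _) =>
      first [apply: lin_mull | apply: lin_mulr]; lin
  | |- GRing.linear_for _ (fun x => _ _) =>
      first
        [ match goal with |- GRing.linear_for _ (fun x => ?g _) =>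
            apply: (linear_comp_fun (g := g)) end
        | match goal with |- GRing.linear_for _ (fun x => ?g _ ?c) =>
            apply: (linear_comp_fun (g := fun y => g y c)) end
        | match goal with |- GRing.linear_for _ (fun x => ?g _ ?c ?d) =>
            apply: (linear_comp_fun (g := fun y => g y c d)) end
        | match goal with |- GRing.linear_for _ (fun x => ?g _ ?c ?d ?e) =>
            apply: (linear_comp_fun (g := fun y => g y c d e)) end ];
      [linear_atom | lin]
  | |- _ => linear_atom
  end
with bal :=
  first [ assumption | exact: balanced_tens
        | match goal with H : _ |- _ => solve [apply: H] end
        | apply: balancedI; intros; cbv beta; [lin | lin | idtac] ].

(** * Comodule algebras and bialgebroids *)

Section ComoduleAlgebra.
Variables (k : fieldType) (B H : algType k) (L : bialgebroid B H).
Variables (P : algType k) (A : comodule_algebra L P) (V : lmodType k).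
Local Notation s := (src L).
Local Notation t := (tgt L).
Local Notation η := (GRing.Linear.sort (eta A)).
Local Notation δ := (coact A).
Local Notation ε := (counit L).
Local Notation bal f := (balanced (fun b p => η b * p) (fun b X => s b * X) f).

Lemma src1 : s 1 = 1. Proof. exact: rmorph1. Qed.
Lemma tgt1 : t 1 = 1. Proof. by have [] := tgt_anti L. Qed.
Lemma tgtM b c : t (b * c) = t c * t b. Proof. by have [] := tgt_anti L. Qed.
Lemma eta1 : η (1 : B) = 1. Proof. by have [] := eta_anti A. Qed.
Lemma etaM b c : η (b * c) = η c * η b. Proof. by have [] := eta_anti A. Qed.

Lemma counit_src b X : ε (s b * X) = b * ε X.
Proof. by have := counit_lin L b 1 X; rewrite tgt1 !mulr1. Qed.

Lemma counit_tgt b X : ε (t b * X) = ε X * b.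
Proof. by have := counit_lin L 1 b X; rewrite src1 !mul1r. Qed.

Lemma counit_src1 b : ε (s b) = b.
Proof. by rewrite -[s b]mulr1 counit_src counit1 mulr1. Qed.

Lemma coact_takeuchif (f : P -> H -> V) p b : bal f ->
  \tsum_(q ⊗ X <- δ p) f (q * η b) X = \tsum_(q ⊗ X <- δ p) f q (X * s b).
Proof.
move=> fb; have := congr1 (fun u => tsum u f) (coact_takeuchi A p b).
rewrite !tsum_tsum //; under eq_tsum do rewrite tsum_tens //.
by under [in RHS]eq_tsum do rewrite tsum_tens //.
Qed.

Lemma coact_etal (f : P -> H -> V) p b : bal f ->
  tsum (δ (η b * p)) f = \tsum_(q ⊗ X <- δ p) f q (t b * X).
Proof.
move=> fb; rewrite (comod_lin (coact_comodule A)) tsum_tsum //.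
by apply: eq_tsum => q X; rewrite tsum_tens.
Qed.

Lemma coact_counit (f : P -> V) p : linear f ->
  \tsum_(q ⊗ X <- δ p) f (η (ε X) * q) = f p.
Proof.
by move=> fl; rewrite -linear_out // (comod_counit (coact_comodule A)).
Qed.

Lemma coact_mulf (f : P -> H -> V) p q : bal f ->
  tsum (δ (p * q)) f =
  \tsum_(p0 ⊗ p1 <- δ p) \tsum_(q0 ⊗ q1 <- δ q) f (p0 * q0) (p1 * q1).
Proof.
move=> fb; rewrite coactM tsum_tsum //; apply: eq_tsum => p0 p1.
by rewrite tsum_tsum //; apply: eq_tsum => q0 q1; rewrite tsum_tens.
Qed.

(** Left multiplication by δ(p) is well defined on the diamond product because δ(p) lies in the
    Takeuchi product: the scalar appearing in the middle is moved from the right of p(0) to the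
    right of p(1). *)
Lemma coact_mul_balanced (f : P -> H -> V) p : bal f ->
  bal (fun q X => \tsum_(p0 ⊗ p1 <- δ p) f (p0 * q) (p1 * X)).
Proof.
move=> fb; bal.
under [RHS]eq_tsum do rewrite mulrA.
rewrite -(coact_takeuchif (f := fun x Y => f (x * m) (Y * n))); last by bal;
  rewrite -!mulrA (balanced_mid fb).
by apply: eq_tsum => x Y; rewrite mulrA.
Qed.

Lemma coact_mul_tens (f : P -> H -> V) p q q' X : bal f -> δ q = q' ⊗ X ->
  tsum (δ (p * q)) f = \tsum_(p0 ⊗ p1 <- δ p) f (p0 * q') (p1 * X).
Proof.
move=> fb dq; rewrite coact_mulf // exchange_tsum dq tsum_tens //.
exact: coact_mul_balanced.
Qed.

Lemma coact_mull (f : P -> H -> V) p p' q X : bal f -> δ p = p' ⊗ X ->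
    (forall b, p' * η b = η b * p') -> (forall b, X * s b = s b * X) ->
  tsum (δ (p * q)) f = \tsum_(q0 ⊗ q1 <- δ q) f (p' * q0) (X * q1).
Proof.
move=> fb dp cp cX; rewrite coact_mulf // dp tsum_tens //.
bal.
  by apply: eq_tsum => x Y; rewrite -!mulrA (balanced_mid fb).
Qed.

Lemma coact_etar (f : P -> H -> V) p b : bal f ->
  tsum (δ (p * η b)) f = \tsum_(q ⊗ X <- δ p) f q (X * t b).
Proof.
move=> fb; rewrite (coact_mul_tens p fb (coact_eta A b)).
by apply: eq_tsum => q X; rewrite mulr1.
Qed.

Lemma coact_coinvr (f : P -> H -> V) p (n : coinv A) : bal f ->
  tsum (δ (p * val n)) f = \tsum_(q ⊗ X <- δ p) f (q * val n) X.
Proof.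
move=> fb; rewrite (coact_mul_tens p fb (coinvariantP _ _ (valP n))).
by apply: eq_tsum => q X; rewrite mulr1.
Qed.

Lemma coinv_eta (n : coinv A) b : val n * η b = η b * val n.
Proof. exact: coinvariant_eta (valP n). Qed.

Lemma coact_coinvl (f : P -> H -> V) p (n : coinv A) : bal f ->
  tsum (δ (val n * p)) f = \tsum_(q ⊗ X <- δ p) f (val n * q) X.
Proof.
move=> fb; rewrite (coact_mull p fb (coinvariantP _ _ (valP n))).
- by apply: eq_tsum => q X; rewrite mul1r.
- exact: coinv_eta.
- by move=> b; rewrite mulr1 mul1r.
Qed.

(** Coassociativity evaluated on a trilinear function; the last two conditions say that [f] factors
    through P ⋄ H ⋄ H. *)
Lemma coact_coassoc (f : P -> H -> H -> V) p :
    (forall X Y, linear (fun p => f p X Y)) ->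
    (forall p Y, linear (fun X => f p X Y)) ->
    (forall p X, linear (f p X)) ->
    (forall b p X Y, f (η b * p) X Y = f p (s b * X) Y) ->
    (forall b p X Y, f p (t b * X) Y = f p X (s b * Y)) ->
  \tsum_(p0 ⊗ p1 <- δ p) \tsum_(q0 ⊗ q1 <- δ p0) f q0 q1 p1 =
  \tsum_(p0 ⊗ p1 <- δ p) \tsum_(X1 ⊗ X2 <- comul L p1) f p0 X1 X2.
Proof.
move=> f1 f2 f3 fm1 fm2.
have fb Y : bal (fun p X => f p X Y) by bal.
pose F (u : diamond s (fun b p => η b * p)) Y := tsum u (fun p X => f p X Y).
have Fb : balanced (diamond_act (s := s) t (a := (fun b p => η b * p)))
    (fun b X => s b * X) F.
  rewrite /F; bal; rewrite /diamond_act /tens_mapr tsum_tsum //.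
  by apply: eq_tsum => q X; rewrite tsum_tens // fm2.
have := congr1 (fun u => tsum u F) (comod_coassoc (coact_comodule A) p).
rewrite !tsum_tsum //; under eq_tsum do rewrite tsum_tens //.
move=> ->; apply: eq_tsum => p0 p1; rewrite tsum_tsum //; apply: eq_tsum => X1 X2.
by rewrite tsum_tens // /F tsum_tens //; apply: fb.
Qed.

End ComoduleAlgebra.

Section Regular.
Variables (k : fieldType) (B H : algType k) (L : bialgebroid B H).
Local Notation s := (src L).
Local Notation t := (tgt L).
Local Notation ε := (counit L).
Local Notation Δ := (comul L).
Local Notation bal f := (balanced (tact t) (fun b X => s b * X) f).

Lemma comul_tgtl b X : Δ (t b * X) = \tsum_(X1 ⊗ X2 <- Δ X) (X1 ⊗ (t b * X2)).
Proof.
rewrite -[t b]mul1r -(src1 L) comul_lin.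
by apply: eq_tsum => X1 X2; rewrite src1 !mul1r.
Qed.

Lemma comul_srcl b X : Δ (s b * X) = \tsum_(X1 ⊗ X2 <- Δ X) ((s b * X1) ⊗ X2).
Proof.
rewrite -[s b]mulr1 -(tgt1 L) comul_lin.
by apply: eq_tsum => X1 X2; rewrite tgt1 !mul1r mulr1.
Qed.

Lemma comul_tgt b : Δ (t b) = 1 ⊗ t b.
Proof.
rewrite -[t b]mulr1 comul_tgtl comul1 tsum_tens //.
bal; by rewrite /tact !mulrA -src_tgtC -!mulrA tens_mid.
Qed.

Lemma comul_src b : Δ (s b) = s b ⊗ 1.
Proof.
rewrite -[s b]mulr1 comul_srcl comul1 tsum_tens //.
bal; by rewrite /tact mulrA src_tgtC -!mulrA tens_mid.
Qed.

Fact regular_comodule :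
  @right_comodule k B H L H (fun b X => t b * X) (comul L).
Proof.
split=> [||X|b X]; last exact: comul_tgtl.
- split=> *; rewrite ?mulrDr ?linearD ?mulrDl ?linearZ /= -?scalerAr -?scalerAl //.
    by rewrite tgt1 mul1r.
  by rewrite tgtM mulrA.
- exact: comul_coassoc.
- exact: counit_r.
Qed.

(** H coacts on itself by Δ, with reversibility map λ. Results on comodule algebras thus specialise
    to the bialgebroid itself. *)
Definition regular : comodule_algebra L H :=
  @ComoduleAlgebra k B H L H t Δ (tgt_anti L) regular_comodule
    (comul_takeuchi L) (comul1 L) (@comulM _ _ _ L) comul_tgt.

Section Functional.
Variable V : lmodType k.
Implicit Types (f : H -> H -> V) (X Y : H).

Lemma comul_takeuchif f X b : bal f ->
  \tsum_(X1 ⊗ X2 <- Δ X) f (X1 * t b) X2 = \tsum_(X1 ⊗ X2 <- Δ X) f X1 (X2 * s b).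
Proof. exact: (coact_takeuchif (A := regular)). Qed.

Lemma comul_tgtlf f X b : bal f ->
  tsum (Δ (t b * X)) f = \tsum_(X1 ⊗ X2 <- Δ X) f X1 (t b * X2).
Proof. exact: (coact_etal (A := regular)). Qed.

Lemma comul_srclf f X b : bal f ->
  tsum (Δ (s b * X)) f = \tsum_(X1 ⊗ X2 <- Δ X) f (s b * X1) X2.
Proof.
by move=> fb; rewrite comul_srcl tsum_tsum //; apply: eq_tsum => *; rewrite tsum_tens.
Qed.

Lemma comul_srcrf f X b : bal f ->
  tsum (Δ (X * s b)) f = \tsum_(X1 ⊗ X2 <- Δ X) f (X1 * s b) X2.
Proof.
move=> fb; have := coact_mul_tens (A := regular) X fb (comul_src b).
by move=> /= ->; apply: eq_tsum => *; rewrite mulr1.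
Qed.

Lemma comul_mulf f X Y : bal f ->
  tsum (Δ (X * Y)) f =
  \tsum_(X1 ⊗ X2 <- Δ X) \tsum_(Y1 ⊗ Y2 <- Δ Y) f (X1 * Y1) (X2 * Y2).
Proof. exact: (coact_mulf (A := regular)). Qed.

Lemma comul_counitl (f : H -> V) X : linear f ->
  \tsum_(X1 ⊗ X2 <- Δ X) f (s (ε X1) * X2) = f X.
Proof. by move=> fl; rewrite -linear_out // counit_l. Qed.

Lemma comul_counitr (f : H -> V) X : linear f ->
  \tsum_(X1 ⊗ X2 <- Δ X) f (t (ε X2) * X1) = f X.
Proof. exact: (coact_counit regular). Qed.

Lemma comul_coassocf (f : H -> H -> H -> V) X :
    (forall X Y, linear (fun p => f p X Y)) ->
    (forall p Y, linear (fun X => f p X Y)) ->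
    (forall p X, linear (f p X)) ->
    (forall b p X Y, f (t b * p) X Y = f p (s b * X) Y) ->
    (forall b p X Y, f p (t b * X) Y = f p X (s b * Y)) ->
  \tsum_(X1 ⊗ X2 <- Δ X) \tsum_(Y1 ⊗ Y2 <- Δ X1) f Y1 Y2 X2 =
  \tsum_(X1 ⊗ X2 <- Δ X) \tsum_(Y1 ⊗ Y2 <- Δ X2) f X1 Y1 Y2.
Proof. exact: (coact_coassoc (A := regular)). Qed.

End Functional.

Lemma comul_counit_tgtr X b : \tsum_(X1 ⊗ X2 <- Δ X) (s (ε (X1 * t b)) * X2) = X * s b.
Proof.
rewrite (comul_takeuchif (f := fun X1 X2 => s (ε X1) * X2)).
  under eq_tsum do rewrite mulrA.
  by rewrite (comul_counitl (f := fun Y => Y * s b)) //; lin.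
bal.
by rewrite /tact counit_tgt rmorphM mulrA.
Qed.

End Regular.

Section CounitRight.
Variables (k : fieldType) (B H : algType k) (L : bialgebroid B H).
Variables (P : algType k) (A : comodule_algebra L P).

(** The left side is the right action of the opposite of B that every comodule carries. In a
    comodule algebra the Takeuchi condition identifies it with right multiplication by η(b). *)
Lemma coact_counit_srcr p b :
  \tsum_(p0 ⊗ p1 <- coact A p) (eta A (counit L (p1 * src L b)) * p0) = p * eta A b.
Proof.
rewrite -(coact_takeuchif (f := fun q X => eta A (counit L X) * q)).
  under eq_tsum do rewrite mulrA.
  by rewrite (coact_counit A (f := fun q => q * eta A b)) //; lin.
bal.
by rewrite counit_src etaM mulrA.
Qed.

End CounitRight.

(** * Inverting the Galois maps *)

(* Below, th is the inverse of the reversibility map, so th (p ⊗ 1) is         *)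
(* p+ (x) p-; for P = H it is lamV.                                            *)

Section Mu.
Variables (k : fieldType) (B H : algType k) (L : hopf_algebroid B H).
Local Notation s := (src L).
Local Notation t := (tgt L).
Local Notation Δ := (comul L).
Local Notation bal f := (balanced (tact t) (fun b X => s b * X) f).
Local Notation balB f := (balanced (fun b X => X * s b) (fun b X => s b * X) f).
Variable V : lmodType k.
Implicit Types (f : H -> H -> V) (X Y Z W : H) (u : HtensH L) (w : HdH L).

Fact mu_balanced : balB (fun X Y => \tsum_(X1 ⊗ X2 <- Δ X) ((X1 * Y) ⊗ X2 : HdH L)).
Proof.
bal; last first.
  rewrite comul_srcrf; first by apply: eq_tsum => *; rewrite mulrA.
  bal; by rewrite /tact -tens_mid /tact mulrA.
by rewrite -tens_mid /tact mulrA.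
Qed.

Lemma mu_linear : linear (@mu k B H L).
Proof. exact/linear_tsum/linear_id_fun/mu_balanced. Qed.

Lemma muV_linear : linear (@muV k B H L).
Proof. exact: linear_inverse mu_linear (@muK _ _ _ L) (@muVK _ _ _ L). Qed.

Lemma mu_tens X Y : mu (X ⊗ Y : HtensH L) = \tsum_(X1 ⊗ X2 <- Δ X) ((X1 * Y) ⊗ X2).
Proof. exact: tsum_tens mu_balanced. Qed.

Lemma muE f u : bal f ->
  tsum (mu u) f = \tsum_(X ⊗ Y <- u) \tsum_(X1 ⊗ X2 <- Δ X) f (X1 * Y) X2.
Proof.
move=> fb; rewrite tsum_tsum //; apply: eq_tsum => X Y.
by rewrite tsum_tsum //; apply: eq_tsum => *; rewrite tsum_tens.
Qed.

Lemma muVKf f w : bal f ->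
  \tsum_(X ⊗ Y <- muV w) \tsum_(X1 ⊗ X2 <- Δ X) f (X1 * Y) X2 = tsum w f.
Proof. by move=> fb; rewrite -muE // muVK. Qed.

Local Notation muV := (@muV k B H L).

Lemma muKf f X Y : balB f ->
  \tsum_(X1 ⊗ X2 <- Δ X) tsum (muV ((X1 * Y) ⊗ X2)) f = f X Y.
Proof.
move=> fb; rewrite -[RHS](tsum_tens _ _ fb) -(muK (X ⊗ Y : HtensH L)) mu_tens.
rewrite (linear_out (g := muV)) ?tsum_tsum //; exact: muV_linear.
Qed.

Lemma muV_eqf f w u : mu u = w -> tsum (muV w) f = tsum u f.
Proof. by move=> <-; rewrite muK. Qed.

End Mu.

Section MuLinear.
Variables (k : fieldType) (B H : algType k) (L : hopf_algebroid B H).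
Local Notation s := (src L).
Local Notation t := (tgt L).
Local Notation Δ := (comul L).
Local Notation bal f := (balanced (tact t) (fun b X => s b * X) f).
Local Notation balB f := (balanced (fun b X => X * s b) (fun b X => s b * X) f).
Local Notation muV := (@muV k B H L).
Variable V : lmodType k.
Implicit Types (f : H -> H -> V) (X Y Z W : H) (u : HtensH L) (w : HdH L).

(** μ turns right multiplication on [Y] into right multiplication on the first leg, and the inverse
    inherits this. [muV_srcl] and [muV_tgtl] do the same for left multiplication by [s b] and
    [t b]. *)
Lemma muV_mulr f Z Z' W : balB f ->
  tsum (muV ((Z * Z') ⊗ W)) f = \tsum_(X ⊗ Y <- muV (Z ⊗ W)) f X (Y * Z').
Proof.
move=> fb; rewrite (muV_eqf f (u := \tsum_(X ⊗ Y <- muV (Z ⊗ W)) (X ⊗ (Y * Z')))).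
  by rewrite tsum_tsum //; apply: eq_tsum => *; rewrite tsum_tens.
rewrite (linear_out (g := @mu k B H L)); last exact: mu_linear.
under eq_tsum do [rewrite mu_tens; under eq_tsum do rewrite mulrA].
have gb : bal (fun X Y => (X * Z') ⊗ Y : HdH L).
  bal; by rewrite /tact -mulrA -tens_mid.
by rewrite (muVKf _ gb) tsum_tens.
Qed.

Lemma muV_srcl f b Z W : balB f ->
  tsum (muV ((s b * Z) ⊗ W)) f = \tsum_(X ⊗ Y <- muV (Z ⊗ W)) f (s b * X) Y.
Proof.
move=> fb; rewrite (muV_eqf f (u := \tsum_(X ⊗ Y <- muV (Z ⊗ W)) ((s b * X) ⊗ Y))).
  by rewrite tsum_tsum //; apply: eq_tsum => *; rewrite tsum_tens.
rewrite (linear_out (g := @mu k B H L)); last exact: mu_linear.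
have gb : bal (fun X Y => (s b * X) ⊗ Y : HdH L).
  bal; by rewrite /tact mulrA src_tgtC -mulrA -tens_mid.
rewrite -[RHS](tsum_tens _ _ gb) -(muVKf _ gb); apply: eq_tsum => X Y.
rewrite mu_tens comul_srclf; last by bal; rewrite /tact -mulrA -tens_mid.
by apply: eq_tsum => *; rewrite mulrA.
Qed.

Lemma muV_tgtl f b Z W : balB f ->
  tsum (muV (Z ⊗ (t b * W))) f = \tsum_(X ⊗ Y <- muV (Z ⊗ W)) f (t b * X) Y.
Proof.
move=> fb; rewrite (muV_eqf f (u := \tsum_(X ⊗ Y <- muV (Z ⊗ W)) ((t b * X) ⊗ Y))).
  by rewrite tsum_tsum //; apply: eq_tsum => *; rewrite tsum_tens.
rewrite (linear_out (g := @mu k B H L)); last exact: mu_linear.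
have gb : bal (fun X Y => X ⊗ (t b * Y) : HdH L).
  bal; by rewrite tens_mid !mulrA src_tgtC.
rewrite -[RHS](tsum_tens _ _ gb) -(muVKf _ gb); apply: eq_tsum => X Y.
rewrite mu_tens comul_tgtlf //; bal; by rewrite /tact -mulrA -tens_mid.
Qed.

End MuLinear.

Section ReversibleMap.
Variables (k : fieldType) (B H : algType k) (L : bialgebroid B H).
Variables (P : algType k) (A : comodule_algebra L P).
Local Notation s := (src L).
Local Notation t := (tgt L).
Local Notation η := (GRing.Linear.sort (eta A)).
Local Notation δ := (coact A).
Local Notation PdH := (diamond s (fun b p => η b * p)).
Local Notation PoH := (tensor (fun b p => p * η b) (fun b X => t b * X)).
Local Notation bal f := (balanced (fun b p => η b * p) (fun b X => s b * X) f).
Local Notation balo f := (balanced (fun b p => p * η b) (fun b X => t b * X) f).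
Local Notation lamP := (@reversible_map k B H P L A).

Fact reversible_map_balanced : balo (fun p X => \tsum_(p0 ⊗ p1 <- δ p) (p0 ⊗ (p1 * X)
  : PdH)).
Proof.
bal; last first.
  rewrite coact_etar; first by apply: eq_tsum => *; rewrite mulrA.
  bal; by rewrite -mulrA -tens_mid.
by rewrite tens_mid mulrA.
Qed.

Lemma reversible_map_linear : linear lamP.
Proof. exact/linear_tsum/linear_id_fun/reversible_map_balanced. Qed.

Lemma reversible_map_tens p X :
  lamP (p ⊗ X : PoH) = \tsum_(p0 ⊗ p1 <- δ p) (p0 ⊗ (p1 * X)).
Proof. exact: tsum_tens reversible_map_balanced. Qed.

Section Inverse.
Variable th : PdH -> PoH.
Hypotheses (lamPK : cancel lamP th) (thK : cancel th lamP).

Lemma th_linear : linear th.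
Proof. exact: linear_inverse reversible_map_linear lamPK thK. Qed.

Section Values.
Variable V : lmodType k.
Implicit Types f : P -> H -> V.

Lemma th_lamf f w : bal f ->
  \tsum_(p ⊗ X <- th w) \tsum_(p0 ⊗ p1 <- δ p) f p0 (p1 * X) = tsum w f.
Proof.
move=> fb; rewrite -[in RHS](thK w) [RHS]tsum_tsum //; apply: eq_tsum => p X.
by rewrite tsum_tsum //; apply: eq_tsum => *; rewrite tsum_tens.
Qed.

Lemma lam_thf f p X : balo f ->
  \tsum_(p0 ⊗ p1 <- δ p) tsum (th (p0 ⊗ (p1 * X))) f = f p X.
Proof.
move=> fb; rewrite -[RHS](tsum_tens _ _ fb) -(lamPK (p ⊗ X : PoH)) reversible_map_tens.
rewrite (linear_out (g := th)) ?tsum_tsum //; exact: th_linear.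
Qed.

Lemma th_eqf f w u : lamP u = w -> tsum (th w) f = tsum u f.
Proof. by move=> <-; rewrite lamPK. Qed.

End Values.

Section Linearity.
Variable V : lmodType k.
Implicit Types f : P -> H -> V.

(** If the reversibility map intertwines [h] with [g], its inverse intertwines [g] with [h]. All
    linearity properties of [th] below are instances. *)
Lemma th_map f (g : P -> H -> PdH) (h : P -> H -> PoH) p X : balo f -> bal g -> 
  (forall p X, lamP (h p X) = \tsum_(p0 ⊗ p1 <- δ p) g p0 (p1 * X)) ->
  tsum (th (g p X)) f = \tsum_(q ⊗ Y <- th (p ⊗ X)) tsum (h q Y) f.
Proof.
move=> fb gb gh; rewrite (th_eqf f (u := \tsum_(q ⊗ Y <- th (p ⊗ X)) (h q Y))).
  by rewrite tsum_tsum.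
rewrite (linear_out (g := lamP)); last exact: reversible_map_linear.
under eq_tsum do rewrite gh.
by rewrite th_lamf // tsum_tens.
Qed.

Lemma th_mulr f p X Z : balo f ->
  tsum (th (p ⊗ (X * Z))) f = \tsum_(q ⊗ Y <- th (p ⊗ X)) f q (Y * Z).
Proof.
move=> fb; rewrite (th_map (g := fun p X => p ⊗ (X * Z))
  (h := fun q Y => q ⊗ (Y * Z)) _ _ fb).
- by apply: eq_tsum => *; rewrite tsum_tens.
- bal; by rewrite tens_mid mulrA.
- by move=> q Y; rewrite reversible_map_tens; apply: eq_tsum => *; rewrite mulrA.
Qed.

Lemma th_coinvl f (n : coinv A) p X : balo f ->
  tsum (th ((val n * p) ⊗ X)) f = \tsum_(q ⊗ Y <- th (p ⊗ X)) f (val n * q) Y.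
Proof.
move=> fb; rewrite (th_map (g := fun p X => (val n * p) ⊗ X)
  (h := fun q Y => (val n * q) ⊗ Y) _ _ fb).
- by apply: eq_tsum => *; rewrite tsum_tens.
- bal; by rewrite mulrA coinv_eta -mulrA tens_mid.
- move=> q Y; rewrite reversible_map_tens.
  rewrite coact_coinvl //; bal; by rewrite tens_mid mulrA.
Qed.

Lemma th_etar f p b X : balo f ->
  tsum (th ((p * η b) ⊗ X)) f = \tsum_(q ⊗ Y <- th (p ⊗ X)) f q (s b * Y).
Proof.
move=> fb; rewrite (th_map (g := fun p X => (p * η b) ⊗ X)
  (h := fun q Y => q ⊗ (s b * Y)) _ _ fb).
- by apply: eq_tsum => *; rewrite tsum_tens.
- bal; by rewrite -mulrA tens_mid.
- move=> q Y; rewrite reversible_map_tens.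
  rewrite (coact_takeuchif (f := fun x Z => x ⊗ (Z * Y))); first by apply: eq_tsum => *;
    rewrite mulrA.
  bal; by rewrite tens_mid mulrA.
Qed.

Lemma th_tgtl f p b X : balo f ->
  tsum (th (p ⊗ (t b * X))) f = \tsum_(q ⊗ Y <- th (p ⊗ X)) f (η b * q) Y.
Proof.
move=> fb; rewrite (th_map (g := fun p X => p ⊗ (t b * X))
  (h := fun q Y => (η b * q) ⊗ Y) _ _ fb).
- by apply: eq_tsum => *; rewrite tsum_tens.
- bal; by rewrite tens_mid !mulrA src_tgtC.
- move=> q Y; rewrite reversible_map_tens.
  rewrite coact_etal; first by apply: eq_tsum => *; rewrite mulrA.
  bal; by rewrite tens_mid mulrA.
Qed.

End Linearity.
End Inverse.
End ReversibleMap.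

(** * Identities for translation maps *)

(* A Sweedler identity between elements of a threefold tensor product is       *)
(* stated for the values of a trilinear f with the matching balancing          *)
(* conditions.  In such a proof, applying an injective map to both sides of    *)
(* the identity becomes writing f as g composed with that map.                 *)

Section ReversibleIdentities.
Variables (k : fieldType) (B H : algType k) (L : hopf_algebroid B H).
Variables (P : algType k) (A : comodule_algebra L P).
Local Notation s := (src L).
Local Notation t := (tgt L).
Local Notation ε := (counit L).
Local Notation Δ := (comul L).
Local Notation muV := (@muV k B H L).
Local Notation η := (GRing.Linear.sort (eta A)).
Local Notation δ := (coact A).
Local Notation PdH := (diamond s (fun b p => η b * p)).
Local Notation PoH := (tensor (fun b p => p * η b) (fun b X => t b * X)).
Local Notation bal f := (balanced (fun b p => η b * p) (fun b X => s b * X) f).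
Local Notation balo f := (balanced (fun b p => p * η b) (fun b X => t b * X) f).
Local Notation balB f := (balanced (fun b X => X * s b) (fun b X => s b * X) f).
Local Notation lamP := (@reversible_map k B H P L A).
Variable th : PdH -> PoH.
Hypotheses (lamPK : cancel lamP th) (thK : cancel th lamP).
Variable V : lmodType k.
Local Notation lth := (th_linear lamPK thK).

(* p+(0) (x) p-(1) (x) p+(1) p-(2) = p+ (x) p- (x) 1 *)
Lemma coact_plus_minus (f : P -> H -> H -> V) p :
    (forall X Y, linear (fun q => f q X Y)) ->
    (forall q Y, linear (fun X => f q X Y)) ->
    (forall q X, linear (f q X)) ->
    (forall b q X Y, f (q * η b) X Y = f q (t b * X) Y) ->
    (forall b q X Y, f (η b * q) X Y = f q X (s b * Y)) ->
  \tsum_(q ⊗ X <- th (p ⊗ 1))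
    \tsum_(q0 ⊗ q1 <- δ q) \tsum_(X1 ⊗ X2 <- Δ X) f q0 X1 (q1 * X2) =
  \tsum_(q ⊗ X <- th (p ⊗ 1)) f q X 1.
Proof.
move=> f1 f2 f3 m1 m2; have thl := lth.
have fb Y : balo (fun q X => f q X Y) by bal.
(* [g] is [f] after [th], so [f] is [g] after the reversibility map. The left side becomes [g] on
   q(0) ⊗ q(1)X(1) ⊗ q(2)X(2), that is, Δ applied to the second leg of q(0) ⊗ q(1)X = p ⊗ 1. *)
pose g q Z Y := tsum (th (q ⊗ Z)) (fun q' X => f q' X Y).
have g1 Z Y : linear (fun q => g q Z Y) by rewrite /g; lin.
have g2 q Y : linear (fun Z => g q Z Y) by rewrite /g; lin.
have g3 q Z : linear (g q Z) by rewrite /g; lin.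
have gm1 b q Z Y : g (η b * q) Z Y = g q (s b * Z) Y by rewrite /g tens_mid.
have gm2 b q Z Y : g q (t b * Z) Y = g q Z (s b * Y).
  by rewrite /g (th_tgtl lamPK thK) //; apply: eq_tsum => *; rewrite m2.
have fg q X Y : f q X Y = \tsum_(q0 ⊗ q1 <- δ q) g q0 (q1 * X) Y.
  by rewrite -(lam_thf lamPK thK _ _ (fb Y)).
have gE : g p 1 1 = \tsum_(q ⊗ X <- th (p ⊗ 1)) f q X 1 by [].
clearbody g.
pose h q Z := tsum (Δ Z) (g q) : V.
have gb q : balanced (tact t) (fun b X => s b * X) (g q).
  by bal; apply: gm2.
have hb : bal h.
  by rewrite /h; bal; rewrite comul_srclf //; apply: eq_tsum => *; rewrite gm1.
transitivity (\tsum_(q ⊗ X <- th (p ⊗ 1)) \tsum_(q0 ⊗ q1 <- δ q) h q0 (q1 * X)).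
  apply: eq_tsum => q X.
  under eq_tsum => q0 q1.
    under eq_tsum do rewrite fg; rewrite exchange_tsum; over.
  rewrite (coact_coassoc (f := fun a U W => \tsum_(X1 ⊗ X2 <- Δ X) g a (U * X1) (W * X2))).
  - by apply: eq_tsum => q0 q1; rewrite /h comul_mulf.
  - by move=> *; lin.
  - by move=> *; lin.
  - by move=> *; lin.
  - by move=> *; apply: eq_tsum => *; rewrite gm1 mulrA.
  - by move=> *; apply: eq_tsum => *; rewrite -!mulrA gm2.
rewrite (th_lamf thK _ hb) tsum_tens // /h comul1 tsum_tens //.
Qed.

(* p+ (x) p-(1) (x) p-(2) = p++ (x) p- (x) p+- *)
Lemma comul_minus (h : P -> H -> H -> V) p :
    (forall X Y, linear (fun q => h q X Y)) ->
    (forall q Y, linear (fun X => h q X Y)) ->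
    (forall q X, linear (h q X)) ->
    (forall b q X Y, h (q * η b) X Y = h q X (t b * Y)) ->
    (forall b q X Y, h q (t b * X) Y = h q X (s b * Y)) ->
  \tsum_(q ⊗ X <- th (p ⊗ 1)) \tsum_(X1 ⊗ X2 <- Δ X) h q X1 X2 =
  \tsum_(q ⊗ X <- th (p ⊗ 1)) \tsum_(q' ⊗ X' <- th (q ⊗ 1)) h q' X X'.
Proof.
move=> h1 h2 h3 m1 m2; have thl := lth.
have hb X : balo (fun q Y => h q X Y) by bal.
(* The function chosen feeds the first and third factors to [th], which on the left recovers q ⊗
   X(2) from q(0) ⊗ q(1)X(2). *)
rewrite -(@coact_plus_minus (fun q X Y => tsum (th (q ⊗ Y)) (fun q' X' => h q' X X'))).
- apply: eq_tsum => q X; rewrite exchange_tsum; apply: eq_tsum => X1 X2.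
  by rewrite (lam_thf lamPK thK).
- by move=> *; lin.
- by move=> *; lin.
- by move=> *; lin.
- by move=> b q X Y; rewrite (th_etar lamPK thK) //; apply: eq_tsum => *; rewrite m2.
- by move=> b q X Y; rewrite tens_mid.
Qed.

Lemma th_coact (f : P -> H -> V) p : balo f ->
  \tsum_(p0 ⊗ p1 <- δ p) \tsum_(q ⊗ X <- th (p0 ⊗ 1)) f q (X * p1) = f p 1.
Proof.
move=> fb; rewrite -(lam_thf lamPK thK _ _ fb); apply: eq_tsum => p0 p1.
by rewrite -(th_mulr lamPK thK) // mul1r mulr1.
Qed.

(* p(0)+ (x) p(0)- (x) p(1) = p+ (x) p-[+] (x) p-[-] *)
Lemma plus_minus_coact (f : P -> H -> H -> V) p :
    (forall X Y, linear (fun q => f q X Y)) ->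
    (forall q Y, linear (fun X => f q X Y)) ->
    (forall q X, linear (f q X)) ->
    (forall b q X Y, f (q * η b) X Y = f q (t b * X) Y) ->
    (forall b q X Y, f q (X * s b) Y = f q X (s b * Y)) ->
  \tsum_(p0 ⊗ p1 <- δ p) \tsum_(q ⊗ X <- th (p0 ⊗ 1)) f q X p1 =
  \tsum_(q ⊗ X <- th (p ⊗ 1)) tsum (muV (1 ⊗ X)) (f q).
Proof.
move=> f1 f2 f3 m1 m2; have thl := lth; have muVl := @muV_linear _ _ _ L.
have fb q : balB (f q) by bal.
(* Here [f] is written as [g] after μ on the last two factors. The left side is then p(0)+ ⊗
   p(0)-(1) p(1) ⊗ p(0)-(2), which [comul_minus] and [th_coact] reduce to p+ ⊗ 1 ⊗ p-. *)
pose g q Z W := tsum (muV (Z ⊗ W)) (f q).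
have g1 Z Y : linear (fun q => g q Z Y) by rewrite /g; lin.
have g2 q Y : linear (fun Z => g q Z Y) by rewrite /g; lin.
have g3 q Z : linear (g q Z) by rewrite /g; lin.
have gm1 b q Z W
  : g q (t b * Z) W = g q Z (s b * W) by rewrite /g -[t b * Z]/(tact t b Z) tens_mid.
have gm2 b q Z W : g (q * η b) Z W = g q Z (t b * W).
  by rewrite /g muV_tgtl //; apply: eq_tsum => *; rewrite m1.
have fg q X Y : f q X Y = \tsum_(X1 ⊗ X2 <- Δ X) g q (X1 * Y) X2.
  by rewrite muKf.
rewrite -[RHS]/(\tsum_(q ⊗ X <- th (p ⊗ 1)) g q 1 X); clearbody g.
under eq_tsum => p0 p1.
  under eq_tsum do rewrite fg.
  rewrite (@comul_minus (fun q X Y => g q (X * p1) Y)); last first.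
  - by move=> *; rewrite -mulrA gm1.
  - by move=> *; rewrite gm2.
  - by move=> *; lin.
  - by move=> *; lin.
  - by move=> *; lin.
  over.
rewrite (th_coact (f := fun q X => tsum (th (q ⊗ 1)) (fun q' X' => g q' X X'))) //.
have gb X : balo (fun q Y => g q X Y) by bal.
by bal; rewrite (th_etar lamPK thK) //; apply: eq_tsum => *; rewrite gm1.
Qed.

(** By [coact_counit_srcr] and ε(Xs(ε(Y))) = ε(XY), the summand is η(ε(q(1)X)) q(0), a function of
    q(0) ⊗ q(1)X = p ⊗ 1. *)
Lemma plus_minus_counit p : \tsum_(q ⊗ X <- th (p ⊗ 1)) (q * η (ε X)) = p.
Proof.
have fb : bal (fun q X => η (ε X) * q).
  by bal; rewrite counit_src etaM mulrA.
transitivity (\tsum_(q ⊗ X <- th (p ⊗ 1)) \tsum_(q0 ⊗ q1 <- δ q) (η (ε (q1 * X)) * q0)).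
  apply: eq_tsum => q X; rewrite -coact_counit_srcr.
  by apply: eq_tsum => *; rewrite counitM_src.
by rewrite (th_lamf thK _ fb) tsum_tens // counit1 eta1 mul1r.
Qed.

End ReversibleIdentities.

Section HopfIdentities.
Variables (k : fieldType) (B H : algType k) (L : hopf_algebroid B H).
Local Notation s := (src L).
Local Notation t := (tgt L).
Local Notation ε := (counit L).
Local Notation Δ := (comul L).
Local Notation muV := (@muV k B H L).
Local Notation lamV := (@lamV k B H L).
Local Notation bal f := (balanced (tact t) (fun b X => s b * X) f).
Local Notation balo f := (balanced (fun b X => X * t b) (fun b X => t b * X) f).
Local Notation balB f := (balanced (fun b X => X * s b) (fun b X => s b * X) f).

Lemma lamV_linear : linear lamV.
Proof. exact: (th_linear (A := regular L) (@lamK _ _ _ L) (@lamVK _ _ _ L)). Qed.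

Lemma src_coinvariant b : s b \in coinvariant (regular L).
Proof. exact/coinvariantP/comul_src. Qed.

Section Values.
Variable V : lmodType k.
Implicit Types (f : H -> H -> V) (X Y Z : H).

Lemma lamVKf f w : bal f ->
  \tsum_(X ⊗ Y <- lamV w) \tsum_(X1 ⊗ X2 <- Δ X) f X1 (X2 * Y) = tsum w f.
Proof. exact: (th_lamf (A := regular L) (@lamVK _ _ _ L)). Qed.

Lemma lamKf f X Y : balo f ->
  \tsum_(X1 ⊗ X2 <- Δ X) tsum (lamV (X1 ⊗ (X2 * Y))) f = f X Y.
Proof. exact: (lam_thf (A := regular L) (@lamK _ _ _ L) (@lamVK _ _ _ L)). Qed.

Lemma lamV_srcl f b X Z : balo f ->
  tsum (lamV ((s b * X) ⊗ Z)) f = \tsum_(Y ⊗ W <- lamV (X ⊗ Z)) f (s b * Y) W.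
Proof.
exact: (th_coinvl (A := regular L) (@lamK _ _ _ L) (@lamVK _ _ _ L)
  (Coinv (src_coinvariant b))).
Qed.

Lemma lamV_tgtl f b X Z : balo f ->
  tsum (lamV (X ⊗ (t b * Z))) f = \tsum_(Y ⊗ W <- lamV (X ⊗ Z)) f (t b * Y) W.
Proof. exact: (th_tgtl (A := regular L) (@lamK _ _ _ L) (@lamVK _ _ _ L)). Qed.

Lemma lamV_mulr f X Z W : balo f ->
  tsum (lamV (X ⊗ (Z * W))) f = \tsum_(Y ⊗ Y' <- lamV (X ⊗ Z)) f Y (Y' * W).
Proof. exact: (th_mulr (A := regular L) (@lamK _ _ _ L) (@lamVK _ _ _ L)). Qed.

(** In H ⋄ H one has t(b)X ⊗ 1 = X ⊗ s(b), and the inverse of λ is right H-linear. *)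
Lemma plus_minus_tgt f b X : balo f ->
  tsum (plus_minus L (t b * X)) f = \tsum_(Y ⊗ Z <- plus_minus L X) f Y (Z * s b).
Proof.
move=> fb; rewrite /plus_minus -[t b * X]/(tact t b X) tens_mid mulr1.
by rewrite -[s b]mul1r lamV_mulr // mul1r.
Qed.

Lemma plus_minus_src f b X : balo f ->
  tsum (plus_minus L (s b * X)) f = \tsum_(Y ⊗ Z <- plus_minus L X) f (s b * Y) Z.
Proof. exact: lamV_srcl. Qed.

End Values.

Lemma plus_minus_linear : linear (plus_minus L).
Proof. by move=> a X Y; rewrite /plus_minus -lamV_linear; congr lamV;
  exact: (linear_tensl _ _ 1 (@linear_id_fun k H)). Qed.

Lemma plus_minus_tgt_counit X : \tsum_(Y ⊗ Z <- plus_minus L X) (Y * t (ε Z)) = X.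
Proof. exact: (plus_minus_counit (A := regular L) (@lamVK _ _ _ L)). Qed.

(** The mirror image of [plus_minus_counit], with μ in place of λ and source and target
    exchanged. *)
Lemma bplus_bminus_src_counit X :
  \tsum_(Y ⊗ Z <- bplus_bminus L X) (Y * s (ε Z)) = X.
Proof.
have fb : bal (fun U W => s (ε U) * W).
  by bal; rewrite /tact counit_tgt rmorphM mulrA.
transitivity (\tsum_(Y ⊗ Z <- bplus_bminus L X) \tsum_(Y1 ⊗ Y2 <- Δ Y) (s (ε (Y1 * Z)) * Y2)).
  apply: eq_tsum => Y Z; rewrite -comul_counit_tgtr.
  by apply: eq_tsum => *; rewrite counitM_tgt.
by rewrite (muVKf _ fb) tsum_tens // counit1 src1 mul1r.
Qed.

Section Trilinear.
Variables (V : lmodType k) (f : H -> H -> H -> V).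
Hypotheses (f1 : forall X Y, linear (fun q => f q X Y))
  (f2 : forall q Y, linear (fun X => f q X Y)) (f3 : forall q X, linear (f q X)).

Lemma comul_plus_minus X :
    (forall b X Y Z, f (X * t b) Y Z = f X (t b * Y) Z) ->
    (forall b X Y Z, f (t b * X) Y Z = f X Y (s b * Z)) ->
  \tsum_(Y ⊗ Z <- plus_minus L X)
    \tsum_(Y1 ⊗ Y2 <- Δ Y) \tsum_(Z1 ⊗ Z2 <- Δ Z) f Y1 Z1 (Y2 * Z2) =
  \tsum_(Y ⊗ Z <- plus_minus L X) f Y Z 1.
Proof.
exact: (coact_plus_minus (A := regular L) (@lamK _ _ _ L) (@lamVK _ _ _ L)).
Qed.

(* X(1)+ (x) X(1)- (x) X(2) = X+ (x) X-[+] (x) X-[-] *)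
Lemma plus_minus_comul X :
    (forall b X Y Z, f (X * t b) Y Z = f X (t b * Y) Z) ->
    (forall b X Y Z, f X (Y * s b) Z = f X Y (s b * Z)) ->
  \tsum_(X1 ⊗ X2 <- Δ X) \tsum_(Y ⊗ Z <- plus_minus L X1) f Y Z X2 =
  \tsum_(Y ⊗ Z <- plus_minus L X) tsum (bplus_bminus L Z) (f Y).
Proof.
exact: (plus_minus_coact (A := regular L) (@lamK _ _ _ L) (@lamVK _ _ _ L)).
Qed.

(* X+(1) (x) X+(2) (x) X- = X(1) (x) X(2)+ (x) X(2)- *)
Lemma comul_plus X :
    (forall b X Y Z, f (t b * X) Y Z = f X (s b * Y) Z) ->
    (forall b X Y Z, f X (Y * t b) Z = f X Y (t b * Z)) ->
  \tsum_(Y ⊗ Z <- plus_minus L X) \tsum_(Y1 ⊗ Y2 <- Δ Y) f Y1 Y2 Z =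
  \tsum_(X1 ⊗ X2 <- Δ X) tsum (plus_minus L X2) (f X1).
Proof.
move=> m1 m2; have lamVl := lamV_linear.
have fb U : balo (f U) by bal.
(* With [f] equal to [g] after λ on the last two factors, coassociativity exposes Y(1) ⊗ Y(2)Z for Y
   ⊗ Z = X+ ⊗ X-, which is X ⊗ 1. *)
pose g X U W := tsum (lamV (U ⊗ W)) (f X).
have g1 U W : linear (fun x => g x U W) by rewrite /g; lin.
have g2 x W : linear (fun U => g x U W) by rewrite /g; lin.
have g3 x U : linear (g x U) by rewrite /g; lin.
have gm1 b Y U W : g (t b * Y) U W = g Y (s b * U) W.
  by rewrite /g lamV_srcl //; apply: eq_tsum => *; rewrite m1.
have gm2 b Y U W : g Y (t b * U) W = g Y U (s b * W).
  by rewrite /g -[t b * U]/(tact t b U) tens_mid.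
have fg Y U W : f Y U W = \tsum_(U1 ⊗ U2 <- Δ U) g Y U1 (U2 * W) by rewrite lamKf.
rewrite -[RHS]/(\tsum_(X1 ⊗ X2 <- Δ X) g X1 X2 1); clearbody g.
have gb W : bal (fun a b => g a b W) by bal; apply: gm1.
under eq_tsum => Y Z.
  under eq_tsum do rewrite fg.
  rewrite -(comul_coassocf (f := fun a b c => g a b (c * Z))); last first.
  - by move=> *; rewrite -mulrA gm2.
  - by move=> *; rewrite gm1.
  - by move=> *; lin.
  - by move=> *; lin.
  - by move=> *; lin.
  over.
have hb : bal (fun U W => tsum (Δ U) (fun a b => g a b W)).
  by bal; rewrite comul_tgtlf //; apply: eq_tsum => *; rewrite gm2.
by rewrite (lamVKf _ hb) tsum_tens.
Qed.

(* X[+] (x) X[-]+ (x) X[-]- = X(2)[+] (x) X(2)[-] (x) X(1) *)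
Lemma bplus_bminus_comul X :
    (forall b X Y Z, f (X * s b) Y Z = f X (s b * Y) Z) ->
    (forall b X Y Z, f X (Y * t b) Z = f X Y (t b * Z)) ->
  \tsum_(Y ⊗ Z <- bplus_bminus L X) tsum (plus_minus L Z) (f Y) =
  \tsum_(X1 ⊗ X2 <- Δ X) \tsum_(Y ⊗ Z <- bplus_bminus L X2) f Y Z X1.
Proof.
move=> m1 m2; have lamVl := lamV_linear; have muVl := @muV_linear _ _ _ L.
have fb U : balo (f U) by bal.
have fB Z : balB (fun X Y => f X Y Z) by bal.
(* Two maps have to be undone: [h] takes care of μ and [g], built on it, of λ. In terms of [g] both
   sides become 1 ⊗ X(2) ⊗ X(1), the left one by first cancelling λ on the X[-] factors and then μ
   on X[+] ⊗ X[-]. *)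
pose h W U Z := tsum (muV (U ⊗ W)) (fun X Y => f X Y Z).
have h1 U W : linear (fun x => h x U W) by rewrite /h; lin.
have h2 x W : linear (fun U => h x U W) by rewrite /h; lin.
have h3 x U : linear (h x U) by rewrite /h; lin.
have hb W : balo (h W).
  bal; rewrite /h muV_mulr //; apply: eq_tsum => *; by rewrite m2.
have hm b W U Z : h W (t b * U) Z = h (s b * W) U Z.
  by rewrite /h -[t b * U]/(tact t b U) tens_mid.
pose g U W V0 := tsum (lamV (U ⊗ V0)) (h W).
have g1 U W : linear (fun x => g x U W) by rewrite /g; lin.
have g2 x W : linear (fun U => g x U W) by rewrite /g; lin.
have g3 x U : linear (g x U) by rewrite /g; lin.
have gm1 b U W Z : g (t b * U) W Z = g U W (s b * Z).
  by rewrite /g -[t b * U]/(tact t b U) tens_mid.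
have gm2 b U W Z : g U W (t b * Z) = g U (s b * W) Z.
  by rewrite /g lamV_tgtl //; apply: eq_tsum => *; rewrite hm.
have gb W : bal (fun a b => g a W b) by bal; apply: gm1.
have gE : \tsum_(X1 ⊗ X2 <- Δ X) g 1 X2 X1 =
    \tsum_(X1 ⊗ X2 <- Δ X) \tsum_(Y ⊗ Z <- bplus_bminus L X2) f Y Z X1.
  apply: eq_tsum => X1 X2; rewrite /bplus_bminus -[RHS]/(h X2 1 X1).
  rewrite -[RHS]lamKf // comul1 tsum_tens ?mul1r //.
  change (bal (fun a b => g a X2 (b * X1))).
  by bal; rewrite /tact gm1 mulrA.
have fg Y U W : f Y U W =
    \tsum_(Y1 ⊗ Y2 <- Δ Y) \tsum_(a ⊗ b <- Δ Y1) \tsum_(U1 ⊗ U2 <- Δ U)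
      g (a * U1) Y2 (b * (U2 * W)).
  rewrite -(muKf _ _ (fB W)); apply: eq_tsum => Y1 Y2.
  rewrite -[LHS]/(h Y2 (Y1 * U) W) -lamKf //.
  rewrite -[LHS]/(tsum (Δ (Y1 * U)) (fun a b => g a Y2 (b * W))).
  rewrite comul_mulf; last by bal; rewrite /tact gm1 mulrA.
  by apply: eq_tsum => a b; apply: eq_tsum => *; rewrite mulrA.
rewrite -gE; clear gE hm hb; clearbody g.
have gx c Y2 : bal (fun a b => g (a * c) Y2 b).
  by bal; rewrite /tact -mulrA gm1.
have gy Y1 Y2 : bal (fun c d => \tsum_(a ⊗ b <- Δ Y1) g (a * c) Y2 (b * d)).
  bal; rewrite /tact; under eq_tsum do rewrite mulrA.
  rewrite (comul_takeuchif (f := fun a b => g (a * m) Y2 (b * n))).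
    by apply: eq_tsum => *; rewrite mulrA.
  by bal; rewrite /tact -mulrA gm1 mulrA.
transitivity (\tsum_(Y ⊗ Z <- bplus_bminus L X)
    \tsum_(Y1 ⊗ Y2 <- Δ Y) \tsum_(a ⊗ b <- Δ Y1) g (a * Z) Y2 b).
  apply: eq_tsum => Y Z; under eq_tsum do rewrite fg.
  rewrite exchange_tsum; apply: eq_tsum => Y1 Y2.
  under eq_tsum do rewrite exchange_tsum.
  rewrite (lamVKf _ (gy Y1 Y2)) tsum_tens //.
  by apply: eq_tsum => *; rewrite mulr1.
under eq_tsum => Y Z.
  rewrite (comul_coassocf (f := fun a b c => g (a * Z) c b)).
  - over.
  - by move=> *; lin.
  - by move=> *; lin.
  - by move=> *; lin.
  - by move=> *; rewrite -mulrA gm1.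
  - by move=> *; rewrite gm2.
have gz U : bal (fun b c => g U c b) by bal; rewrite /tact gm2.
have hb : bal (fun U W => tsum (Δ W) (fun b c => g U c b)).
  by bal; rewrite comul_srclf //; apply: eq_tsum => *; rewrite /tact gm1.
by rewrite (muVKf _ hb) tsum_tens.
Qed.

End Trilinear.
End HopfIdentities.

(** * From anti-cleft to crossed product *)

(* rt and r stand for rho~ and rho. *)

Section CoinvariantVal.
Variables (k : fieldType) (B H : algType k) (L : bialgebroid B H).
Variables (P : algType k) (A : comodule_algebra L P).

Lemma coinv_val_linear : linear (val : coinv A -> P).
Proof. by []. Qed.

Lemma coinv_valM (m n : coinv A) : val (m * n) = val m * val n.
Proof. by []. Qed.

Lemma coinv_val1 : val (1 : coinv A) = 1.
Proof. by []. Qed.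

End CoinvariantVal.

Section ColinearSection.
Variables (k : fieldType) (B H : algType k) (L : bialgebroid B H).
Variables (P : algType k) (A : comodule_algebra L P) (V : lmodType k).
Local Notation s := (src L).
Local Notation t := (tgt L).
Local Notation ε := (counit L).
Local Notation Δ := (comul L).
Local Notation η := (GRing.Linear.sort (eta A)).
Local Notation δ := (coact A).
Local Notation bal f := (balanced (fun b p => η b * p) (fun b X => s b * X) f).
Variable rt : {linear H -> P}.
Hypothesis rt_colinear : colinear Δ δ rt.

Lemma colinear_tgt b X : rt (t b * X) = η b * rt X.
Proof. by case: rt_colinear => /(_ b X). Qed.

Lemma colinear_coact (f : P -> H -> V) X : bal f ->
  tsum (δ (rt X)) f = \tsum_(X1 ⊗ X2 <- Δ X) f (rt X1) X2.
Proof.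
move=> fb; case: rt_colinear => _ ->; rewrite tsum_tsum //.
by apply: eq_tsum => *; rewrite tsum_tens.
Qed.

End ColinearSection.

(** The right action of the opposite of B is determined by the coaction ([coact_counit_srcr]), so a
    colinear map respects it. *)
Lemma colinear_tgtr (k : fieldType) (B H : algType k) (L : bialgebroid B H)
    (P : algType k) (A : comodule_algebra L P) (rt : {linear H -> P}) b X :
  colinear (comul L) (coact A) rt -> rt (X * tgt L b) = rt X * eta A b.
Proof.
move=> rtc; rewrite -(coact_counit_srcr (regular L) X b) /= -coact_counit_srcr.
rewrite (colinear_coact rtc); last by bal; rewrite -mulrA counit_src etaM mulrA.
rewrite (linear_out (g := rt)); last exact: linearPf.
by apply: eq_tsum => X1 X2; rewrite (colinear_tgt rtc).
Qed.

Section AntiCleft.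
Variables (k : fieldType) (B H : algType k) (L : hopf_algebroid B H).
Variables (P : algType k) (A : comodule_algebra L P).
Local Notation s := (src L).
Local Notation t := (tgt L).
Local Notation ε := (counit L).
Local Notation Δ := (comul L).
Local Notation η := (GRing.Linear.sort (eta A)).
Local Notation δ := (coact A).
Local Notation bal f := (balanced (fun b p => η b * p) (fun b X => s b * X) f).
Local Notation balB f := (balanced (fun b X => X * s b) (fun b X => s b * X) f).
Variables (i : {lrmorphism B -> coinv A}) (rt r : {linear H -> P}).
Hypothesis rt_colinear : colinear Δ δ rt.
Hypothesis rt_src : forall b X, rt (s b * X) = val (i b) * rt X.
Hypothesis r_tgt : forall b X, r (t b * X) = η b * r X.
Hypothesis r_src : forall b X, r (X * s b) = r X * val (i b).
Hypothesis rt_r :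
  forall X, \tsum_(Y ⊗ Z <- plus_minus L X) (rt Y * r Z) = val (i (ε X)).
Hypothesis r_rt :
  forall X, \tsum_(Y ⊗ Z <- bplus_bminus L X) (r Y * rt Z) = η (ε X).

(* Uniqueness of inverses: delta o r and r(X(1)) (x) X(2) are both inverse, in the
   anti-skewed sense, to delta o rt. *)
Lemma anti_inverse_coact (V : lmodType k) (f : P -> H -> V) X : bal f ->
  tsum (δ (r X)) f = \tsum_(X1 ⊗ X2 <- Δ X) f (r X1) X2.
Proof.
move=> fb.
have fm b q Y : f (η b * q) Y = f q (s b * Y) by exact: balanced_mid fb b q Y.
have f1 Y : linear (fun q => f q Y) by exact: balanced_linl fb.
have f2 q : linear (f q) by exact: balanced_linr fb.
(* [G] pairs q ⊗ Z with δ(q)(r(Z(1)) ⊗ Z(2)). The sum of G(r(X[+]) rt(X[-]+), X[-]-) is evaluated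
   twice. By [bplus_bminus_comul] the factors r and rt cancel through [r_rt], leaving r(X(1)) ⊗
   X(2). *)
pose G q Z := \tsum_(Z1 ⊗ Z2 <- Δ Z) \tsum_(q0 ⊗ q1 <- δ q) f (q0 * r Z1) (q1 * Z2).
have fc Z1 Z2 : bal (fun q0 q1 => f (q0 * r Z1) (q1 * Z2)).
  by bal; rewrite -!mulrA fm.
have fd q : balanced (tact t) (fun b X => s b * X)
    (fun Z1 Z2 => \tsum_(q0 ⊗ q1 <- δ q) f (q0 * r Z1) (q1 * Z2)).
  bal; rewrite /tact r_tgt; under eq_tsum do rewrite mulrA.
  rewrite (coact_takeuchif (f := fun q0 q1 => f (q0 * r m) (q1 * n))) //.
  by apply: eq_tsum => *; rewrite mulrA.
have G1 Z : linear (fun q => G q Z) by rewrite /G; lin.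
have G2 q : linear (G q) by rewrite /G; lin.
have Gm b q Z : G (q * η b) Z = G q (t b * Z).
  rewrite /G [RHS]comul_tgtlf //; apply: eq_tsum => Z1 Z2.
  by rewrite coact_etar //; apply: eq_tsum => *; rewrite mulrA.
have e : \tsum_(Y ⊗ Z <- bplus_bminus L X)
      tsum (plus_minus L Z) (fun Z' Z'' => G (r Y * rt Z') Z'') =
    \tsum_(X1 ⊗ X2 <- Δ X) \tsum_(Y ⊗ Z <- bplus_bminus L X2) G (r Y * rt Z) X1.
  apply: (@bplus_bminus_comul _ _ _ L V (fun X Y Z => G (r X * rt Y) Z)).
  - by move=> *; lin.
  - by move=> *; lin.
  - by move=> *; lin.
  - by move=> *; rewrite r_src rt_src mulrA.
  - by move=> *; rewrite (colinear_tgtr _ _ rt_colinear) mulrA Gm.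
have Gl b Z : G (η b) Z = tsum (Δ (t b * Z)) (fun Z1 Z2 => f (r Z1) Z2).
  rewrite comul_tgtlf; last by bal; rewrite /tact r_tgt fm.
  by apply: eq_tsum => *; rewrite coact_eta tsum_tens // mul1r.
have er : \tsum_(X1 ⊗ X2 <- Δ X) \tsum_(Y ⊗ Z <- bplus_bminus L X2) G (r Y * rt Z) X1 =
    \tsum_(X1 ⊗ X2 <- Δ X) f (r X1) X2.
  rewrite -(comul_counitr L (f := fun Z => tsum (Δ Z) (fun Z1 Z2 => f (r Z1) Z2)));
    last first.
    by lin; rewrite /tact r_tgt fm.
  apply: eq_tsum => X1 X2.
  by rewrite -(linear_out (g := fun q => G q X1)) // r_rt Gl.
(* The second evaluation: δ(rt(X[-]+)) cancels against r(X[-]-(1)) ⊗ X[-]-(2) by [comul_plus_minus]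
   and [rt_r]. What remains is δ(r(X[+]s(ε(X[-])))) = δ(r(X)). *)
rewrite -er -e -{1}[X](bplus_bminus_src_counit L).
rewrite (linear_out (g := fun X => tsum (δ (r X)) f)); last by lin.
apply: eq_tsum => Y Z.
pose f6 Y' Z' W := \tsum_(p0 ⊗ p1 <- δ (r Y)) f (p0 * (rt Y' * r Z')) (p1 * W).
transitivity (\tsum_(Y' ⊗ Z' <- plus_minus L Z) f6 Y' Z' 1).
  rewrite r_src coact_coinvr // -rt_r /f6 exchange_tsum; apply: eq_tsum => p0 p1.
  rewrite mulr1 (linear_out (g := fun q => p0 * q)); last by lin.
  by rewrite (linear_out (g := fun q => f q p1)).
rewrite -(@comul_plus_minus _ _ _ L V f6).
- apply: eq_tsum => Y' Z'; rewrite /G exchange_tsum; apply: eq_tsum => Z1 Z2.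
  rewrite /f6 coact_mulf // [RHS]exchange_tsum.
  rewrite (colinear_coact rt_colinear).
    apply: eq_tsum => Y1 Y2; apply: eq_tsum => p0 p1; by rewrite !mulrA.
  bal.
  under eq_tsum do rewrite mulrA.
  rewrite (coact_takeuchif (f := fun p0 p1 => f (p0 * m * r Z1) (p1 * n * Z2))).
    by apply: eq_tsum => *; rewrite !mulrA.
  by bal; rewrite -!mulrA fm.
- by rewrite /f6 => *; lin.
- by rewrite /f6 => *; lin.
- by rewrite /f6 => *; lin.
- move=> b Y1 Y2 W; rewrite /f6; apply: eq_tsum => *.
  by rewrite (colinear_tgtr _ _ rt_colinear) r_tgt mulrA.
- move=> b Y1 Y2 W; rewrite /f6.
  under eq_tsum do rewrite (colinear_tgt rt_colinear) -(mulrA (η b)) (mulrA _ (η b)).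
  rewrite (coact_takeuchif (f := fun p0 p1 => f (p0 * (rt Y1 * r Y2)) (p1 * W))).
    by apply: eq_tsum => *; rewrite !mulrA.
  by bal; rewrite -!mulrA fm.
Qed.
End AntiCleft.

(** * The projection p ↦ p+ ρ(p-) onto the coinvariants *)

Section CoinvariantProjection.
Variables (k : fieldType) (B H : algType k) (L : hopf_algebroid B H).
Variables (P : algType k) (A : comodule_algebra L P).
Local Notation s := (src L).
Local Notation t := (tgt L).
Local Notation ε := (counit L).
Local Notation Δ := (comul L).
Local Notation η := (GRing.Linear.sort (eta A)).
Local Notation δ := (coact A).
Local Notation PdH := (diamond s (fun b p => η b * p)).
Local Notation PoH := (tensor (fun b p => p * η b) (fun b X => t b * X)).
Local Notation lamP := (@reversible_map k B H P L A).
Local Notation bal f := (balanced (fun b p => η b * p) (fun b X => s b * X) f).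
Local Notation balo f := (balanced (fun b p => p * η b) (fun b X => t b * X) f).
Variables (i : {lrmorphism B -> coinv A}) (rt r : {linear H -> P}).
Hypothesis rt_colinear : colinear Δ δ rt.
Hypothesis rt_src : forall b X, rt (s b * X) = val (i b) * rt X.
Hypothesis r_tgt : forall b X, r (t b * X) = η b * r X.
Hypothesis r_src : forall b X, r (X * s b) = r X * val (i b).
Hypothesis rt_r :
  forall X, \tsum_(Y ⊗ Z <- plus_minus L X) (rt Y * r Z) = val (i (ε X)).
Hypothesis r_rt :
  forall X, \tsum_(Y ⊗ Z <- bplus_bminus L X) (r Y * rt Z) = η (ε X).
Variable th : PdH -> PoH.
Hypotheses (lamPK : cancel lamP th) (thK : cancel th lamP).

Definition coinv_proj_val (p : P) : P := \tsum_(q ⊗ X <- th (p ⊗ 1)) (q * r X).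

Fact coinv_proj_balanced : balo (fun q X => q * r X).
Proof. by bal; rewrite r_tgt mulrA. Qed.

Fact coinv_proj_val_linear : linear coinv_proj_val.
Proof.
have thl := th_linear lamPK thK; have fb := coinv_proj_balanced.
by rewrite /coinv_proj_val; lin.
Qed.

(** By colinearity of r, δ(p+ r(p-)) = p+(0) r(p-(1)) ⊗ p+(1)p-(2), and [coact_plus_minus] turns the
    second leg into 1. *)
Fact coinv_proj_subproof p : coinv_proj_val p \in coinvariant A.
Proof.
apply/coinvariantP; rewrite /coinv_proj_val.
rewrite (linear_out (g := δ)); last exact: linearPf.
have e := @coact_plus_minus _ _ _ L P A th lamPK thK _ 
  (fun q X Y => (q * r X) ⊗ Y : PdH) p.
rewrite (linear_out (g := fun q => q ⊗ 1)); last by lin.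
rewrite -e.
- apply: eq_tsum => q X; rewrite -[LHS]tsum_tensE coact_mulf; last by bal.
  rewrite exchange_tsum.
  rewrite (anti_inverse_coact rt_colinear rt_src r_tgt r_src rt_r r_rt).
    exact: exchange_tsum.
  by apply: coact_mul_balanced; bal.
- by move=> *; lin.
- by move=> *; lin.
- by move=> *; lin.
- by move=> *; rewrite r_tgt mulrA.
- by move=> *; rewrite -mulrA tens_mid.
Qed.

Definition coinv_proj_fun p : coinv A := Coinv (coinv_proj_subproof p).

Fact coinv_proj_linear : linear coinv_proj_fun.
Proof. by move=> a p q; apply: val_inj; exact: coinv_proj_val_linear. Qed.

HB.instance Definition _ :=
  GRing.isLinear.Build k P (coinv A) *:%R coinv_proj_fun coinv_proj_linear.

Definition coinv_proj : {linear P -> coinv A} := coinv_proj_fun.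

Lemma coinv_projE p :
  val (coinv_proj p) = \tsum_(q ⊗ X <- th (p ⊗ 1)) (q * r X).
Proof. by []. Qed.

Lemma coinv_proj_mull n p : coinv_proj (val n * p) = n * coinv_proj p.
Proof.
apply: val_inj; rewrite coinv_valM !coinv_projE.
rewrite (th_coinvl lamPK thK _ _ _ coinv_proj_balanced).
rewrite (linear_out (g := fun q => val n * q)); last by lin.
by apply: eq_tsum => *; rewrite mulrA.
Qed.

Lemma coinv_proj_eta b p : coinv_proj (η b * p) = coinv_proj p * i b.
Proof.
apply: val_inj; rewrite coinv_valM !coinv_projE tens_mid mulr1 -[s b]mul1r.
rewrite (th_mulr lamPK thK _ _ _ coinv_proj_balanced).
rewrite (linear_out (g := fun q => q * val (i b))); last by lin.
by apply: eq_tsum => *; rewrite r_src mulrA.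
Qed.

(** Colinearity of [rt] gives rt(X)+ ⊗ rt(X)- = rt(X+) ⊗ X-, so the projection of rt(X) is the left
    side of [rt_r]. *)
Lemma coinv_proj_section X : coinv_proj (rt X) = i (ε X).
Proof.
apply: val_inj; rewrite coinv_projE -rt_r.
have fb := coinv_proj_balanced.
rewrite (th_eqf lamPK _ (u := \tsum_(Y ⊗ Z <- plus_minus L X) (rt Y ⊗ Z : PoH))).
  by rewrite tsum_tsum //; apply: eq_tsum => *; rewrite tsum_tens.
rewrite (linear_out (g := lamP)); last exact: reversible_map_linear.
have gb : balanced (tact t) (fun b X => s b * X) (fun X Y => rt X ⊗ Y : PdH).
  by bal; rewrite /tact (colinear_tgt rt_colinear) tens_mid.
rewrite -[RHS](tsum_tens _ _ gb) -(lamVKf _ gb); apply: eq_tsum => Y Z.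
rewrite reversible_map_tens (colinear_coact rt_colinear) //.
by bal; rewrite tens_mid mulrA.
Qed.

(** By [plus_minus_coact] the sum is p+ r(p-[+]) rt(p-[-]) = p+ η(ε(p-)), which is p by
    [plus_minus_counit]. *)
Lemma coinv_proj_coact p : \tsum_(p0 ⊗ p1 <- δ p) (val (coinv_proj p0) * rt p1) = p.
Proof.
under eq_tsum => p0 p1.
  rewrite coinv_projE (linear_out (g := fun q => q * rt p1)); last by lin.
  over.
rewrite (plus_minus_coact lamPK thK (f := fun q X Y => q * r X * rt Y)).
- rewrite -[RHS](plus_minus_counit thK); apply: eq_tsum => q X.
  rewrite -r_rt (linear_out (g := fun x => q * x)); last by lin.
  by apply: eq_tsum => *; rewrite mulrA.
- by move=> *; lin.
- by move=> *; lin.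
- by move=> *; lin.
- by move=> *; rewrite r_tgt mulrA.
- by move=> *; rewrite r_src rt_src !mulrA.
Qed.

End CoinvariantProjection.

(** * The comodule N ⊗_B H and colinear isomorphisms onto it *)

Section NtensHTheory.
Variables (k : fieldType) (B H : algType k) (L : bialgebroid B H).
Variables (N : algType k) (i : {lrmorphism B -> N}).
Local Notation s := (src L).
Local Notation t := (tgt L).
Local Notation ε := (counit L).
Local Notation Δ := (comul L).
Local Notation T := (NtensH L i).
Local Notation dT := (diamond s (NtensH_act (L := L) (i := i))).
Local Notation balT f := (balanced (fun b n => n * i b) (fun b X => s b * X) f).

Fact NtensH_lmul_balanced n : balT (fun m X => (n * m) ⊗ X : T).
Proof. by bal; rewrite mulrA tens_mid. Qed.

Lemma NtensH_lmul_tens n m X : NtensH_lmul n (m ⊗ X : T) = (n * m) ⊗ X.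
Proof. exact: tsum_tens (NtensH_lmul_balanced n). Qed.

Lemma NtensH_lmul_linear n : linear (@NtensH_lmul _ _ _ L N i n).
Proof. exact/linear_tsum/linear_id_fun/NtensH_lmul_balanced. Qed.

Fact NtensH_act_balanced b : balT (fun m X => m ⊗ tact t b X : T).
Proof. by bal; rewrite tens_mid /tact !mulrA src_tgtC. Qed.

Lemma NtensH_act_tens b m X : NtensH_act b (m ⊗ X : T) = m ⊗ (t b * X).
Proof. exact: tsum_tens (NtensH_act_balanced b). Qed.

Lemma NtensH_act_linear b : linear (@NtensH_act _ _ _ L N i b).
Proof. exact/linear_tsum/linear_id_fun/NtensH_act_balanced. Qed.

Fact NtensH_coact_balanced :
  balT (fun n X => \tsum_(X1 ⊗ X2 <- Δ X) ((n ⊗ X1 : T) ⊗ X2 : dT)).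
Proof.
have fb m : balanced (tact t) (fun b X => s b * X) (fun X1 X2 => (m ⊗ X1 : T) ⊗ X2 : dT).
  by bal; rewrite /tact -NtensH_act_tens tens_mid.
by bal; rewrite comul_srclf //; apply: eq_tsum => *; rewrite tens_mid.
Qed.

Lemma NtensH_coact_tens n X :
  NtensH_coact (n ⊗ X : T) = \tsum_(X1 ⊗ X2 <- Δ X) ((n ⊗ X1 : T) ⊗ X2 : dT).
Proof. exact: tsum_tens NtensH_coact_balanced. Qed.

Lemma NtensH_coact_linear : linear (@NtensH_coact _ _ _ L N i).
Proof. exact/linear_tsum/linear_id_fun/NtensH_coact_balanced. Qed.

End NtensHTheory.

Section ColinearInverse.
Variables (k : fieldType) (B H : algType k) (L : bialgebroid B H).
Variables (P : algType k) (A : comodule_algebra L P).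
Variables (N : algType k) (i : {lrmorphism B -> N}).
Local Notation s := (src L).
Local Notation η := (GRing.Linear.sort (eta A)).
Local Notation T := (NtensH L i).
Local Notation PdH := (diamond s (fun b p => η b * p)).
Variables (phi : {linear P -> T}) (psi : T -> P).
Hypotheses (phiK : cancel phi psi) (psiK : cancel psi phi).
Hypothesis phi_colinear : colinear (coact A) (NtensH_coact (L := L) (i := i)) phi.

Lemma colinear_inv_act b u : psi (NtensH_act b u) = η b * psi u.
Proof. by apply: (can_inj phiK); rewrite phi_colinear.1 !psiK. Qed.

Lemma colinear_inv_coact n X :
  coact A (psi (n ⊗ X)) =
  \tsum_(X1 ⊗ X2 <- comul L X) (psi (n ⊗ X1) ⊗ X2 : PdH).
Proof.
have psil : linear psi by exact: linear_inverse (linearPf phi) phiK psiK.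
have Fb : balanced (NtensH_act (L := L) (i := i)) (fun b X => s b * X)
    (fun u X => psi u ⊗ X : PdH).
  by bal; rewrite -tens_mid colinear_inv_act.
have := congr1 (fun u => tsum u (fun u X => psi u ⊗ X : PdH))
  (phi_colinear.2 (psi (n ⊗ X))).
rewrite psiK NtensH_coact_tens !tsum_tsum //.
under eq_tsum do rewrite tsum_tens //.
under [X in _ = X -> _]eq_tsum do rewrite tsum_tens // phiK.
by rewrite tsum_tensE => <-.
Qed.

End ColinearInverse.

(** * The normal basis defined by a section and a projection *)

Section NormalBasisData.
Variables (k : fieldType) (B H : algType k) (L : hopf_algebroid B H).
Variables (P : algType k) (A : comodule_algebra L P).
Local Notation s := (src L).
Local Notation t := (tgt L).
Local Notation ε := (counit L).
Local Notation Δ := (comul L).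
Local Notation η := (GRing.Linear.sort (eta A)).
Local Notation δ := (coact A).
Local Notation bal f := (balanced (fun b p => η b * p) (fun b X => s b * X) f).
Local Notation balo f := (balanced (fun b p => p * t b) (fun b X => t b * X) f).
Variables (i : {lrmorphism B -> coinv A}) (rt : {linear H -> P}) (pi
  : {linear P -> coinv A}).
Hypothesis rt_colinear : colinear Δ δ rt.
Hypothesis rt_src : forall b X, rt (s b * X) = val (i b) * rt X.
Hypothesis pi_mull : forall n p, pi (val n * p) = n * pi p.
Hypothesis pi_eta : forall b p, pi (η b * p) = pi p * i b.
Hypothesis pi_rt : forall X, pi (rt X) = i (ε X).
Hypothesis pi_coact : forall p, \tsum_(p0 ⊗ p1 <- δ p) (val (pi p0) * rt p1) = p.

Local Notation balT f := (balanced (fun b n => n * i b) (fun b X => s b * X) f).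
Local Notation T := (NtensH L i).

Fact normal_basis_balanced : bal (fun p X => pi p ⊗ X : T).
Proof. by bal; rewrite pi_eta tens_mid. Qed.

Definition normal_basis_fun p : T := \tsum_(p0 ⊗ p1 <- δ p) (pi p0 ⊗ p1).

Fact normal_basis_linear : linear normal_basis_fun.
Proof. apply: linear_tsum; [exact: normal_basis_balanced | exact: linearPf]. Qed.

HB.instance Definition _ :=
  GRing.isLinear.Build k P T *:%R normal_basis_fun normal_basis_linear.

Definition normal_basis_map : {linear P -> T} := normal_basis_fun.

Lemma normal_basis_mapP p :
  normal_basis_map p = \tsum_(p0 ⊗ p1 <- δ p) (pi p0 ⊗ p1).
Proof. by []. Qed.

Fact normal_basis_inv_balanced : balT (fun n X => val n * rt X).
Proof. by bal; rewrite rt_src mulrA. Qed.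

Definition normal_basis_inv : {linear T -> P} := tlift normal_basis_inv_balanced.

Lemma normal_basis_mapE (f : coinv A -> H -> P) p : balT f ->
  tsum (normal_basis_map p) f = \tsum_(p0 ⊗ p1 <- δ p) f (pi p0) p1.
Proof. by move=> fb; rewrite tsum_tsum //; apply: eq_tsum => *; rewrite tsum_tens. Qed.

Lemma normal_basis_mapK : cancel normal_basis_map normal_basis_inv.
Proof.
move=> p; rewrite -[LHS]/(tsum (normal_basis_map p) _).
by rewrite normal_basis_mapE ?pi_coact //; exact: normal_basis_inv_balanced.
Qed.

Lemma normal_basis_invK : cancel normal_basis_inv normal_basis_map.
Proof.
apply: eq_linear_tens => [||n X].
- by apply: linear_comp_fun; exact: linearPf.
- exact: linear_id_fun.
rewrite tliftE normal_basis_mapP.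
have fb := normal_basis_balanced.
rewrite coact_coinvl // (colinear_coact rt_colinear); last first.
  by bal; rewrite mulrA coinv_eta -mulrA pi_eta tens_mid.
under eq_tsum do rewrite pi_mull pi_rt tens_mid.
by rewrite (comul_counitl L (f := fun X => n ⊗ X : T)) //; lin.
Qed.

Lemma normal_basis_map_bij : bijective normal_basis_map.
Proof. exact: Bijective normal_basis_mapK normal_basis_invK. Qed.

Lemma normal_basis_map_colinear :
  colinear δ (NtensH_coact (L := L) (i := i)) normal_basis_map.
Proof.
have fb := normal_basis_balanced; split=> [b p | p].
  rewrite !normal_basis_mapP coact_etal //.
  rewrite (linear_out (g := @NtensH_act _ _ _ L _ i b)); last exact: NtensH_act_linear.
  by apply: eq_tsum => *; rewrite NtensH_act_tens.
rewrite normal_basis_mapP.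
rewrite (linear_out (g := @NtensH_coact _ _ _ L _ i)); last exact: NtensH_coact_linear.
under eq_tsum do rewrite NtensH_coact_tens.
rewrite -(coact_coassoc (f := fun p X Y => (pi p ⊗ X : T) ⊗ Y
  : diamond s (NtensH_act (L := L) (i := i)))).
- apply: eq_tsum => p0 p1.
  by rewrite normal_basis_mapP (linear_out (g := fun u => u ⊗ p1)); last by lin.
- by move=> *; lin.
- by move=> *; lin.
- by move=> *; lin.
- by move=> *; rewrite pi_eta tens_mid.
- by move=> *; rewrite -NtensH_act_tens tens_mid.
Qed.

End NormalBasisData.

(** * The cocycle of a normalised section and its inverse *)

Section CrossedProduct.
Variables (k : fieldType) (B H : algType k) (L : hopf_algebroid B H).
Variables (P : algType k) (A : comodule_algebra L P).
Local Notation s := (src L).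
Local Notation t := (tgt L).
Local Notation ε := (counit L).
Local Notation Δ := (comul L).
Local Notation η := (GRing.Linear.sort (eta A)).
Local Notation δ := (coact A).
Local Notation bal f := (balanced (fun b p => η b * p) (fun b X => s b * X) f).
Local Notation balH f := (balanced (tact t) (fun b X => s b * X) f).
Local Notation balo f := (balanced (fun b p => p * t b) (fun b X => t b * X) f).
Local Notation balB f := (balanced (fun b X => X * s b) (fun b X => s b * X) f).
Variables (i : {lrmorphism B -> coinv A}) (rt : {linear H -> P}) (pi
  : {linear P -> coinv A}).
Hypothesis rt_colinear : colinear Δ δ rt.
Hypothesis rt_src : forall b X, rt (s b * X) = val (i b) * rt X.
Hypothesis rt1 : rt 1 = 1.
Hypothesis pi_mull : forall n p, pi (val n * p) = n * pi p.
Hypothesis pi_eta : forall b p, pi (η b * p) = pi p * i b.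
Hypothesis pi_rt : forall X, pi (rt X) = i (ε X).
Hypothesis pi_coact : forall p, \tsum_(p0 ⊗ p1 <- δ p) (val (pi p0) * rt p1) = p.

Local Notation T := (NtensH L i).

Let rt_tgt b X : rt (t b * X) = η b * rt X.
Proof. exact: colinear_tgt rt_colinear b X. Qed.

Let rt_tgtr b X : rt (X * t b) = rt X * η b.
Proof. exact: colinear_tgtr rt_colinear. Qed.

Definition cross_act (X : H) (n : coinv A) : coinv A := pi (rt X * val n).

Fact cross_act_bilinear : bilinear_for *:%R *:%R cross_act.
Proof.
split=> [n|X]; rewrite /cross_act; first by lin.
by move=> a m n; rewrite coinv_val_linear mulrDr -scalerAr linearP.
Qed.

HB.instance Definition _ :=
  bilinear_isBilinear.Build k H (coinv A) (coinv A) *:%R *:%R cross_act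
    cross_act_bilinear.

Fact cross_sig_balanced : balo (fun X Y => pi (rt X * rt Y)).
Proof. by bal; rewrite rt_tgt rt_tgtr mulrA. Qed.

Definition cross_sig : {linear HoppH L -> coinv A} := tlift cross_sig_balanced.

Lemma cross_sigE X Y : cross_sig (X ⊗ Y) = pi (rt X * rt Y).
Proof. exact: tliftE. Qed.

Lemma pi1 (n : coinv A) : pi (val n) = n.
Proof. by rewrite -[val n]mulr1 pi_mull -rt1 pi_rt counit1 rmorph1 mulr1. Qed.

(** [pi_coact] applied to rt(X)n: the commutation rule of the crossed product, read inside P.
    [sectionM] is the same for rt(X) rt(Y). *)
Lemma section_coinv X (n : coinv A) :
  \tsum_(X1 ⊗ X2 <- Δ X) (val (pi (rt X1 * val n)) * rt X2) = rt X * val n.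
Proof.
have fb : bal (fun p Y => val (pi p) * rt Y).
  by bal; rewrite pi_eta rt_src mulrA.
rewrite -[RHS]pi_coact coact_coinvr // (colinear_coact rt_colinear) //.
by bal; rewrite -!mulrA pi_eta rt_src !mulrA.
Qed.

Lemma sectionM X Y :
  \tsum_(X1 ⊗ X2 <- Δ X) \tsum_(Y1 ⊗ Y2 <- Δ Y)
    (val (pi (rt X1 * rt Y1)) * rt (X2 * Y2)) = rt X * rt Y.
Proof.
have fb : bal (fun p Y => val (pi p) * rt Y).
  by bal; rewrite pi_eta rt_src mulrA.
rewrite -[RHS]pi_coact coact_mulf // exchange_tsum [RHS]exchange_tsum.
rewrite (colinear_coact rt_colinear); last exact: coact_mul_balanced fb.
apply: eq_tsum => Y1 Y2; rewrite (colinear_coact rt_colinear) //.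
by bal; rewrite -!mulrA pi_eta rt_src !mulrA.
Qed.

Lemma pi_section_coinv X (n : coinv A) q :
  \tsum_(X1 ⊗ X2 <- Δ X) (pi (rt X1 * val n) * pi (rt X2 * q)) =
  pi (rt X * val n * q).
Proof.
rewrite -section_coinv (linear_out (g := fun p : P => pi (p * q))); last by lin.
by apply: eq_tsum => *; rewrite -mulrA pi_mull.
Qed.

Lemma pi_sectionM X Y q :
  \tsum_(X1 ⊗ X2 <- Δ X) \tsum_(Y1 ⊗ Y2 <- Δ Y)
    (pi (rt X1 * rt Y1) * pi (rt (X2 * Y2) * q)) = pi (rt X * rt Y * q).
Proof.
rewrite -sectionM (linear_out (g := fun p : P => pi (p * q))); last by lin.
apply: eq_tsum => *; rewrite (linear_out (g := fun p : P => pi (p * q))); last by lin.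
by apply: eq_tsum => *; rewrite -mulrA pi_mull.
Qed.

Lemma cross_mid b X Y :
  \tsum_(X1 ⊗ X2 <- Δ X) (cross_act X1 (i b) * cross_sig (X2 ⊗ Y)) =
  cross_sig (X ⊗ (s b * Y)).
Proof.
under eq_tsum do rewrite cross_sigE.
by rewrite pi_section_coinv cross_sigE rt_src mulrA.
Qed.

(** Associativity of P: both sides compute π(rt X rt Y rt Z), with the two bracketings.
    [cross_twisted] is the same argument with n in place of rt Z. *)
Lemma cross_cocycle X Y Z :
  \tsum_(X1 ⊗ X2 <- Δ X) \tsum_(Y1 ⊗ Y2 <- Δ Y) \tsum_(Z1 ⊗ Z2 <- Δ Z)
    (cross_act X1 (cross_sig (Y1 ⊗ Z1)) * cross_sig (X2 ⊗ (Y2 * Z2))) =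
  \tsum_(X1 ⊗ X2 <- Δ X) \tsum_(Y1 ⊗ Y2 <- Δ Y)
    (cross_sig (X1 ⊗ Y1) * cross_sig ((X2 * Y2) ⊗ Z)).
Proof.
transitivity (pi (rt X * rt Y * rt Z)).
  rewrite exchange_tsum; under eq_tsum do rewrite exchange_tsum.
  under eq_tsum do under eq_tsum do [under eq_tsum do rewrite !cross_sigE;
    rewrite pi_section_coinv].
  rewrite -mulrA -sectionM (linear_out (g := fun p : P => pi (rt X * p))); last by lin.
  apply: eq_tsum => *; rewrite (linear_out (g := fun p : P => pi (rt X * p)));
    last by lin.
  by apply: eq_tsum => *; rewrite mulrA.
by under [RHS]eq_tsum do under eq_tsum do rewrite !cross_sigE; rewrite pi_sectionM.
Qed.

Lemma cross_twisted X Y n :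
  \tsum_(X1 ⊗ X2 <- Δ X) \tsum_(Y1 ⊗ Y2 <- Δ Y)
    (cross_sig (X1 ⊗ Y1) * cross_act (X2 * Y2) n) =
  \tsum_(X1 ⊗ X2 <- Δ X) \tsum_(Y1 ⊗ Y2 <- Δ Y)
    (cross_act X1 (cross_act Y1 n) * cross_sig (X2 ⊗ Y2)).
Proof.
transitivity (pi (rt X * rt Y * val n)).
  by under eq_tsum do under eq_tsum do rewrite cross_sigE; rewrite pi_sectionM.
rewrite exchange_tsum.
under [RHS]eq_tsum do [under eq_tsum do rewrite cross_sigE; rewrite pi_section_coinv].
rewrite -mulrA -section_coinv (linear_out (g := fun p : P => pi (rt X * p))); last by lin.
by apply: eq_tsum => *; rewrite mulrA.
Qed.

Fact cross_act_lin b b' X n :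
  cross_act (s b * t b' * X) n = i b * cross_act X n * i b'.
Proof. by rewrite /cross_act -mulrA rt_src rt_tgt -!mulrA pi_mull pi_eta. Qed.

Fact cross_act_1r X : cross_act X 1 = i (ε X).
Proof. by rewrite /cross_act coinv_val1 mulr1 pi_rt. Qed.

Fact cross_actM X m n :
  cross_act X (m * n) = \tsum_(X1 ⊗ X2 <- Δ X) (cross_act X1 m * cross_act X2 n).
Proof. by rewrite pi_section_coinv -mulrA. Qed.

Fact cross_sig_lin b b' X Y :
  cross_sig ((s b * t b' * X) ⊗ Y) = i b * cross_sig (X ⊗ Y) * i b'.
Proof. by rewrite !cross_sigE -mulrA rt_src rt_tgt -!mulrA pi_mull pi_eta mulrA. Qed.

Fact cross_sig_1r X : cross_sig (X ⊗ 1) = i (ε X).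
Proof. by rewrite cross_sigE rt1 mulr1 pi_rt. Qed.

Fact cross_sig_1l X : cross_sig (1 ⊗ X) = i (ε X).
Proof. by rewrite cross_sigE rt1 mul1r pi_rt. Qed.

Fact cross_act_1l n : cross_act 1 n = n.
Proof. by rewrite /cross_act rt1 mul1r pi1. Qed.

Definition section_cocycle : cocycle L i :=
  @Cocycle k B H L (coinv A) i cross_act cross_sig cross_act_lin cross_act_1r
    cross_actM cross_sig_lin cross_sig_1r cross_sig_1l cross_mid cross_cocycle
    cross_twisted cross_act_1l.

Lemma section_cocycle_iso : crossed_product_iso A section_cocycle.
Proof.
pose phi := normal_basis_map pi_eta; pose psi := normal_basis_inv rt_src.
have phiK : cancel phi psi by apply: normal_basis_mapK.
have psiK : cancel psi phi by apply: normal_basis_invK.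
exists phi; split.
- exact: Bijective phiK psiK.
- by rewrite /phi normal_basis_mapP coact1 tsum_tens; [rewrite (pi1 1
  : pi 1 = 1) | exact: normal_basis_balanced].
(* After the injective [psi], the product n rt(X) m rt(Y) is brought to normal form: rt(X) is moved
   past m by [section_coinv], then rt(X') rt(Y) is expanded by [sectionM]. *)
- move=> p q; apply: (can_inj psiK); rewrite phiK.
  rewrite -[in LHS](phiK p) -[in LHS](phiK q); move: (phi p) (phi q) => u v.
  rewrite /crossed_mul (linear_out (g := psi)); last exact: linearPf.
  have psiE w : psi w = tsum w (fun n X => val n * rt X) by [].
  rewrite [psi u]psiE.
  rewrite (linear_out (g := fun x => x * psi v)); last by lin.
  apply: eq_tsum => n X; rewrite (linear_out (g := psi)); last exact: linearPf.
  rewrite psiE.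
  rewrite (linear_out (g := fun x => val n * rt X * x)); last by lin.
  apply: eq_tsum => m Y; rewrite (linear_out (g := psi)); last exact: linearPf.
  rewrite mulrA -(mulrA _ (rt X)) -section_coinv.
  rewrite (linear_out (g := fun x => val n * x * rt Y)); last by lin.
  apply: eq_tsum => X1 X'; rewrite (linear_out (g := psi)); last exact: linearPf.
  rewrite mulrA -mulrA -sectionM.
  rewrite (linear_out (g := fun x => val n * val (pi (rt X1 * val m)) * x)); last by lin.
  apply: eq_tsum => X2 X3; rewrite (linear_out (g := psi)); last exact: linearPf.
  rewrite (linear_out (g := fun x => val n * val (pi (rt X1 * val m)) * x)); last by lin.
  apply: eq_tsum => Y1 Y2.
  by rewrite tliftE (cross_sigE X2 Y1 : csig section_cocycle _ = _) /= !mulrA.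
- move=> b; rewrite /phi normal_basis_mapP coact_eta tsum_tens.
    by rewrite (pi1 1 : pi 1 = 1).
  exact: normal_basis_balanced.
- exact: normal_basis_map_colinear.
Qed.

Section Inverse.
Variable r : {linear H -> P}.
Hypothesis r_tgt : forall b X, r (t b * X) = η b * r X.
Hypothesis r_src : forall b X, r (X * s b) = r X * val (i b).
Hypothesis rt_r :
  forall X, \tsum_(Y ⊗ Z <- plus_minus L X) (rt Y * r Z) = val (i (ε X)).
Hypothesis r_rt :
  forall X, \tsum_(Y ⊗ Z <- bplus_bminus L X) (r Y * rt Z) = η (ε X).

(** The solution T of T(X, Y(1)) rt(Y(2)) = rt(XY); [pi_cross_inv] reads it as σ^-1(X(1), Y)
    rt(X(2)). *)
Definition cross_inv X Y := \tsum_(Y' ⊗ Y'' <- plus_minus L Y) (rt (X * Y') * r Y'').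

Let inv_balanced X : balo (fun Y Z => rt (X * Y) * r Z).
Proof. by bal; rewrite r_tgt !mulrA rt_tgtr. Qed.

Lemma cross_inv_linl Y : linear (cross_inv^~ Y).
Proof. by rewrite /cross_inv; lin. Qed.

Lemma cross_inv_linr X : linear (cross_inv X).
Proof. apply: linear_tsum; [exact: inv_balanced | exact: plus_minus_linear]. Qed.

Lemma cross_inv_mid b X Y : cross_inv (X * s b) Y = cross_inv X (s b * Y).
Proof.
rewrite /cross_inv plus_minus_src; last exact: inv_balanced.
by apply: eq_tsum => *; rewrite mulrA.
Qed.

Lemma cross_inv_tgt b X Y : cross_inv X (t b * Y) = cross_inv X Y * val (i b).
Proof.
rewrite /cross_inv plus_minus_tgt; last exact: inv_balanced.
rewrite [RHS](linear_out (g := fun x => x * val (i b))); last by lin.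
by apply: eq_tsum => *; rewrite r_src mulrA.
Qed.

Lemma cross_inv_lin b b' X Y :
  cross_inv (s b * t b' * X) Y = val (i b) * (η b' * cross_inv X Y).
Proof.
rewrite /cross_inv [RHS](linear_out (g := fun x => val (i b) * (η b' * x))); last by lin.
by apply: eq_tsum => *; rewrite -!mulrA rt_src rt_tgt -!mulrA.
Qed.

(** Both [rt] and [r] being colinear, the second leg of the coaction is X(2)Y+(2)Y-(2), and
    [comul_plus_minus] removes the part in Y. *)
Lemma cross_inv_coact (V : lmodType k) (f : P -> H -> V) X Y : bal f ->
  tsum (δ (cross_inv X Y)) f = \tsum_(X1 ⊗ X2 <- Δ X) f (cross_inv X1 Y) X2.
Proof.
move=> fb.
have fm b q Z : f (η b * q) Z = f q (s b * Z) by exact: balanced_mid fb b q Z.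
have f1 Z : linear (fun q => f q Z) by exact: balanced_linl fb.
have f2 q : linear (f q) by exact: balanced_linr fb.
pose F Y' Z' W := \tsum_(X1 ⊗ X2 <- Δ X) f (rt (X1 * Y') * r Z') (X2 * W).
transitivity (\tsum_(Y' ⊗ Z' <- plus_minus L Y) F Y' Z' 1); last first.
  rewrite /F exchange_tsum; apply: eq_tsum => X1 X2.
  rewrite mulr1 /cross_inv (linear_out (g := fun x => f x X2)) //.
have fX Z1 W : balH (fun X1 X2 => f (rt (X1 * Z1) * r W) X2).
  by bal; rewrite /tact -!mulrA rt_tgt -!mulrA fm.
rewrite -(@comul_plus_minus _ _ _ L V F).
- rewrite (linear_out (g := fun x => tsum (δ x) f)); last by lin.
  apply: eq_tsum => Y' Z'; rewrite coact_mulf // exchange_tsum.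
  rewrite (anti_inverse_coact rt_colinear rt_src r_tgt r_src rt_r r_rt);
    last exact: coact_mul_balanced fb.
  rewrite [RHS]exchange_tsum; apply: eq_tsum => Z1 Z2.
  rewrite (colinear_coact rt_colinear) ?comul_mulf /F 1?exchange_tsum.
  - by apply: eq_tsum => *; apply: eq_tsum => *; rewrite mulrA.
  - by bal; rewrite /tact rt_tgt -!mulrA fm.
  - by bal; rewrite -!mulrA fm.
- by rewrite /F => *; lin.
- by rewrite /F => *; lin.
- by rewrite /F => *; lin.
- by move=> *; rewrite /F; apply: eq_tsum => *; rewrite r_tgt !mulrA rt_tgtr.
- move=> b Y1 Y2 W; rewrite /F; under eq_tsum do rewrite mulrA.
  rewrite (comul_takeuchif (f := fun X1 X2 => f (rt (X1 * Y1) * r Y2) (X2 * W))).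
    by apply: eq_tsum => *; rewrite mulrA.
  by bal; rewrite /tact -!mulrA rt_tgt -!mulrA fm.
Qed.

Lemma pi_cross_inv X Y :
  \tsum_(X1 ⊗ X2 <- Δ X) (val (pi (cross_inv X1 Y)) * rt X2) = cross_inv X Y.
Proof.
rewrite -[RHS]pi_coact cross_inv_coact //.
by bal; rewrite pi_eta rt_src mulrA.
Qed.

Lemma pi_cross_invM X Y q :
  \tsum_(X1 ⊗ X2 <- Δ X) (pi (cross_inv X1 Y) * pi (rt X2 * q)) = pi (cross_inv X Y * q).
Proof.
rewrite -pi_cross_inv (linear_out (g := fun p : P => pi (p * q))); last by lin.
by apply: eq_tsum => *; rewrite -mulrA pi_mull.
Qed.

Fact cross_sigV_balanced : balB (fun X Y => pi (cross_inv X Y)).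
Proof.
apply: balancedI => [Y|X|b X Y].
- exact: linear_comp_fun (linearPf _) (cross_inv_linl Y).
- exact: linear_comp_fun (linearPf _) (cross_inv_linr X).
- by rewrite cross_inv_mid.
Qed.

Definition cross_sigV : {linear HtensH L -> coinv A} := tlift cross_sigV_balanced.

Lemma cross_sigVE X Y : cross_sigV (X ⊗ Y) = pi (cross_inv X Y).
Proof. exact: tliftE. Qed.

Lemma section_cocycle_inverse : cocycle_inverse section_cocycle cross_sigV.
Proof.
split=> [b b' X Y|b X Y|X Y|X Y] /=.
- by rewrite !cross_sigVE cross_inv_lin pi_mull pi_eta mulrA.
- under eq_tsum do rewrite cross_sigVE.
  by rewrite pi_cross_invM cross_sigVE cross_inv_tgt.
(* By [comul_plus], Y(1) ⊗ Y(2)+ ⊗ Y(2)- is replaced by Y+(1) ⊗ Y+(2) ⊗ Y-. Then [pi_sectionM]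
   contracts the sum to π(rt(X) rt(Y+) r(Y-)), and [rt_r] finishes. *)
- pose F a b c := \tsum_(X1 ⊗ X2 <- Δ X) (pi (rt X1 * rt a) * pi (rt (X2 * b) * r c)).
  rewrite exchange_tsum.
  transitivity (\tsum_(Y1 ⊗ Y2 <- Δ Y) tsum (plus_minus L Y2) (F Y1)).
    apply: eq_tsum => Y1 Y2; rewrite /F [RHS]exchange_tsum.
    apply: eq_tsum => X1 X2; rewrite cross_sigE cross_sigVE /cross_inv.
    by rewrite (linear_out (g := fun x => pi (rt X1 * rt Y1) * pi x)) //; lin.
  rewrite -(@comul_plus _ _ _ L _ F).
  + under eq_tsum do rewrite /F exchange_tsum.
    transitivity (\tsum_(Y' ⊗ Y'' <- plus_minus L Y) pi (rt X * rt Y' * r Y'')).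
      by apply: eq_tsum => *; rewrite -pi_sectionM.
    rewrite /cross_act coinv_val1 mulr1 pi_rt -rt_r.
    rewrite [RHS](linear_out (g := fun x : P => pi (rt X * x))); last by lin.
    by apply: eq_tsum => *; rewrite mulrA.
  + by rewrite /F => *; lin.
  + by rewrite /F => *; lin.
  + by rewrite /F => *; lin.
  + move=> b U W Z; rewrite /F; under eq_tsum do rewrite rt_tgt mulrA -rt_tgtr.
    rewrite (comul_takeuchif (f := fun X1 X2 => pi (rt X1 * rt U) * pi (rt (X2 * W) * r Z))).
      by apply: eq_tsum => *; rewrite mulrA.
    by bal; rewrite /tact -!mulrA rt_tgt rt_src -!mulrA pi_eta pi_mull mulrA.
  + by move=> b U W Z; rewrite /F; apply: eq_tsum => *; rewrite r_tgt !mulrA rt_tgtr.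
(* By [plus_minus_comul] the sum is π(rt(XY+) r(Y-[+]) rt(Y-[-])); [r_rt] leaves rt(XY+ t(ε(Y-))) =
   rt(XY) under π. *)
- transitivity (\tsum_(Y1 ⊗ Y2 <- Δ Y) pi (cross_inv X Y1 * rt Y2)).
    rewrite exchange_tsum; apply: eq_tsum => Y1 Y2; rewrite -pi_cross_invM.
    by apply: eq_tsum => *; rewrite cross_sigVE cross_sigE.
  rewrite /cross_act coinv_val1 mulr1.
  under eq_tsum => Y1 Y2.
    rewrite /cross_inv (linear_out (g := fun x : P => pi (x * rt Y2))); last by lin.
    over.
  rewrite (@plus_minus_comul _ _ _ L _ (fun U W Z => pi (rt (X * U) * r W * rt Z))).
  + rewrite -[in RHS](plus_minus_tgt_counit L Y).
    rewrite (linear_out (g := fun x : H => pi (rt (X * x)))); last by lin.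
    apply: eq_tsum => U W; rewrite mulrA rt_tgtr -r_rt.
    rewrite (linear_out (g := fun x : P => pi (rt (X * U) * x))); last by lin.
    by apply: eq_tsum => *; rewrite mulrA.
  + by move=> *; lin.
  + by move=> *; lin.
  + by move=> *; lin.
  + by move=> *; rewrite r_tgt !mulrA rt_tgtr.
  + by move=> *; rewrite r_src rt_src !mulrA.
Qed.

End Inverse.

End CrossedProduct.

(** * Normalising the section at 1 *)

Section AntiCleftCrossed.
Variables (k : fieldType) (B H P : algType k).
Variables (HH : hopf_algebroid B H) (A : comodule_algebra HH P).
Local Notation s := (src HH).
Local Notation t := (tgt HH).
Local Notation η := (GRing.Linear.sort (eta A)).

Lemma plus_minus1 (V : lmodType k) (f : H -> H -> V) :
    balanced (fun b X => X * t b) (fun b X => t b * X) f ->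
  tsum (plus_minus HH 1) f = f 1 1.
Proof.
move=> fb; rewrite -(lamKf 1 1 fb) comul1 tsum_tens ?mulr1 //.
have lamVl := @lamV_linear _ _ _ HH.
by bal; rewrite tens_mid mulrA.
Qed.

Lemma bplus_bminus1 (V : lmodType k) (f : H -> H -> V) :
    balanced (fun b X => X * s b) (fun b X => s b * X) f ->
  tsum (bplus_bminus HH 1) f = f 1 1.
Proof.
move=> fb; rewrite -(muKf 1 1 fb) comul1 tsum_tens ?mulr1 //.
have muVl := @muV_linear _ _ _ HH.
by bal; rewrite -tens_mid /tact mulrA.
Qed.

(** Since 1+ ⊗ 1- and 1[+] ⊗ 1[-] are both 1 ⊗ 1, rt(1) and r(1) are mutually inverse, and they are
    coinvariant. Multiplying [rt] on the right by r(1) and [r] on the left by rt(1) keeps all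
    properties. *)
Lemma anti_cleft_normalized : anti_cleft A ->
  exists (i : {lrmorphism B -> coinv A}) (rt r : {linear H -> P}),
    [/\ injective i, rt 1 = 1,
        colinear (comul HH) (coact A) rt /\
        (forall b X, rt (s b * X) = val (i b) * rt X),
        (forall b X, r (t b * X) = η b * r X) /\
        (forall b X, r (X * s b) = r X * val (i b)) &
        (forall X, \tsum_(Y ⊗ Z <- plus_minus HH X) (rt Y * r Z) =
                   val (i (counit HH X))) /\
        (forall X, \tsum_(Y ⊗ Z <- bplus_bminus HH X) (r Y * rt Z) =
                   η (counit HH X))].
Proof.
move=> [_ [i [rt [r [i_inj [rt_colinear rt_src] [r_tgt r_src] rt_r r_rt]]]]].
have uc : rt 1 \in coinvariant A.
  apply/coinvariantP; rewrite -[LHS]tsum_tensE (colinear_coact rt_colinear); last by bal.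
  by rewrite comul1 tsum_tens //; bal; rewrite /tact (colinear_tgt rt_colinear) tens_mid.
have vc : r 1 \in coinvariant A.
  apply/coinvariantP; rewrite -[LHS]tsum_tensE.
  rewrite (anti_inverse_coact rt_colinear rt_src r_tgt r_src rt_r r_rt); last by bal.
  by rewrite comul1 tsum_tens //; bal; rewrite /tact r_tgt tens_mid.
pose u : coinv A := Coinv uc; pose v : coinv A := Coinv vc.
have uv : rt 1 * r 1 = 1.
  rewrite -(@plus_minus1 _ (fun Y Z => rt Y * r Z)) ?rt_r ?counit1 ?rmorph1 //.
  by bal; rewrite r_tgt (colinear_tgtr _ _ rt_colinear) mulrA.
have vu : r 1 * rt 1 = 1.
  rewrite -(@bplus_bminus1 _ (fun Y Z => r Y * rt Z)) ?r_rt ?counit1 ?eta1 //.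
  by bal; rewrite r_src rt_src mulrA.
have rtl : linear (fun X => rt X * val v) by lin.
have rl : linear (fun X => val u * r X) by lin.
exists i, (linear_pack rtl), (linear_pack rl); split=> //=.
- split; last by move=> b X; rewrite rt_src mulrA.
  split=> [b X | X] /=.
    by rewrite /tact (colinear_tgt rt_colinear) mulrA.
  rewrite -[LHS]tsum_tensE (coact_coinvr _ v); last by bal.
  by rewrite (colinear_coact rt_colinear) //; bal; rewrite -mulrA tens_mid.
- split=> b X; first by rewrite r_tgt mulrA (coinv_eta u) -mulrA.
  by rewrite r_src mulrA.
- split=> X.
    by rewrite -rt_r; apply: eq_tsum => Y Z; rewrite mulrA -(mulrA (rt Y)) vu mulr1.
  transitivity (val u * η (counit HH X) * val v); last first.
    by rewrite (coinv_eta u) -mulrA uv mulr1.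
  rewrite -r_rt (linear_out (g := fun x => val u * x * val v)); last by lin.
  by apply: eq_tsum => *; rewrite !mulrA.
Qed.

Lemma anti_cleft_crossed_product : anti_cleft A -> crossed_product A.
Proof.
move=> acA; have [[th lamPK thK] _] := acA.
have [i [rt [r [i_inj rt1 [rt_colinear rt_src] [r_tgt r_src] [rt_r r_rt]]]]] :=
  anti_cleft_normalized acA.
pose pi := coinv_proj rt_colinear rt_src r_tgt r_src rt_r r_rt lamPK thK.
have pi_mull n p : pi (val n * p) = n * pi p by apply: coinv_proj_mull.
have pi_eta b p : pi (η b * p) = pi p * i b by apply: coinv_proj_eta.
have pi_rt X : pi (rt X) = i (counit HH X) by apply: coinv_proj_section.
have pi_coact p : \tsum_(p0 ⊗ p1 <- coact A p) (val (pi p0) * rt p1) = p.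
  exact: coinv_proj_coact.
exists (coinv A), i, (section_cocycle rt_colinear rt_src rt1 pi_mull pi_eta pi_rt pi_coact).
split=> //; last exact: section_cocycle_iso.
by exists (cross_sigV pi rt_colinear r_tgt); exact: section_cocycle_inverse.
Qed.

End AntiCleftCrossed.

(** * From anti-Galois with normal basis to anti-cleft *)

Section AntiGaloisMap.
Variables (k : fieldType) (B H : algType k) (L : hopf_algebroid B H).
Variables (P : algType k) (A : comodule_algebra L P).
Local Notation s := (src L).
Local Notation t := (tgt L).
Local Notation ε := (counit L).
Local Notation Δ := (comul L).
Local Notation η := (GRing.Linear.sort (eta A)).
Local Notation δ := (coact A).
Local Notation PdH := (diamond s (fun b p => η b * p)).
Local Notation PNP := (tensor (fun (n : coinv A) p => p * val n) (fun (n
  : coinv A) p => val n * p)).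
Local Notation bal f := (balanced (fun b p => η b * p) (fun b X => s b * X) f).
Local Notation balN f :=
  (balanced (fun (n : coinv A) p => p * val n) (fun (n : coinv A) p => val n * p) f).
Local Notation beta := (@anti_galois_map k B H P L A).

Fact anti_galois_balanced :
  balN (fun p q => \tsum_(p0 ⊗ p1 <- δ p) ((p0 * q) ⊗ p1 : PdH)).
Proof.
have fb q : bal (fun p X => (p * q) ⊗ X : PdH) by bal; rewrite -mulrA tens_mid.
bal.
by rewrite coact_coinvr //; apply: eq_tsum => *; rewrite mulrA.
Qed.

Lemma anti_galois_linear : linear beta.
Proof. exact/linear_tsum/linear_id_fun/anti_galois_balanced. Qed.

Lemma anti_galois_tens p q :
  beta (p ⊗ q : PNP) = \tsum_(p0 ⊗ p1 <- δ p) ((p0 * q) ⊗ p1).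
Proof. exact: tsum_tens anti_galois_balanced. Qed.

Section Inverse.
Variable g : PdH -> PNP.
Hypotheses (betaK : cancel beta g) (gK : cancel g beta).

Lemma anti_galois_inv_linear : linear g.
Proof. exact: linear_inverse anti_galois_linear betaK gK. Qed.

Section Values.
Variable V : lmodType k.

Lemma anti_galoisVKf (f : P -> H -> V) w : bal f ->
  \tsum_(p ⊗ q <- g w) \tsum_(p0 ⊗ p1 <- δ p) f (p0 * q) p1 = tsum w f.
Proof.
move=> fb; rewrite -[in RHS](gK w) [RHS]tsum_tsum //; apply: eq_tsum => p q.
by rewrite tsum_tsum //; apply: eq_tsum => *; rewrite tsum_tens.
Qed.

Lemma anti_galoisKf (f : P -> P -> V) p q : balN f ->
  \tsum_(p0 ⊗ p1 <- δ p) tsum (g ((p0 * q) ⊗ p1)) f = f p q.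
Proof.
move=> fb; rewrite -[RHS](tsum_tens _ _ fb) -(betaK (p ⊗ q : PNP)) anti_galois_tens.
rewrite (linear_out (g := g)) ?tsum_tsum //; exact: anti_galois_inv_linear.
Qed.

Lemma anti_galoisV_eqf (f : P -> P -> V) w u : beta u = w -> tsum (g w) f = tsum u f.
Proof. by move=> <-; rewrite betaK. Qed.

End Values.

Section Linearity.
Variable V : lmodType k.
Implicit Types f : P -> P -> V.

Lemma anti_galoisV_tgt f p b X : balN f ->
  tsum (g (p ⊗ (t b * X))) f = \tsum_(q ⊗ q' <- g (p ⊗ X)) f (η b * q) q'.
Proof.
move=> fb; rewrite (anti_galoisV_eqf f (u := \tsum_(q ⊗ q' <- g (p ⊗ X)) ((η b * q) ⊗ q'))).
  by rewrite tsum_tsum //; apply: eq_tsum => *; rewrite tsum_tens.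
have fd : bal (fun q Y => q ⊗ (t b * Y) : PdH).
  by bal; rewrite tens_mid !mulrA src_tgtC.
rewrite (linear_out (g := beta)); last exact: anti_galois_linear.
rewrite -[RHS](tsum_tens _ _ fd) -(anti_galoisVKf _ fd); apply: eq_tsum => q q'.
by rewrite anti_galois_tens coact_etal //; bal; rewrite -mulrA tens_mid.
Qed.

Lemma anti_galoisV_src f p b X : balN f ->
  tsum (g (p ⊗ (X * s b))) f = \tsum_(q ⊗ q' <- g (p ⊗ X)) f q (η b * q').
Proof.
move=> fb; rewrite (anti_galoisV_eqf f (u := \tsum_(q ⊗ q' <- g (p ⊗ X)) (q ⊗ (η b * q')))).
  by rewrite tsum_tsum //; apply: eq_tsum => *; rewrite tsum_tens.
have fd : bal (fun q Y => q ⊗ (Y * s b) : PdH).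
  by bal; rewrite tens_mid !mulrA.
rewrite (linear_out (g := beta)); last exact: anti_galois_linear.
rewrite -[RHS](tsum_tens _ _ fd) -(anti_galoisVKf _ fd); apply: eq_tsum => q q'.
rewrite anti_galois_tens -(coact_takeuchif (f := fun x Y => (x * q') ⊗ Y : PdH)).
  by apply: eq_tsum => *; rewrite mulrA.
by bal; rewrite -mulrA tens_mid.
Qed.

(** In P ⊗_N P ⋄ H this identifies β^-1(1 ⊗ X[+]) ⊗ X[-] with β^-1(1 ⊗ X) coacted upon in its second
    factor. Applying β to the first two factors and then μ to the last two sends both to 1 ⊗ 1 ⊗ X;
    accordingly [f] is written through [G] and then [K]. *)
Lemma anti_galoisV_bplus_bminus (f : P -> P -> H -> V) X :
    (forall q Y, linear (fun p => f p q Y)) ->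
    (forall p Y, linear (fun q => f p q Y)) ->
    (forall p q, linear (f p q)) ->
    (forall (n : coinv A) p q Y, f (p * val n) q Y = f p (val n * q) Y) ->
    (forall b p q Y, f p (η b * q) Y = f p q (s b * Y)) ->
  \tsum_(X' ⊗ X'' <- bplus_bminus L X) \tsum_(p ⊗ q <- g (1 ⊗ X')) f p q X'' =
  \tsum_(p ⊗ q <- g (1 ⊗ X)) \tsum_(q0 ⊗ q1 <- δ q) f p q0 q1.
Proof.
move=> f1 f2 f3 m1 m2.
have gl := anti_galois_inv_linear; have muVl := @muV_linear _ _ _ L.
have fb Y : balN (fun p q => f p q Y) by bal.
pose G r Z Y := tsum (g (r ⊗ Z)) (fun p q => f p q Y).
have G1 Z Y : linear (fun r => G r Z Y) by rewrite /G; lin.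
have G2 r Y : linear (fun Z => G r Z Y) by rewrite /G; lin.
have G3 r Z : linear (G r Z) by rewrite /G; lin.
have Gm1 b r Z Y : G (η b * r) Z Y = G r (s b * Z) Y by rewrite /G tens_mid.
have Gm2 b r Z Y : G r (Z * s b) Y = G r Z (s b * Y).
  by rewrite /G anti_galoisV_src //; apply: eq_tsum => *; rewrite m2.
have fG p q Y : f p q Y = \tsum_(p0 ⊗ p1 <- δ p) G (p0 * q) p1 Y.
  by rewrite -(anti_galoisKf _ _ (fb Y)).
rewrite -[LHS]/(\tsum_(X' ⊗ X'' <- bplus_bminus L X) G 1 X' X''); clearbody G.
have Gb r : balanced (fun b X => X * s b) (fun b X => s b * X) (G r) by bal.
pose K r U W := tsum (@muV _ _ _ L (U ⊗ W)) (G r).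
have K1 U W : linear (fun r => K r U W) by rewrite /K; lin.
have K2 r W : linear (fun U => K r U W) by rewrite /K; lin.
have K3 r U : linear (K r U) by rewrite /K; lin.
have Km1 b r U W : K (η b * r) U W = K r (s b * U) W.
  by rewrite /K muV_srcl //; apply: eq_tsum => *; rewrite Gm1.
have Km2 b r U W : K r (t b * U) W = K r U (s b * W).
  by rewrite /K -[t b * U]/(tact t b U) tens_mid.
have GK r Z Y : G r Z Y = \tsum_(Z1 ⊗ Z2 <- Δ Z) K r (Z1 * Y) Z2 by rewrite muKf.
rewrite -[LHS]/(K 1 1 X); clearbody K.
have Kb W : bal (fun r U => K r U W) by bal.
have Kd : bal (fun r W => \tsum_(r0 ⊗ r1 <- δ r) K r0 r1 W).
  by bal; rewrite coact_etal //; apply: eq_tsum => *; rewrite Km2.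
transitivity (\tsum_(p ⊗ q <- g (1 ⊗ X)) \tsum_(p0 ⊗ p1 <- δ p)
    \tsum_(r0 ⊗ r1 <- δ (p0 * q)) K r0 r1 p1).
  by rewrite (anti_galoisVKf _ Kd) tsum_tens // coact1 tsum_tens.
apply: eq_tsum => p q; under [RHS]eq_tsum do rewrite fG.
rewrite [RHS]exchange_tsum.
under [RHS]eq_tsum do [under eq_tsum do rewrite GK; rewrite exchange_tsum].
rewrite -(coact_coassoc (f := fun x U W => \tsum_(q0 ⊗ q1 <- δ q) K (x * q0) (U * q1) W)).
- by apply: eq_tsum => p0 p1; apply: coact_mulf.
- by move=> *; lin.
- by move=> *; lin.
- by move=> *; lin.
- by move=> *; apply: eq_tsum => *; rewrite -!mulrA Km1.
- by move=> *; apply: eq_tsum => *; rewrite -!mulrA Km2.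
Qed.

End Linearity.
End Inverse.
End AntiGaloisMap.

Section NormalBasisReversible.
Variables (k : fieldType) (B H : algType k) (L : hopf_algebroid B H).
Variables (P : algType k) (A : comodule_algebra L P).
Local Notation s := (src L).
Local Notation t := (tgt L).
Local Notation ε := (counit L).
Local Notation Δ := (comul L).
Local Notation η := (GRing.Linear.sort (eta A)).
Local Notation δ := (coact A).
Local Notation PdH := (diamond s (fun b p => η b * p)).
Local Notation PoH := (tensor (fun b p => p * η b) (fun b X => t b * X)).
Local Notation PNP := (tensor (fun (n : coinv A) p => p * val n) (fun (n
  : coinv A) p => val n * p)).
Local Notation bal f := (balanced (fun b p => η b * p) (fun b X => s b * X) f).
Local Notation balo f := (balanced (fun b X => X * t b) (fun b X => t b * X) f).
Local Notation balN f :=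
  (balanced (fun (n : coinv A) p => p * val n) (fun (n : coinv A) p => val n * p) f).
Variables (i : {lrmorphism B -> coinv A}) (rt : {linear H -> P}) (pi
  : {linear P -> coinv A}).
Hypothesis rt_colinear : colinear Δ δ rt.
Hypothesis rt_src : forall b X, rt (s b * X) = val (i b) * rt X.
Hypothesis pi_mull : forall n p, pi (val n * p) = n * pi p.
Hypothesis pi_eta : forall b p, pi (η b * p) = pi p * i b.
Hypothesis pi_rt : forall X, pi (rt X) = i (ε X).
Hypothesis pi_coact : forall p, \tsum_(p0 ⊗ p1 <- δ p) (val (pi p0) * rt p1) = p.

Let rt_tgt b X : rt (t b * X) = η b * rt X.
Proof. exact: colinear_tgt rt_colinear b X. Qed.

Let rt_tgtr b X : rt (X * t b) = rt X * η b.
Proof. exact: colinear_tgtr rt_colinear. Qed.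

(** Through P ≅ N ⊗_B H the reversibility map becomes id ⊗ λ, so p ⊗ Z ↦ π(p(0)) rt(p(1)+) ⊗ p(1)- Z
    is its inverse. *)
Lemma normal_basis_reversible : reversible A.
Proof.
have lamVl := @lamV_linear _ _ _ L.
pose f p Y W := (val (pi p) * rt Y) ⊗ W : PoH.
have fb p : balo (f p) by rewrite /f; bal; rewrite rt_tgtr mulrA tens_mid.
have f1 Y W : linear (fun p => f p Y W) by rewrite /f; lin.
pose F p U W := tsum (@lamV _ _ _ L (U ⊗ W)) (f p).
have F1 U W : linear (fun r => F r U W) by rewrite /F; lin.
have F2 r W : linear (fun U => F r U W) by rewrite /F; lin.
have F3 r U : linear (F r U) by rewrite /F; lin.
have Fm1 b p U W : F (η b * p) U W = F p (s b * U) W.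
  rewrite /F lamV_srcl //; apply: eq_tsum => Y Z.
  by rewrite /f pi_eta rt_src coinv_valM mulrA.
have Fm2 b p U W : F p (t b * U) W = F p U (s b * W).
  by rewrite /F -[t b * U]/(tact t b U) tens_mid.
have Fb W : bal (fun p U => F p U W) by bal.
have Gb : bal (fun p Z => \tsum_(p0 ⊗ p1 <- δ p) F p0 p1 Z).
  by bal; rewrite coact_etal //; apply: eq_tsum => *; rewrite Fm2.
exists (tlift Gb); apply: eq_linear_tens.
- by apply: linear_comp_fun; [exact: linearPf | exact: reversible_map_linear].
- exact: linear_id_fun.
- move=> p X; rewrite reversible_map_tens (linear_out (g := tlift Gb));
  last exact: linearPf.
  under eq_tsum do rewrite tliftE.
  rewrite (coact_coassoc (f := fun p U W => F p U (W * X))).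
  + under eq_tsum do rewrite lamKf //.
    by rewrite /f -(linear_out (g := fun x => x ⊗ X : PoH)) ?pi_coact //; lin.
  + by move=> *; lin.
  + by move=> *; lin.
  + by move=> *; lin.
  + by move=> *; rewrite Fm1.
  + by move=> *; rewrite -mulrA Fm2.
- by apply: linear_comp_fun; [exact: reversible_map_linear | exact: linearPf].
- exact: linear_id_fun.
- move=> p Z; rewrite tliftE (linear_out (g := @reversible_map _ _ _ _ _ A));
  last exact: reversible_map_linear.
  rewrite -[in RHS](pi_coact p) [RHS](linear_out (g := fun x => x ⊗ Z : PdH));
    last by lin.
  apply: eq_tsum => p0 p1; rewrite /F (linear_out (g := @reversible_map _ _ _ _ _ A));
    last exact: reversible_map_linear.
  have gb : balanced (tact t) (fun b X => s b * X) (fun X Y => (val (pi p0) * rt X) ⊗ Y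
    : PdH).
    by bal; rewrite /tact rt_tgt mulrA coinv_eta -mulrA tens_mid.
  rewrite -[RHS](tsum_tens _ _ gb) -(lamVKf _ gb); apply: eq_tsum => Y W.
  rewrite /f reversible_map_tens coact_coinvl; last by bal; rewrite tens_mid mulrA.
  by rewrite (colinear_coact rt_colinear) //; bal;
    rewrite mulrA coinv_eta -!mulrA tens_mid mulrA.
Qed.

Section AntiGalois.
Local Notation beta := (@anti_galois_map k B H P L A).
Variable g : PdH -> PNP.
Hypotheses (betaK : cancel beta g) (gK : cancel g beta).

Let pi_balanced : balN (fun p q => p * val (pi q)).
Proof. by bal; rewrite pi_mull coinv_valM mulrA. Qed.

(** Left N-linearity of π is what makes p π(q) well defined over ⊗_N. *)
Definition anti_inverse_fun X := \tsum_(p ⊗ q <- g (1 ⊗ X)) (p * val (pi q)).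

Fact anti_inverse_linear : linear anti_inverse_fun.
Proof.
have gl := anti_galois_inv_linear betaK gK; have fb := pi_balanced.
by rewrite /anti_inverse_fun; lin.
Qed.

Definition anti_inverse : {linear H -> P} := linear_pack anti_inverse_linear.

Lemma anti_inverseE X :
  anti_inverse X = \tsum_(p ⊗ q <- g (1 ⊗ X)) (p * val (pi q)).
Proof. by []. Qed.

Lemma anti_inverse_tgt b X : anti_inverse (t b * X) = η b * anti_inverse X.
Proof.
rewrite !anti_inverseE (anti_galoisV_tgt betaK gK _ _ _ pi_balanced).
rewrite [RHS](linear_out (g := fun x => η b * x)); last by lin.
by apply: eq_tsum => *; rewrite mulrA.
Qed.

Lemma anti_inverse_src b X : anti_inverse (X * s b) = anti_inverse X * val (i b).
Proof.
rewrite !anti_inverseE (anti_galoisV_src betaK gK _ _ _ pi_balanced).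
rewrite [RHS](linear_out (g := fun x => x * val (i b))); last by lin.
by apply: eq_tsum => *; rewrite pi_eta coinv_valM mulrA.
Qed.

(** In P ⊗_N P, rt(X+) β^-1(1 ⊗ X-) = 1 ⊗ rt(X), since β maps both to rt(X) ⊗ 1. Then p ⊗ q ↦ p π(q)
    is applied. *)
Lemma section_anti_inverse X :
  \tsum_(Y ⊗ Z <- plus_minus L X) (rt Y * anti_inverse Z) = val (i (ε X)).
Proof.
have gl := anti_galois_inv_linear betaK gK.
rewrite -pi_rt -[RHS]mul1r -(tsum_tens 1 (rt X) pi_balanced).
have <- : \tsum_(Y ⊗ Z <- plus_minus L X) \tsum_(p ⊗ q <- g (1 ⊗ Z)) ((rt Y * p) ⊗ q
  : PNP)
    = 1 ⊗ rt X.
  rewrite -[LHS]betaK -[RHS]betaK; congr g; rewrite anti_galois_tens coact1 tsum_tens;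
    last first.
    by bal; rewrite -mulrA tens_mid.
  rewrite (linear_out (g := beta)); last exact: anti_galois_linear.
  have fd : balanced (tact t) (fun b X => s b * X) (fun X Y => rt X ⊗ Y : PdH).
    by bal; rewrite /tact rt_tgt tens_mid.
  rewrite mul1r -[RHS](tsum_tens _ _ fd) -(lamVKf _ fd); apply: eq_tsum => Y Z.
  rewrite (linear_out (g := beta)); last exact: anti_galois_linear.
  have fe : bal (fun p W => \tsum_(Y1 ⊗ Y2 <- Δ Y) ((rt Y1 * p) ⊗ (Y2 * W) : PdH)).
    bal; last first.
      under eq_tsum do rewrite mulrA -rt_tgtr.
      rewrite (comul_takeuchif (f := fun X1 X2 => (rt X1 * m) ⊗ (X2 * n) : PdH)).
        by apply: eq_tsum => *; rewrite mulrA.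
      by bal; rewrite /tact rt_tgt -!mulrA tens_mid.
  have e := anti_galoisVKf gK (1 ⊗ Z) fe.
  rewrite (tsum_tens _ _ fe) in e.
  under [RHS]eq_tsum do rewrite -[rt _]mulr1.
  rewrite -e; apply: eq_tsum => p q; rewrite anti_galois_tens.
  rewrite coact_mulf; last by bal; rewrite -mulrA tens_mid.
  rewrite exchange_tsum; apply: eq_tsum => p0 p1.
  rewrite (colinear_coact rt_colinear); first by apply: eq_tsum => *; rewrite mulrA.
  by bal; rewrite -!mulrA tens_mid.
rewrite tsum_tsum; last exact: pi_balanced.
apply: eq_tsum => Y Z; rewrite tsum_tsum; last exact: pi_balanced.
rewrite anti_inverseE (linear_out (g := fun x => rt Y * x)); last by lin.
by apply: eq_tsum => p q; rewrite tsum_tens ?mulrA.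
Qed.

(** For p ⊗ q = β^-1(1 ⊗ X), [anti_galoisV_bplus_bminus] turns the sum into p π(q(0)) rt(q(1)) = pq.
    This is η(ε(X)): apply the counit to p(0)q ⊗ p(1) = 1 ⊗ X. *)
Lemma anti_inverse_section X :
  \tsum_(Y ⊗ Z <- bplus_bminus L X) (anti_inverse Y * rt Z) = η (ε X).
Proof.
under eq_tsum => Y Z.
  rewrite anti_inverseE (linear_out (g := fun x => x * rt Z)); last by lin.
  over.
rewrite (anti_galoisV_bplus_bminus betaK gK (f := fun p q X => p * val (pi q) * rt X)).
- have fb : bal (fun p X => η (ε X) * p) by bal; rewrite counit_src etaM mulrA.
  rewrite -[RHS]mulr1 -(tsum_tens 1 X fb) -(anti_galoisVKf gK _ fb).
  apply: eq_tsum => p q.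
  transitivity (p * q).
    rewrite -[in RHS](pi_coact q) (linear_out (g := fun x => p * x)); last by lin.
    by apply: eq_tsum => *; rewrite mulrA.
  rewrite -(coact_counit A (f := fun x => x * q) p); last by lin.
  by apply: eq_tsum => *; rewrite mulrA.
- by move=> *; lin.
- by move=> *; lin.
- by move=> *; lin.
- by move=> *; rewrite pi_mull coinv_valM mulrA.
- by move=> *; rewrite pi_eta coinv_valM rt_src !mulrA.
Qed.

End AntiGalois.
End NormalBasisReversible.

Lemma anti_galois_normal_basis_anti_cleft (k : fieldType) (B H P : algType k)
    (HH : hopf_algebroid B H) (A : comodule_algebra HH P) :
  anti_galois A -> normal_basis A -> anti_cleft A.
Proof.
move=> [g betaK gK] [i [phi [i_inj [psi phiK psiK] phi_mull phi_colinear]]].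
have psil : linear psi by exact: linear_inverse (linearPf phi) phiK psiK.
pose s := src HH; pose t := tgt HH; pose T := NtensH HH i.
have rtl : linear (fun X => psi (1 ⊗ X : T)) by lin.
pose rt := linear_pack rtl.
have epsb : balanced (fun b (n : coinv A) => n * i b) (fun b X => s b * X)
    (fun n X => n * i (counit HH X)).
  by bal; rewrite counit_src rmorphM mulrA.
have pil : linear (fun p => tsum (phi p) (fun n X => n * i (counit HH X))).
  by lin.
pose pi := linear_pack pil.
have psi_tens n X : psi (n ⊗ X : T) = val n * rt X.
  apply: (can_inj phiK); rewrite psiK phi_mull psiK NtensH_lmul_tens mulr1.
  by [].
have rt_tgt b X : rt (tact t b X) = eta A b * rt X.
  by rewrite -(colinear_inv_act phiK psiK phi_colinear) NtensH_act_tens.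
have rt_src b X : rt (s b * X) = val (i b) * rt X.
  by rewrite -psi_tens -[i b]mul1r tens_mid.
have rt_colinear : colinear (comul HH) (coact A) rt.
  by split=> // X; exact: (colinear_inv_coact phiK psiK phi_colinear).
have pi_mull n p : pi (val n * p) = n * pi p.
  rewrite /= phi_mull tsum_tsum // (linear_out (g := fun x => n * x)); last by lin.
  by apply: eq_tsum => *; rewrite tsum_tens // mulrA.
have pi_eta b p : pi (eta A b * p) = pi p * i b.
  rewrite /= phi_colinear.1 tsum_tsum // [RHS](linear_out (g := fun x => x * i b));
    last by lin.
  by apply: eq_tsum => *; rewrite tsum_tens // /tact counit_tgt rmorphM mulrA.
have pi_rt X : pi (rt X) = i (counit HH X).
  by rewrite /= psiK tsum_tens // mul1r.
have pi_coact p : \tsum_(p0 ⊗ p1 <- coact A p) (val (pi p0) * rt p1) = p.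
  rewrite -[RHS]phiK -[in LHS](phiK p); move: (phi p) => u.
  have Gb : balanced (fun b p => eta A b * p) (fun b X => s b * X)
     (fun p X => val (pi p) * rt X).
    by bal; rewrite pi_eta rt_src coinv_valM mulrA.
  apply: (eq_linear_tens (g := fun u => \tsum_(p0 ⊗ p1 <- coact A (psi u)) (val (pi p0) * rt p1))).
  - by lin.
  - exact: psil.
  - move=> n X; rewrite psi_tens coact_coinvl // (colinear_coact rt_colinear); last first.
      by bal; rewrite /tact mulrA (coinv_eta n) -mulrA pi_eta rt_src coinv_valM mulrA.
    under eq_tsum do rewrite pi_mull pi_rt coinv_valM -mulrA -rt_src.
    by rewrite (comul_counitl HH (f := fun X => val n * rt X)) //; lin.
split; first exact: normal_basis_reversible rt_colinear rt_src pi_eta pi_coact.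
exists i, rt, (anti_inverse pi_mull betaK gK); split=> //.
- split=> b X; first exact: anti_inverse_tgt.
  exact: anti_inverse_src.
- exact: section_anti_inverse.
- exact: anti_inverse_section.
Qed.

(** * From crossed product to anti-Galois *)

Section CocycleAntiGalois.
Variables (k : fieldType) (B H : algType k) (L : hopf_algebroid B H).
Variables (P : algType k) (A : comodule_algebra L P).
Local Notation s := (src L).
Local Notation t := (tgt L).
Local Notation ε := (counit L).
Local Notation Δ := (comul L).
Local Notation η := (GRing.Linear.sort (eta A)).
Local Notation δ := (coact A).
Local Notation PdH := (diamond s (fun b p => η b * p)).
Local Notation PNP := (tensor (fun (n : coinv A) p => p * val n) (fun (n
  : coinv A) p => val n * p)).
Local Notation bal f := (balanced (fun b p => η b * p) (fun b X => s b * X) f).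
Local Notation balH f := (balanced (tact t) (fun b X => s b * X) f).
Local Notation balB f := (balanced (fun b X => X * s b) (fun b X => s b * X) f).
Local Notation beta := (@anti_galois_map k B H P L A).
Variables (i : {lrmorphism B -> coinv A}) (rt : {linear H -> P}) (pi
  : {linear P -> coinv A}).
Hypothesis rt_colinear : colinear Δ δ rt.
Hypothesis rt_src : forall b X, rt (s b * X) = val (i b) * rt X.
Hypothesis pi_mull : forall n p, pi (val n * p) = n * pi p.
Hypothesis pi_eta : forall b p, pi (η b * p) = pi p * i b.
Hypothesis pi_rt : forall X, pi (rt X) = i (ε X).
Hypothesis pi_coact : forall p, \tsum_(p0 ⊗ p1 <- δ p) (val (pi p0) * rt p1) = p.
(** These stand for σ, its inverse and X ▷ i(b), already carried into the coinvariants, so that the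
    argument takes place inside P. *)
Variables (sg sv : H -> H -> coinv A) (ac : H -> B -> coinv A).
Hypotheses (sgl : forall Y, linear (sg^~ Y)) (sgr : forall X, linear (sg X)).
Hypotheses (svl : forall Y, linear (sv^~ Y)) (svr : forall X, linear (sv X)).
Hypothesis acl : forall b, linear (ac^~ b).
Hypothesis rt_base : forall X b,
  rt X * val (i b) = \tsum_(X1 ⊗ X2 <- Δ X) (val (ac X1 b) * rt X2).
Hypothesis rtM : forall X Y, rt X * rt Y =
  \tsum_(X1 ⊗ X2 <- Δ X) \tsum_(Y1 ⊗ Y2 <- Δ Y) (val (sg X1 Y1) * rt (X2 * Y2)).
Hypothesis ac_tgt : forall b b' X, ac (t b * X) b' = ac X b' * i b.
Hypothesis ac_src : forall b b' X, ac (s b * X) b' = i b * ac X b'.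
Hypothesis sg_src : forall b X Y, sg (s b * X) Y = i b * sg X Y.
Hypothesis sg_tgt : forall b X Y, sg (t b * X) Y = sg X Y * i b.
Hypothesis sg_bal : forall b X Y, sg (X * t b) Y = sg X (t b * Y).
Hypothesis sg_mid : forall b X Y,
  \tsum_(X1 ⊗ X2 <- Δ X) (ac X1 b * sg X2 Y) = sg X (s b * Y).
Hypothesis sv_src : forall b X Y, sv (s b * X) Y = i b * sv X Y.
Hypothesis sv_tgt : forall b X Y, sv (t b * X) Y = sv X Y * i b.
Hypothesis sv_bal : forall b X Y, sv (X * s b) Y = sv X (s b * Y).
Hypothesis sv_mid : forall b X Y,
  \tsum_(X1 ⊗ X2 <- Δ X) (sv X1 Y * ac X2 b) = sv X (t b * Y).
Hypothesis sgK : forall X Y,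
  \tsum_(X1 ⊗ X2 <- Δ X) \tsum_(Y1 ⊗ Y2 <- Δ Y) (sg X1 Y1 * sv X2 Y2) = ac X (ε Y).
Hypothesis sgVK : forall X Y,
  \tsum_(X1 ⊗ X2 <- Δ X) \tsum_(Y1 ⊗ Y2 <- Δ Y) (sv X1 Y1 * sg X2 Y2) = i (ε (X * Y)).

Let rt_tgt b X : rt (t b * X) = η b * rt X.
Proof. exact: colinear_tgt rt_colinear b X. Qed.

Let val_src x b X : val (x * i b) * rt X = val x * rt (s b * X).
Proof. by rewrite rt_src coinv_valM mulrA. Qed.

Definition twisted_section X Y := \tsum_(X1 ⊗ X2 <- Δ X) (val (sv X1 Y) * rt X2).

Let ts_balanced Y : balH (fun X1 X2 => val (sv X1 Y) * rt X2).
Proof. by bal; rewrite /tact sv_tgt val_src. Qed.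

Lemma twisted_section_linl Y : linear (twisted_section^~ Y).
Proof. have fb := ts_balanced Y; by rewrite /twisted_section; lin. Qed.

Lemma twisted_section_linr X : linear (twisted_section X).
Proof. by rewrite /twisted_section; lin. Qed.

Lemma twisted_section_src b X Y :
  twisted_section (s b * X) Y = val (i b) * twisted_section X Y.
Proof.
rewrite /twisted_section comul_srclf; last exact: ts_balanced.
rewrite [RHS](linear_out (g := fun x => val (i b) * x)); last by lin.
by apply: eq_tsum => *; rewrite sv_src coinv_valM mulrA.
Qed.

Lemma twisted_section_bal b X Y :
  twisted_section (X * s b) Y = twisted_section X (s b * Y).
Proof.
rewrite /twisted_section comul_srcrf; last exact: ts_balanced.
by apply: eq_tsum => *; rewrite sv_bal.
Qed.

(** [sv_mid] rewrites σ^-1(X(1), t(b)Y) as σ^-1(X(1), Y)(X(2) ▷ b), and [rt_base] reads (X(2) ▷ b)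
    rt(X(3)) as rt(X(2))b. This makes [galois_section] well defined over ⊗_N. *)
Lemma twisted_section_tgt b X Y :
  twisted_section X (t b * Y) = twisted_section X Y * val (i b).
Proof.
rewrite /twisted_section [RHS](linear_out (g := fun x => x * val (i b))); last by lin.
under eq_tsum => X1 X2.
  rewrite -sv_mid (linear_out (g := fun x => val x * rt X2)); last by lin.
  over.
rewrite (comul_coassocf (f := fun a c d => val (sv a Y * ac c b) * rt d)).
- apply: eq_tsum => X1 X2; rewrite -mulrA rt_base.
  rewrite [RHS](linear_out (g := fun x => val (sv X1 Y) * x)); last by lin.
  by apply: eq_tsum => *; rewrite coinv_valM mulrA.
- by move=> *; lin.
- by move=> *; lin.
- by move=> *; lin.
- by move=> *; rewrite sv_tgt ac_src mulrA.
- by move=> *; rewrite ac_tgt mulrA val_src.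
Qed.

Lemma twisted_section_coact (V : lmodType k) (f : P -> H -> V) X Y : bal f ->
  tsum (δ (twisted_section X Y)) f =
  \tsum_(X1 ⊗ X2 <- Δ X) f (twisted_section X1 Y) X2.
Proof.
move=> fb; have f1 Z := balanced_linl Z fb; have f2 p := balanced_linr p fb.
have fm (x : coinv A) : balH (fun X1 X2 => f (val x * rt X1) X2).
  by bal; rewrite /tact rt_tgt mulrA coinv_eta -mulrA; exact: balanced_mid fb _ _ _.
rewrite /twisted_section (linear_out (g := fun x => tsum (δ x) f)); last by lin.
under [RHS]eq_tsum => X1 X2.
  rewrite (linear_out (g := fun x => f x X2)); last by lin.
  over.
rewrite [RHS](comul_coassocf (f := fun a b c => f (val (sv a Y) * rt b) c)).
- apply: eq_tsum => X1 X2; rewrite coact_coinvl // (colinear_coact rt_colinear) //.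
  bal; rewrite mulrA coinv_eta -mulrA; exact: balanced_mid fb _ _ _.
- by move=> *; lin.
- by move=> *; lin.
- by move=> *; lin.
- by move=> *; rewrite sv_tgt val_src.
- by move=> b X1 X2 X3; exact: balanced_mid (fm _) b X2 X3.
Qed.

(** Expanding rt(X(2)) rt(Y(2)), the left side is σ^-1(X(1), Y(1)) σ(X(2), Y(2)) rt(X(3)Y(3));
    [sgVK] makes the first two factors ε(X(1)Y(1)), which the counit absorbs. *)
Lemma twisted_sectionM X Y :
  \tsum_(Y1 ⊗ Y2 <- Δ Y) (twisted_section X Y1 * rt Y2) = rt (X * Y).
Proof.
pose W Z b c := \tsum_(Z1 ⊗ Z2 <- Δ Z) (val (sg Z1 b) * rt (Z2 * c)).
have Wb b c : balH (fun Z1 Z2 => val (sg Z1 b) * rt (Z2 * c)).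
  by bal; rewrite /tact sg_tgt val_src mulrA.
have W1 b c : linear (fun Z => W Z b c) by rewrite /W; lin.
have W2 Z c : linear (fun b => W Z b c) by rewrite /W; lin.
have W3 Z b : linear (W Z b) by rewrite /W; lin.
have Wm2 Z d b c : W Z (t d * b) c = W Z b (s d * c).
  rewrite /W; under eq_tsum do rewrite -sg_bal.
  rewrite (comul_takeuchif (f := fun X1 X2 => val (sg X1 b) * rt (X2 * c))) //.
  by apply: eq_tsum => *; rewrite mulrA.
have Ws Z d b c : W (s d * Z) b c = val (i d) * W Z b c.
  rewrite /W comul_srclf // [RHS](linear_out (g := fun x => val (i d) * x)); last by lin.
  by apply: eq_tsum => *; rewrite sg_src coinv_valM mulrA.
have Wm1 Z d b c : W Z (s d * b) c = \tsum_(Z1 ⊗ Z2 <- Δ Z) (val (ac Z1 d) * W Z2 b c).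
  rewrite /W; under eq_tsum => Z1 Z2.
    rewrite -sg_mid (linear_out (g := fun x => val x * rt (Z2 * c))); last by lin.
    over.
  under [RHS]eq_tsum => Z1 Z2.
    rewrite (linear_out (g := fun x => val (ac Z1 d) * x)); last by lin.
    under eq_tsum do rewrite mulrA -coinv_valM.
    over.
  apply: (comul_coassocf (f := fun x y z => val (ac x d * sg y b) * rt (z * c))).
  - by move=> *; lin.
  - by move=> *; lin.
  - by move=> *; lin.
  - by move=> *; rewrite ac_tgt sg_src mulrA.
  - by move=> *; rewrite sg_tgt mulrA val_src mulrA.
pose Q a b c := \tsum_(X1 ⊗ X2 <- Δ X) (val (sv X1 a) * W X2 b c).
have Qe a b c : Q a b c = \tsum_(X1 ⊗ X2 <- Δ X) \tsum_(Z1 ⊗ Z2 <- Δ X1)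
    (val (sv Z1 a * sg Z2 b) * rt (X2 * c)).
  rewrite (comul_coassocf (f := fun x y z => val (sv x a * sg y b) * rt (z * c))).
  - apply: eq_tsum => X1 X2; rewrite /W (linear_out (g := fun x => val (sv X1 a) * x));
    last by lin.
    by apply: eq_tsum => *; rewrite mulrA.
  - by move=> *; lin.
  - by move=> *; lin.
  - by move=> *; lin.
  - by move=> *; rewrite sv_tgt sg_src mulrA.
  - by move=> *; rewrite sg_tgt mulrA val_src mulrA.
(* Balance between the first two legs of Y, needed before coassociativity in Y: both sides insert
   X(2) ▷ d between σ^-1 and σ, on the left by [sv_mid], on the right by [sg_mid]. *)
have Qm a d b c : Q (t d * a) b c = Q a (s d * b) c.
  rewrite /Q; under eq_tsum => X1 X2.
    rewrite -sv_mid (linear_out (g := fun x => val x * W X2 b c)); last by lin.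
    over.
  under [RHS]eq_tsum => X1 X2.
    rewrite Wm1 (linear_out (g := fun x => val (sv X1 a) * x)); last by lin.
    under eq_tsum do rewrite mulrA -coinv_valM.
    over.
  apply: (comul_coassocf (f := fun x y z => val (sv x a * ac y d) * W z b c)).
  - by move=> *; lin.
  - by move=> *; lin.
  - by move=> *; lin.
  - by move=> *; rewrite sv_tgt ac_src mulrA.
  - by move=> *; rewrite ac_tgt Ws mulrA coinv_valM -mulrA.
transitivity (\tsum_(Y1 ⊗ Y2 <- Δ Y) \tsum_(Z1 ⊗ Z2 <- Δ Y2) Q Y1 Z1 Z2).
  apply: eq_tsum => Y1 Y2.
  rewrite /twisted_section (linear_out (g := fun x => x * rt Y2)); last by lin.
  rewrite /Q [RHS]exchange_tsum; apply: eq_tsum => X1 X2.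
  rewrite -mulrA rtM exchange_tsum (linear_out (g := fun x => val (sv X1 Y1) * x));
    last by lin.
  by [].
rewrite -(comul_coassocf (f := Q)).
- under eq_tsum => Y1 Y2 do [under eq_tsum do rewrite Qe; rewrite exchange_tsum].
  rewrite exchange_tsum.
  transitivity (\tsum_(X1 ⊗ X2 <- Δ X) \tsum_(Y1 ⊗ Y2 <- Δ Y)
      rt (s (ε (X1 * Y1)) * (X2 * Y2))).
    apply: eq_tsum => X1 X2; apply: eq_tsum => Y1 Y2; rewrite exchange_tsum.
    rewrite rt_src -sgVK (linear_out (g := fun x => val x * rt (X2 * Y2))); last by lin.
    by apply: eq_tsum => *; rewrite (linear_out (g := fun x => val x * rt (X2 * Y2)));
      last by lin.
  rewrite -(comul_mulf (f := fun U V => rt (s (ε U) * V))).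
    by rewrite (comul_counitl L (f := rt)); last by exact: linearPf.
  by bal; rewrite /tact counit_tgt rmorphM mulrA.
- by rewrite /Q => *; lin.
- by rewrite /Q => *; lin.
- by rewrite /Q => *; lin.
- by move=> *; rewrite Qm.
- by move=> *; rewrite /Q; apply: eq_tsum => *; rewrite Wm2.
Qed.

(** The opposite cancellation: [sgK] leaves (X(1) ▷ ε(Y)) rt(X(2)), which is rt(X) ε(Y) by
    [rt_base]. *)
Lemma sg_twisted_section X Y :
  \tsum_(Y1 ⊗ Y2 <- Δ Y) \tsum_(X1 ⊗ X2 <- Δ X)
    (val (sg X1 Y1) * twisted_section X2 Y2) = rt X * val (i (ε Y)).
Proof.
rewrite rt_base.
transitivity (\tsum_(Y1 ⊗ Y2 <- Δ Y) \tsum_(X1 ⊗ X2 <- Δ X) \tsum_(Z1 ⊗ Z2 <- Δ X1)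
    (val (sg Z1 Y1 * sv Z2 Y2) * rt X2)).
  apply: eq_tsum => Y1 Y2.
  rewrite (comul_coassocf (f := fun a b c => val (sg a Y1 * sv b Y2) * rt c)).
  - apply: eq_tsum => X1 X2; rewrite /twisted_section.
    rewrite (linear_out (g := fun x => val (sg X1 Y1) * x)); last by lin.
    by apply: eq_tsum => *; rewrite coinv_valM mulrA.
  - by move=> *; lin.
  - by move=> *; lin.
  - by move=> *; lin.
  - by move=> *; rewrite sg_tgt sv_src mulrA.
  - by move=> *; rewrite sv_tgt mulrA val_src.
rewrite exchange_tsum; apply: eq_tsum => X1 X2; rewrite exchange_tsum.
rewrite -sgK (linear_out (g := fun x => val x * rt X2)); last by lin.
by apply: eq_tsum => *; rewrite (linear_out (g := fun x => val x * rt X2)); last by lin.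
Qed.

Definition galois_section (x : coinv A) U W : PNP :=
  \tsum_(W1 ⊗ W2 <- Δ W) ((val x * twisted_section U W1) ⊗ rt W2).

Let twl := twisted_section_linl.
Let twr := twisted_section_linr.

Let gs_balanced (x : coinv A) U :
  balH (fun W1 W2 => (val x * twisted_section U W1) ⊗ rt W2 : PNP).
Proof. by bal; rewrite /tact twisted_section_tgt rt_src mulrA tens_mid. Qed.

Lemma galois_section_lin1 U W : linear (fun x => galois_section x U W).
Proof. by rewrite /galois_section; lin. Qed.

Lemma galois_section_lin2 x W : linear (fun U => galois_section x U W).
Proof. by rewrite /galois_section; lin. Qed.

Lemma galois_section_lin3 x U : linear (galois_section x U).
Proof. have fb := gs_balanced x U; by rewrite /galois_section; lin. Qed.

Lemma galois_section_src x b U W :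
  galois_section x (s b * U) W = galois_section (x * i b) U W.
Proof.
by apply: eq_tsum => W1 W2; rewrite twisted_section_src coinv_valM mulrA.
Qed.

Lemma galois_section_bal x b U W :
  galois_section x (U * s b) W = galois_section x U (s b * W).
Proof.
rewrite /galois_section comul_srclf; last exact: gs_balanced.
by apply: eq_tsum => *; rewrite twisted_section_bal.
Qed.

Lemma anti_galois_section x U W :
  beta (galois_section x U W) = \tsum_(U1 ⊗ U2 <- Δ U) ((val x * rt (U1 * W)) ⊗ U2).
Proof.
rewrite (linear_out (g := beta)); last exact: anti_galois_linear.
under eq_tsum => W1 W2.
  rewrite anti_galois_tens coact_coinvl; last by bal; rewrite -mulrA tens_mid.
  rewrite twisted_section_coact; last by bal; rewrite !mulrA coinv_eta -!mulrA tens_mid.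
  over.
rewrite exchange_tsum; apply: eq_tsum => U1 U2.
rewrite -twisted_sectionM (linear_out (g := fun y => (val x * y) ⊗ U2)); last by lin.
by apply: eq_tsum => *; rewrite mulrA.
Qed.

(** By coassociativity in Y and [sg_twisted_section] the first factor becomes x rt(X) ε(Y(1)); this
    scalar crosses ⊗_N and is absorbed into rt(Y(2)). *)
Lemma galois_section_sg x X Y :
  \tsum_(X1 ⊗ X2 <- Δ X) \tsum_(Y1 ⊗ Y2 <- Δ Y) galois_section (x * sg X1 Y1) X2 Y2 =
  (val x * rt X) ⊗ rt Y.
Proof.
pose F a b c := \tsum_(X1 ⊗ X2 <- Δ X)
  ((val (x * sg X1 a) * twisted_section X2 b) ⊗ rt c : PNP).
transitivity (\tsum_(Y1 ⊗ Y2 <- Δ Y) \tsum_(a ⊗ b <- Δ Y1) F a b Y2).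
  rewrite (comul_coassocf (f := F)).
  - by rewrite exchange_tsum; apply: eq_tsum => Y1 Y2; rewrite [RHS]exchange_tsum.
  - by rewrite /F => *; lin.
  - by rewrite /F => *; lin.
  - by rewrite /F => *; lin.
  - move=> d a b c; rewrite /F; under eq_tsum do rewrite -sg_bal.
    rewrite (comul_takeuchif (f := fun X1 X2 =>
      (val (x * sg X1 a) * twisted_section X2 b) ⊗ rt c : PNP)).
      by apply: eq_tsum => *; rewrite twisted_section_bal.
    by bal; rewrite /tact sg_tgt twisted_section_src !coinv_valM !mulrA.
  - move=> d a b c; rewrite /F; apply: eq_tsum => *.
    by rewrite twisted_section_tgt rt_src mulrA tens_mid.
rewrite -(comul_counitl L (f := fun Z => (val x * rt X) ⊗ rt Z : PNP)); last by lin.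
apply: eq_tsum => Y1 Y2; rewrite rt_src -tens_mid -mulrA -sg_twisted_section.
rewrite (linear_out (g := fun y => (val x * y) ⊗ rt Y2 : PNP)); last by lin.
apply: eq_tsum => a b; rewrite (linear_out (g := fun y => (val x * y) ⊗ rt Y2 : PNP));
  last by lin.
by apply: eq_tsum => *; rewrite coinv_valM mulrA.
Qed.

Lemma cocycle_anti_galois : anti_galois A.
Proof.
have muVl := @muV_linear _ _ _ L.
have gs1 := galois_section_lin1; have gs2 := galois_section_lin2.
have gs3 := galois_section_lin3.
have gsb x : balB (galois_section x).
  by apply: balancedI => [Y|X|b U W]; [exact: gs2|exact: gs3|exact: galois_section_bal].
(* By [anti_galois_section], β after [galois_section] is μ with x rt applied to its first leg. Hence
   the candidate inverse is p ⊗ X ↦ K(π(p(0)), p(1), X), with μ^-1 built into [K]. *)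
pose K x Z X := tsum (@muV _ _ _ L (Z ⊗ X)) (galois_section x).
have K1 Z X : linear (fun x => K x Z X) by rewrite /K; lin.
have K2 x X : linear (fun Z => K x Z X) by rewrite /K; lin.
have K3 x Z : linear (K x Z) by rewrite /K; lin.
have Ks x b Z X : K x (s b * Z) X = K (x * i b) Z X.
  by rewrite /K muV_srcl //; apply: eq_tsum => *; rewrite galois_section_src.
have Kt x b Z X : K x (t b * Z) X = K x Z (s b * X).
  by rewrite /K -[t b * Z]/(tact t b Z) tens_mid.
have Kb X : bal (fun p Z => K (pi p) Z X) by bal; rewrite pi_eta Ks.
have Gb : bal (fun p X => \tsum_(p0 ⊗ p1 <- δ p) K (pi p0) p1 X).
  by bal; rewrite coact_etal //; apply: eq_tsum => *; rewrite Kt.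
have GE x Z X : tlift Gb ((val x * rt Z) ⊗ X) = K x Z X.
  rewrite tliftE coact_coinvl // (colinear_coact rt_colinear); last first.
    by bal; rewrite mulrA coinv_eta -mulrA pi_eta Ks.
  under eq_tsum do rewrite pi_mull pi_rt -Ks.
  by rewrite (comul_counitl L (f := fun Z => K x Z X)).
have betal := @anti_galois_linear _ _ _ L P A.
exists (tlift Gb); apply: eq_linear_tens.
- by apply: linear_comp_fun; [exact: linearPf | exact: betal].
- exact: linear_id_fun.
(* It suffices to treat x rt(X) ⊗ rt(Y): the coefficient of q crosses ⊗_N into p, and then p is
   expanded in turn. *)
- move=> p q; rewrite -[in RHS](pi_coact q) [RHS](linear_out (g := fun y => p ⊗ y : PNP));
  last by lin.
  rewrite -[in LHS](pi_coact q) (linear_out (g := fun y => tlift Gb (beta (p ⊗ y))));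
    last by lin.
  apply: eq_tsum => q0 Y; rewrite -tens_mid; move: (p * _) => {q0 q} {}p.
  rewrite -(pi_coact p) (linear_out (g := fun x => tlift Gb (beta (x ⊗ rt Y))));
    last by lin.
  rewrite [RHS](linear_out (g := fun x => x ⊗ rt Y : PNP)); last by lin.
  apply: eq_tsum => p0 X; move: (pi p0) => x.
  rewrite -[RHS]galois_section_sg anti_galois_tens.
  rewrite coact_coinvl; last by bal; rewrite -mulrA tens_mid.
  rewrite (colinear_coact rt_colinear); last first.
    by bal; rewrite !mulrA coinv_eta -!mulrA tens_mid.
  rewrite (linear_out (g := tlift Gb)); last exact: linearPf.
  transitivity (\tsum_(X1 ⊗ X2 <- Δ X) \tsum_(Z1 ⊗ Z2 <- Δ X1)
      \tsum_(Y1 ⊗ Y2 <- Δ Y) K (x * sg Z1 Y1) (Z2 * Y2) X2).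
    apply: eq_tsum => X1 X2; rewrite -mulrA rtM.
    rewrite (linear_out (g := fun y => tlift Gb ((val x * y) ⊗ X2))); last by lin.
    apply: eq_tsum => Z1 Z2.
    rewrite (linear_out (g := fun y => tlift Gb ((val x * y) ⊗ X2))); last by lin.
    by apply: eq_tsum => Y1 Y2; rewrite mulrA -coinv_valM GE.
  rewrite (comul_coassocf (f := fun a b c => \tsum_(Y1 ⊗ Y2 <- Δ Y) K (x * sg a Y1) (b * Y2) c)).
  + apply: eq_tsum => X1 X2; rewrite exchange_tsum; apply: eq_tsum => Y1 Y2.
    by rewrite /K muKf.
  + by move=> *; lin.
  + by move=> *; lin.
  + by move=> *; lin.
  + by move=> *; apply: eq_tsum => *; rewrite sg_tgt mulrA -Ks mulrA.
  + by move=> *; apply: eq_tsum => *; rewrite -mulrA Kt.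
- by apply: linear_comp_fun; [exact: betal | exact: linearPf].
- exact: linear_id_fun.
- move=> p X; rewrite tliftE (linear_out (g := beta)); last exact: betal.
  rewrite -[in RHS](pi_coact p) [RHS](linear_out (g := fun y => y ⊗ X : PdH));
    last by lin.
  apply: eq_tsum => p0 Z; rewrite /K (linear_out (g := beta)); last exact: betal.
  under eq_tsum do rewrite anti_galois_section.
  have fb : balH (fun U1 U2 => (val (pi p0) * rt U1) ⊗ U2 : PdH).
    by bal; rewrite /tact rt_tgt mulrA coinv_eta -mulrA tens_mid.
  by rewrite (muVKf _ fb) tsum_tens.
Qed.

End CocycleAntiGalois.

(** * The product of the crossed product on pure tensors *)

Section CocycleTheory.
Variables (k : fieldType) (B H : algType k) (L : bialgebroid B H).
Variables (N : algType k) (i : {lrmorphism B -> N}) (c : cocycle L i).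
Local Notation s := (src L).
Local Notation t := (tgt L).
Local Notation ε := (counit L).
Local Notation Δ := (comul L).
Local Notation T := (NtensH L i).
Local Notation balH f := (balanced (tact t) (fun b X => s b * X) f).
Local Notation balT f := (balanced (fun b n => n * i b) (fun b X => s b * X) f).
Local Notation σ X Y := (csig c (X ⊗ Y)).

Lemma cact_linl n : linear (fun X => cact c X n).
Proof. by move=> a X Y; exact: linearPl. Qed.

Lemma cact_linr X : linear (cact c X).
Proof. by move=> a m n; exact: linearPr. Qed.

Lemma cact_src b X n : cact c (s b * X) n = i b * cact c X n.
Proof. by have := cact_lin c b 1 X n; rewrite tgt1 mulr1 rmorph1 mulr1. Qed.

Lemma cact_tgt b X n : cact c (t b * X) n = cact c X n * i b.
Proof. by have := cact_lin c 1 b X n; rewrite src1 mul1r rmorph1 mul1r. Qed.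

Lemma csig_src b X Y : σ (s b * X) Y = i b * σ X Y.
Proof. by have := csig_lin c b 1 X Y; rewrite tgt1 mulr1 rmorph1 mulr1. Qed.

Lemma csig_tgt b X Y : σ (t b * X) Y = σ X Y * i b.
Proof. by have := csig_lin c 1 b X Y; rewrite src1 mul1r rmorph1 mul1r. Qed.

Lemma csig_bal b X Y : σ (X * t b) Y = σ X (t b * Y).
Proof. by rewrite tens_mid. Qed.

Let actl := cact_linl.
Let actr := cact_linr.

(** The product of a # X and 1 # Y, as [crossed_mul_sections] shows. *)
Definition crossed_section (a : N) X Y : T :=
  \tsum_(X1 ⊗ X2 <- Δ X) \tsum_(Y1 ⊗ Y2 <- Δ Y) ((a * σ X1 Y1) ⊗ (X2 * Y2)).

Let balX a Y1 Y2 : balH (fun X1 X2 => (a * σ X1 Y1) ⊗ (X2 * Y2) : T).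
Proof. by bal; rewrite /tact csig_tgt mulrA tens_mid mulrA. Qed.

Let balXY a Y :
  balH (fun X1 X2 => \tsum_(Y1 ⊗ Y2 <- Δ Y) ((a * σ X1 Y1) ⊗ (X2 * Y2) : T)).
Proof. by bal; apply: eq_tsum => *; apply: (balanced_mid (balX _ _ _)). Qed.

Let balY a X :
  balH (fun Y1 Y2 => \tsum_(X1 ⊗ X2 <- Δ X) ((a * σ X1 Y1) ⊗ (X2 * Y2) : T)).
Proof.
bal; rewrite /tact; under eq_tsum do rewrite -csig_bal.
rewrite (comul_takeuchif (f := fun X1 X2 => (a * σ X1 m) ⊗ (X2 * n) : T)) //.
by apply: eq_tsum => *; rewrite mulrA.
Qed.

Lemma crossed_section_lin1 X Y : linear (fun a => crossed_section a X Y).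
Proof. by rewrite /crossed_section; lin. Qed.

Lemma crossed_section_lin2 a Y : linear (fun X => crossed_section a X Y).
Proof. by have fb := balXY a Y; rewrite /crossed_section; lin. Qed.

Lemma crossed_section_lin3 a X : linear (crossed_section a X).
Proof.
move=> x Y Z; rewrite /crossed_section !(exchange_tsum (Δ X)).
exact: (linear_tsum (balY a X) (linearPf Δ)).
Qed.

Let csl1 := crossed_section_lin1.
Let csl2 := crossed_section_lin2.
Let csl3 := crossed_section_lin3.

Lemma crossed_section_src a b X Y :
  crossed_section a (s b * X) Y = crossed_section (a * i b) X Y.
Proof.
rewrite /crossed_section comul_srclf; last exact: balXY.
by apply: eq_tsum => *; apply: eq_tsum => *; rewrite csig_src mulrA.
Qed.

Lemma crossed_section_srcr a b X Y :
  crossed_section a X (s b * Y) =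
  \tsum_(X1 ⊗ X2 <- Δ X) crossed_section (a * cact c X1 (i b)) X2 Y.
Proof.
rewrite [LHS]exchange_tsum comul_srclf; last exact: balY.
under [RHS]eq_tsum do rewrite /crossed_section exchange_tsum.
rewrite [RHS]exchange_tsum; apply: eq_tsum => Y1 Y2.
under eq_tsum => X1 X2.
  rewrite -csig_mid (linear_out (g := fun x => (a * x) ⊗ (X2 * Y2) : T)); last by lin.
  over.
rewrite (comul_coassocf (f := fun x y z => (a * (cact c x (i b) * σ y Y1)) ⊗ (z * Y2)
  : T)).
- by apply: eq_tsum => *; apply: eq_tsum => *; rewrite mulrA.
- by move=> *; lin.
- by move=> *; lin.
- by move=> *; lin.
- by move=> *; rewrite cact_tgt csig_src !mulrA.
- by move=> *; rewrite csig_tgt !mulrA tens_mid mulrA.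
Qed.

Definition crossed_mul_pure n X m Y : T :=
  \tsum_(X1 ⊗ X2 <- Δ X) crossed_section (n * cact c X1 m) X2 Y.

Let balE n m Y : balH (fun X1 X2 => crossed_section (n * cact c X1 m) X2 Y).
Proof. by bal; rewrite /tact cact_tgt crossed_section_src mulrA. Qed.

(** A scalar b passes from m to Y because X ▷ (mb) = (X(1) ▷ m)(X(2) ▷ b) and [csig_mid] absorbs
    X(2) ▷ b into σ. *)
Let balr n X : balT (fun m Y => crossed_mul_pure n X m Y).
Proof.
rewrite /crossed_mul_pure; apply: balancedI => [Y|m|b m Y]; [by lin | by lin |].
under [RHS]eq_tsum do rewrite crossed_section_srcr.
under eq_tsum => X1 X2.
  rewrite cactM (linear_out (g := fun x => crossed_section (n * x) X2 Y)); last by lin.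
  over.
rewrite (comul_coassocf (f := fun x y z => crossed_section (n * (cact c x m * cact c y (i b))) z Y)).
- by apply: eq_tsum => *; apply: eq_tsum => *; rewrite mulrA.
- by move=> *; lin.
- by move=> *; lin.
- by move=> *; lin.
- by move=> *; rewrite cact_tgt cact_src !mulrA.
- by move=> *; rewrite cact_tgt crossed_section_src !mulrA.
Qed.

Let ball m Y : balT (fun n X => crossed_mul_pure n X m Y).
Proof.
have fb n := balE n m Y; rewrite /crossed_mul_pure.
apply: balancedI => [X|n|b n X]; [by lin | by lin |].
by rewrite comul_srclf //; apply: eq_tsum => *; rewrite cact_src mulrA.
Qed.

(** [crossed_mul] sums over representatives; balance in both arguments shows that its value on pure
    tensors is the expected one. *)
Lemma crossed_mul_tens n X m Y :
  crossed_mul c (n ⊗ X) (m ⊗ Y) = crossed_mul_pure n X m Y.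
Proof.
rewrite /crossed_mul.
have fb : balT (fun n X => tsum (m ⊗ Y : T) (fun m Y => crossed_mul_pure n X m Y)).
  apply: balancedI => [X'|n'|b n' X']; last first.
  - by apply: eq_tsum => m' Y'; exact: balanced_mid (ball m' Y') _ _ _.
  - by apply: linear_tsumf => m' Y'; exact: balanced_linr (ball m' Y').
  - by apply: linear_tsumf => m' Y'; exact: balanced_linl (ball m' Y').
by rewrite -[LHS]/(tsum _ (fun n X => tsum (m ⊗ Y
  : T) (fun m Y => crossed_mul_pure n X m Y)))
  !tsum_tens.
Qed.

Lemma crossed_mul_1tens n m Y : crossed_mul c (n ⊗ 1) (m ⊗ Y) = (n * m) ⊗ Y.
Proof.
rewrite crossed_mul_tens /crossed_mul_pure comul1 tsum_tens; last exact: balE.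
rewrite cact_1l /crossed_section comul1 tsum_tens; last exact: balXY.
under eq_tsum do rewrite csig_1l mul1r tens_mid.
by rewrite (comul_counitl L (f := fun Y => (n * m) ⊗ Y : T)); last by lin.
Qed.

Lemma crossed_mul_tens1 n X m :
  crossed_mul c (n ⊗ X) (m ⊗ 1) =
  \tsum_(X1 ⊗ X2 <- Δ X) ((n * cact c X1 m) ⊗ X2).
Proof.
rewrite crossed_mul_tens; apply: eq_tsum => X1 X2.
rewrite /crossed_section exchange_tsum comul1 tsum_tens; last exact: balY.
under eq_tsum do rewrite csig_1r mulr1 tens_mid.
by rewrite (comul_counitl L (f := fun Y => (n * cact c X1 m) ⊗ Y : T)); last by lin.
Qed.

Lemma crossed_mul_sections n X Y :
  crossed_mul c (n ⊗ X) (1 ⊗ Y) = crossed_section n X Y.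
Proof.
rewrite crossed_mul_tens /crossed_mul_pure.
under eq_tsum do rewrite cact_1r -crossed_section_src.
by rewrite (comul_counitl L (f := fun X => crossed_section n X Y)).
Qed.

End CocycleTheory.

(** * Coinvariants, normal basis and anti-Galois property of a crossed product *)

Section CrossedProductGalois.
Variables (k : fieldType) (B H : algType k) (L : hopf_algebroid B H).
Variables (P : algType k) (A : comodule_algebra L P).
Variables (N : algType k) (i : {lrmorphism B -> N}) (c : cocycle L i).
Local Notation s := (src L).
Local Notation t := (tgt L).
Local Notation ε := (counit L).
Local Notation Δ := (comul L).
Local Notation η := (GRing.Linear.sort (eta A)).
Local Notation δ := (coact A).
Local Notation T := (NtensH L i).
Local Notation PdH := (diamond s (fun b p => η b * p)).
Local Notation bal f := (balanced (fun b p => η b * p) (fun b X => s b * X) f).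
Local Notation balT f := (balanced (fun b n => n * i b) (fun b X => s b * X) f).
Variables (phi : {linear P -> T}) (psi : T -> P).
Hypotheses (phiK : cancel phi psi) (psiK : cancel psi phi).
Hypothesis phi1 : phi 1 = 1 ⊗ 1.
Hypothesis phiM : forall p q, phi (p * q) = crossed_mul c (phi p) (phi q).
Hypothesis phi_colinear : colinear δ (NtensH_coact (L := L) (i := i)) phi.

Let psil : linear psi.
Proof. exact: linear_inverse (linearPf phi) phiK psiK. Qed.

Let psi_act b u : psi (NtensH_act b u) = η b * psi u.
Proof. exact: colinear_inv_act phiK psiK phi_colinear b u. Qed.

Let psiM u v : psi (crossed_mul c u v) = psi u * psi v.
Proof. by apply: (can_inj phiK); rewrite phiM !psiK. Qed.

Fact crossed_section_map_linear : linear (fun X : H => psi (1 ⊗ X)).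
Proof. by lin. Qed.

Definition crossed_section_map := linear_pack crossed_section_map_linear.
Local Notation rt := crossed_section_map.

Definition crossed_base n : P := psi (n ⊗ 1).
Local Notation j := crossed_base.

Lemma crossed_base_linear : linear j.
Proof. by rewrite /j; lin. Qed.

Let jl := crossed_base_linear.

Lemma crossed_baseM n m X : psi ((n * m) ⊗ X) = j n * psi (m ⊗ X).
Proof. by rewrite -psiM crossed_mul_1tens. Qed.

Lemma crossed_base_section n X : psi (n ⊗ X) = j n * rt X.
Proof. by rewrite -crossed_baseM mulr1. Qed.

Fact crossed_base_coinv n : j n \in coinvariant A.
Proof.
apply/coinvariantP;
  rewrite (colinear_inv_coact phiK psiK phi_colinear) comul1 tsum_tens //.
bal; rewrite -tens_mid -psi_act.
  by rewrite NtensH_act_tens.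
Qed.

Definition crossed_coinv n : coinv A := Coinv (crossed_base_coinv n).
Local Notation jN := crossed_coinv.

Fact crossed_coinv_linear : linear jN.
Proof. by move=> a m n; apply: val_inj; exact: jl. Qed.

Fact crossed_coinv_monoid : monoid_morphism jN.
Proof.
split; first by apply: val_inj; rewrite /= /j -phi1 phiK.
by move=> m n; apply: val_inj; exact: crossed_baseM.
Qed.

HB.instance Definition _ :=
  GRing.isLinear.Build k N (coinv A) *:%R jN crossed_coinv_linear.
HB.instance Definition _ :=
  GRing.isMonoidMorphism.Build N (coinv A) jN crossed_coinv_monoid.

Definition crossed_coinv_morphism : {lrmorphism N -> coinv A} := jN.

Definition crossed_unit : {lrmorphism B -> coinv A} := crossed_coinv_morphism \o i.

Let val_unit b : val (crossed_unit b) = j (i b).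
Proof. by []. Qed.

Fact crossed_counit_balanced : balT (fun n X => n * i (ε X)).
Proof. by bal; rewrite counit_src rmorphM mulrA. Qed.

Definition crossed_counit p : N := tsum (phi p) (fun n X => n * i (ε X)).

Lemma crossed_counit_linear : linear crossed_counit.
Proof. apply: linear_tsum; [exact: crossed_counit_balanced | exact: linearPf]. Qed.

Let ql := crossed_counit_linear.

Lemma crossed_counit_psi n X : crossed_counit (psi (n ⊗ X)) = n * i (ε X).
Proof. by rewrite /crossed_counit psiK tsum_tens //; exact: crossed_counit_balanced. Qed.

Lemma crossed_counit_base n p : crossed_counit (j n * p) = n * crossed_counit p.
Proof.
rewrite -(phiK p); move: (phi p).
apply: eq_linear_tens => [||m X]; [by lin | by lin |].
by rewrite -crossed_baseM !crossed_counit_psi mulrA.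
Qed.

Lemma crossed_counit_eta b p : crossed_counit (η b * p) = crossed_counit p * i b.
Proof.
rewrite -(phiK p) -psi_act; move: (phi p).
have actl := @NtensH_act_linear _ _ _ L _ i b.
apply: eq_linear_tens => [||m X]; [by lin | by lin |].
by rewrite NtensH_act_tens !crossed_counit_psi counit_tgt rmorphM mulrA.
Qed.

(** If n ⊗ X represents φ(x) for a coinvariant x, then n ⊗ X(1) ⊗ X(2) = n ⊗ X ⊗ 1; applying ε to
    the middle leg gives φ(x) = nε(X) ⊗ 1. So every coinvariant comes from N. *)
Lemma crossed_coinvK (x : coinv A) : jN (crossed_counit (val x)) = x.
Proof.
apply: val_inj => /=; apply: (can_inj phiK); rewrite psiK.
have Fb : balanced (NtensH_act (L := L) (i := i)) (fun b X => s b * X)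
    (fun (u : T) Y => tsum u (fun n X => n * i (ε X)) ⊗ Y : T).
  have fb := crossed_counit_balanced.
  bal; rewrite -tens_mid -[m]psiK -(phi_colinear.1) -[LHS]/(crossed_counit _ ⊗ _).
  by rewrite crossed_counit_eta.
have := congr1 (fun u => tsum u (fun u Y => tsum u (fun n X => n * i (ε X)) ⊗ Y : T))
  (phi_colinear.2 (val x)).
rewrite (coinvariantP _ _ (valP x)) [RHS]tsum_tsum // [RHS]tsum_tens; last first.
  by bal; rewrite phi_colinear.1 tens_mid.
rewrite tsum_tens // => e; rewrite -[LHS]e [LHS]tsum_tsum //.
rewrite -[RHS]tsum_tensE; apply: eq_tsum => n X; rewrite tsum_tsum //.
rewrite -[RHS](comul_counitl L (f := fun X => n ⊗ X : T)); last by lin.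
apply: eq_tsum => X1 X2; rewrite tsum_tens // tsum_tens ?tens_mid //.
exact: crossed_counit_balanced.
Qed.

Let rt_tgt b X : rt (t b * X) = η b * rt X.
Proof. by rewrite /= -psi_act NtensH_act_tens. Qed.

Lemma crossed_section_map_src b X : rt (s b * X) = val (crossed_unit b) * rt X.
Proof. by rewrite val_unit -crossed_base_section -[i b]mul1r tens_mid. Qed.

Lemma crossed_section_map_colinear : colinear Δ δ rt.
Proof. by split=> // X; exact: (colinear_inv_coact phiK psiK phi_colinear). Qed.

Lemma crossed_section_map_base X n :
  rt X * j n = \tsum_(X1 ⊗ X2 <- Δ X) (j (cact c X1 n) * rt X2).
Proof.
rewrite /= -psiM crossed_mul_tens1 (linear_out (g := psi)) //.
by apply: eq_tsum => *; rewrite mul1r crossed_base_section.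
Qed.

Lemma crossed_section_mapM X Y :
  rt X * rt Y = \tsum_(X1 ⊗ X2 <- Δ X) \tsum_(Y1 ⊗ Y2 <- Δ Y)
    (j (csig c (X1 ⊗ Y1)) * rt (X2 * Y2)).
Proof.
rewrite /= -psiM crossed_mul_sections (linear_out (g := psi)) //.
apply: eq_tsum => *; rewrite (linear_out (g := psi)) //.
by apply: eq_tsum => *; rewrite mul1r crossed_base_section.
Qed.

Definition crossed_proj : {linear P -> coinv A} :=
  linear_pack (linear_comp_fun crossed_coinv_linear ql).
Local Notation pi := crossed_proj.

Lemma crossed_proj_mull n p : pi (val n * p) = n * pi p.
Proof.
by rewrite -{1}[n]crossed_coinvK /= crossed_counit_base (rmorphM crossed_coinv_morphism)
  /= crossed_coinvK.
Qed.

Lemma crossed_proj_eta b p : pi (η b * p) = pi p * crossed_unit b.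
Proof. by rewrite /= crossed_counit_eta (rmorphM crossed_coinv_morphism). Qed.

Lemma crossed_proj_section X : pi (rt X) = crossed_unit (ε X).
Proof. by rewrite /= crossed_counit_psi mul1r. Qed.

Lemma crossed_proj_coact p : \tsum_(p0 ⊗ p1 <- δ p) (val (pi p0) * rt p1) = p.
Proof.
have Gb : bal (fun p X => val (pi p) * rt X).
  by bal; rewrite crossed_proj_eta crossed_section_map_src coinv_valM mulrA.
rewrite -[RHS]phiK -[in LHS](phiK p); move: (phi p).
apply: (eq_linear_tens (g := fun u => tsum (δ (psi u)) (fun p X => val (pi p) * rt X))) => [||n X].
- by lin.
- exact: psil.
rewrite (colinear_inv_coact phiK psiK phi_colinear) tsum_tsum //.
under eq_tsum => X1 X2.
  rewrite tsum_tens // [val (pi _)]/(j (crossed_counit _)) crossed_counit_psi.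
  rewrite -crossed_base_section tens_mid.
  over.
by rewrite (comul_counitl L (f := fun X => psi (n ⊗ X))) //; lin.
Qed.

Lemma crossed_unit_inj : injective i -> injective crossed_unit.
Proof.
move=> i_inj a b e; apply: i_inj.
have : j (i a) = j (i b) by rewrite -!val_unit e.
move/(congr1 crossed_counit); rewrite !crossed_counit_psi counit1 rmorph1 !mulr1.
by [].
Qed.

Lemma crossed_normal_basis : injective i -> normal_basis A.
Proof.
move=> /crossed_unit_inj i_inj.
exists crossed_unit, (normal_basis_map crossed_proj_eta); split=> //.
- exact: normal_basis_map_bij crossed_section_map_colinear crossed_section_map_src
    crossed_proj_mull crossed_proj_eta crossed_proj_section crossed_proj_coact.
- move=> n p; rewrite !normal_basis_mapP coact_coinvl;
  last exact: normal_basis_balanced crossed_proj_eta.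
  rewrite (linear_out (g := @NtensH_lmul _ _ _ L _ crossed_unit n));
    last exact: NtensH_lmul_linear.
  by apply: eq_tsum => *; rewrite NtensH_lmul_tens crossed_proj_mull.
- exact: normal_basis_map_colinear.
Qed.

(** The algebra map N → P^{co H} carries the axioms of σ and σ^-1 to the hypotheses of
    [cocycle_anti_galois]. *)
Lemma crossed_anti_galois : invertible_cocycle c -> anti_galois A.
Proof.
move=> [sigV [sv_lin sv_mid cK cVK]].
have jM := rmorphM crossed_coinv_morphism.
have jN1 := rmorph1 crossed_coinv_morphism.
pose sg X Y := jN (csig c (X ⊗ Y)).
pose sv X Y := jN (sigV (X ⊗ Y)).
pose ac X b := jN (cact c X (i b)).
have jl' := crossed_coinv_linear.
have actl := cact_linl c.
apply: (cocycle_anti_galois crossed_section_map_colinear crossed_section_map_src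
  crossed_proj_mull crossed_proj_eta crossed_proj_section crossed_proj_coact
  (sg := sg) (sv := sv) (ac := ac)); rewrite /sg /sv /ac.
- by move=> Y; lin.
- by move=> X; lin.
- by move=> Y; lin.
- by move=> X; lin.
- by move=> b; lin.
- by move=> X b; exact: crossed_section_map_base.
- exact: crossed_section_mapM.
- by move=> b b' X; rewrite cact_tgt [LHS]jM.
- by move=> b b' X; rewrite cact_src [LHS]jM.
- by move=> b X Y; rewrite csig_src [LHS]jM.
- by move=> b X Y; rewrite csig_tgt [LHS]jM.
- by move=> b X Y; rewrite csig_bal.
- move=> b X Y; rewrite -csig_mid (linear_out (g := jN)) //.
  by apply: eq_tsum => *; rewrite -[LHS]jM.
- by move=> b X Y; have := sv_lin b 1 X Y; rewrite tgt1 mulr1 rmorph1 mulr1 => ->;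
  rewrite [LHS]jM.
- by move=> b X Y; have := sv_lin 1 b X Y; rewrite src1 mul1r rmorph1 mul1r => ->;
  rewrite [LHS]jM.
- by move=> b X Y; rewrite tens_mid.
- move=> b X Y; rewrite -sv_mid (linear_out (g := jN)) //.
  by apply: eq_tsum => *; rewrite -[LHS]jM.
- move=> X Y; rewrite -(cact_1r c) -cK (linear_out (g := jN)) //; apply: eq_tsum => *.
  by rewrite (linear_out (g := jN)) //; apply: eq_tsum => *; rewrite -[LHS]jM.
- move=> X Y; transitivity (jN (cact c (X * Y) 1)); last by rewrite cact_1r.
  rewrite -cVK (linear_out (g := jN)) //; apply: eq_tsum => *.
  by rewrite (linear_out (g := jN)) //; apply: eq_tsum => *; rewrite -[LHS]jM.
Qed.

End CrossedProductGalois.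

Lemma crossed_product_anti_galois (k : fieldType) (B H P : algType k)
    (L : hopf_algebroid B H) (A : comodule_algebra L P) :
  crossed_product A -> anti_galois A /\ normal_basis A.
Proof.
move=> [N [i [c [i_inj c_inv [phi [[psi phiK psiK] phi1 phiM _ phi_colinear]]]]]].
split; first exact: (crossed_anti_galois phiK psiK phi1 phiM phi_colinear c_inv).
exact: (crossed_normal_basis phiK psiK phi1 phiM phi_colinear i_inj).
Qed.

Theorem theorem3p21 (k : fieldType) (B H : algType k) (HH : hopf_algebroid B H)
    (P : algType k) (A : comodule_algebra HH P) :
  (anti_cleft A <-> (anti_galois A /\ normal_basis A)) /\
  ((anti_galois A /\ normal_basis A) <-> crossed_product A).
Proof.
have c12 : anti_galois A /\ normal_basis A -> anti_cleft A.
  by move=> [gA nA]; exact: anti_galois_normal_basis_anti_cleft.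
have c23 : crossed_product A -> anti_galois A /\ normal_basis A.
  exact: crossed_product_anti_galois.
split; split=> //; first by move/anti_cleft_crossed_product/c23.
by move/c12/anti_cleft_crossed_product.
Qed.
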